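(* Let $\vec p=(p_1,\dots,p_n)$ with $1<p_i<\infty$ for all $i$, and let $t,r$ satisfy either $1<\frac{n}{\sum_{i=1}^n1/p_i}<t<r<\infty$ or $1<\frac{n}{\sum_{i=1}^n1/p_i}\le t<r=\infty$. Then the Hardy-Littlewood maximal operator $\mathcal M$ is bounded on $M_{\vec p}^{t,r}$.
   Context: The Hardy-Littlewood maximal operator is $\mathcal Mf(x)=\sup_{B\ni x}\frac1{|B|}\int_B|f(y)|\,dy$, the supremum being over all balls $B\subset\mathbb R^n$ containing $x$. $\mathcal D$ is the family of dyadic cubes $Q_{j,k}=\prod_{i=1}^n[2^{-j}k_i,2^{-j}(k_i+1))$, $j\in\mathbb Z$, $k\in\mathbb Z^n$. Mixed Lebesgue norm: for measurable $f$ on $\mathbb R^n$, $$\|f\|_{L^{\vec p}}=\Big(\int_{\mathbb R}\cdots\Big(\int_{\mathbb R}|f(x_1,\dots,x_n)|^{p_1}dx_1\Big)^{p_2/p_1}\cdots dx_n\Big)^{1/p_n}$$ (innermost integration in $x_1$). Mixed Bourgain-Morrey space $M_{\vec p}^{t,r}$: all measurable $f$ on $\mathbb R^n$ with $$\|f\|_{M_{\vec p}^{t,r}}=\Big(\sum_{Q\in\mathcal D}|Q|^{\frac rt-\frac rn\sum_{i=1}^n\frac1{p_i}}\|f\chi_Q\|_{L^{\vec p}}^r\Big)^{1/r}<\infty$$ (supremum over $Q\in\mathcal D$ if $r=\infty$). *)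

(* Defs.v *)
From HB Require Import structures.
From mathcomp Require Import all_boot all_order all_algebra.
From mathcomp Require Import all_classical all_reals all_analysis.
From mathcomp Require Import measurable_realfun.

Set Implicit Arguments.
Unset Strict Implicit.
Unset Printing Implicit Defensive.
Import Order.TTheory GRing.Theory Num.Theory.
Import numFieldNormedType.Exports.

Local Open Scope classical_set_scope.
Local Open Scope ring_scope.
Local Open Scope ereal_scope.

(* [measurable] on this type is the Borel sigma-algebra of R^n. *)
Notation Rn R n := (n.-tuple (measurableTypeR R)).

Definition Rn_cons (R : realType) (n : nat)
  (xy : measurableTypeR R * Rn R n) : Rn R n.+1 := [tuple of xy.1 :: xy.2].

Lemma measurable_Rn_cons (R : realType) (n : nat) :
  measurable_fun [set: measurableTypeR R * Rn R n] (@Rn_cons R n).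
Proof. exact: measurable_cons. Qed.

Lemma product_sigma_finite d1 d2 (T1 : measurableType d1)
    (T2 : measurableType d2) (R : realType)
    (m1 : {sigma_finite_measure set T1 -> \bar R})
    (m2 : {sigma_finite_measure set T2 -> \bar R}) :
  sigma_finite setT (m1 \x m2).
Proof.
have /sigma_finiteP[F [TF ndF Foo]] := sigma_finiteT m1.
have /sigma_finiteP[G [TG ndG Goo]] := sigma_finiteT m2.
exists (fun k => F k `*` G k).
  rewrite -setXTT TF TG predeqE => -[x y]; split.
    move=> [/= [i _ Fix] [j _ Gjy]]; exists (maxn i j) => //; split.
    - by move: x Fix; exact/subsetPset/ndF/leq_maxl.
    - by move: y Gjy; exact/subsetPset/ndG/leq_maxr.
  by move=> [k _ []/= ? ?]; split; exists k.
move=> k; have [? ?] := Foo k; have [? ?] := Goo k.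
split; first exact: measurableX.
by rewrite product_measure1E// lte_mul_pinfty// ge0_fin_numE.
Qed.

Section lebesgue_step.
Context (R : realType) (n : nat).
Variable m : {sigma_finite_measure set (Rn R n) -> \bar R}.

Definition lebesgue_step : set (Rn R n.+1) -> \bar R :=
  pushforward (lebesgue_measure \x m) (@Rn_cons R n).

Let step0 : lebesgue_step set0 = 0.
Proof. by rewrite /lebesgue_step /pushforward preimage_set0 measure0. Qed.

Let step_ge0 A : 0 <= lebesgue_step A.
Proof. by rewrite /lebesgue_step /pushforward; exact: measure_ge0. Qed.

Let step_sigma_additive : semi_sigma_additive lebesgue_step.
Proof.
move=> F mF tF mUF; rewrite /lebesgue_step /pushforward preimage_bigcup.
apply: measure_semi_sigma_additive.
- by move=> k; rewrite -[X in measurable X]setTI; exact: measurable_Rn_cons.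
- apply/trivIsetP => /= i j _ _ ij; rewrite -preimage_setI.
  by move/trivIsetP : tF => /(_ _ _ _ _ ij) ->//; rewrite preimage_set0.
- by rewrite -preimage_bigcup -[X in measurable X]setTI;
    exact: measurable_Rn_cons.
Qed.

HB.instance Definition _ := isMeasure.Build _ _ _
  lebesgue_step step0 step_ge0 step_sigma_additive.

Let step_sigma_finite : sigma_finite setT lebesgue_step.
Proof.
have [F TF Foo] := product_sigma_finite lebesgue_measure m.
pose split_Rn (x : Rn R n.+1) : measurableTypeR R * Rn R n :=
  (thead x, [tuple of behead x]).
have splitK x : split_Rn (Rn_cons x) = x.
  by case: x => a b; congr pair; apply/val_inj.
exists (fun k => split_Rn @^-1` F k); first by rewrite -preimage_bigcup -TF.
move=> k; have [mF Fk] := Foo k; split.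
  rewrite -[X in measurable X]setTI.
  apply: measurable_fun_pair => //; first exact: measurable_tnth.
  exact: measurable_behead.
rewrite /lebesgue_step /pushforward -comp_preimage.
by rewrite (_ : _ \o _ = id) //; apply/funext => x /=; exact: splitK.
Qed.

HB.instance Definition _ := Measure_isSigmaFinite.Build _ _ _
  lebesgue_step step_sigma_finite.

End lebesgue_step.

(* n-dimensional Lebesgue measure, on Borel sets: the n-fold product of the
   one-dimensional one. *)
Fixpoint lebesgue_Rn (R : realType) (n : nat) :
    {sigma_finite_measure set (Rn R n) -> \bar R} :=
  match n with
  | 0%N => [the sigma_finite_measure _ _ of \d_([tuple] : Rn R 0)]
  | m.+1 => [the sigma_finite_measure _ _ of lebesgue_step (lebesgue_Rn R m)]
  end.

(* Lebesgue measurability, i.e. measurability for the completed sigma-algebra.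
   Below, nonnegative Lebesgue measurable functions are integrated with the
   integral of the Borel measure: being a supremum over Borel simple functions
   below the integrand, it agrees with the integral of the completion, and it is
   insensitive to the null set of slices that are not measurable. *)
Definition lebesgue_measurable_fun (R : realType) (n : nat)
    (f : Rn R n -> \bar R) :=
  measurable_fun
    [set: g_sigma_algebraType (completed_algebra_gen (lebesgue_Rn R n))] f.

Definition euclidean_ball (R : realType) (n : nat) (c : Rn R n) (rho : R) :
    set (Rn R n) :=
  [set y | (Num.sqrt (\sum_(i < n) (tnth y i - tnth c i) ^+ 2) < rho)%R].

Definition balls (R : realType) (n : nat) : set (set (Rn R n)) :=
  [set B | exists (c : Rn R n) (rho : R), (0 < rho)%R /\
                                          B = euclidean_ball c rho].

Definition hl_maximal (R : realType) (n : nat) (f : Rn R n -> \bar R) :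
    Rn R n -> \bar R := fun x =>
  ereal_sup [set (lebesgue_Rn R n B)^-1 *
                 \int[lebesgue_Rn R n]_(y in B) `|f y|
            | B in [set B | balls B /\ B x]].

Definition dyadic_cube (R : realType) (n : nat) (j : int) (k : n.-tuple int) :
    set (Rn R n) :=
  [set x | forall i : 'I_n,
    (2 ^ (- j) * (tnth k i)%:~R <= tnth x i < 2 ^ (- j) * (tnth k i + 1)%:~R)%R].

Definition dyadic_cubes (R : realType) (n : nat) : set (set (Rn R n)) :=
  [set Q | exists j k, Q = @dyadic_cube R n j k].

(* The first coordinate is integrated out at each step; q is the exponent used
   at the previous one, so that the successive powers are p_1, p_2/p_1, ...,
   p_n/p_(n-1) and finally 1/p_n when starting from q = 1. *)
Fixpoint iterated_norm (R : realType) (n : nat) (q : R) :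
    n.-tuple R -> (Rn R n -> \bar R) -> \bar R :=
  match n with
  | 0%N => fun _ g => g [tuple] `^ q^-1
  | m.+1 => fun p g => iterated_norm (thead p) [tuple of behead p]
      (fun y : Rn R m =>
         \int[lebesgue_measure]_x (g (Rn_cons (x, y)) `^ (thead p / q)))
  end.

Definition mixed_norm (R : realType) (n : nat) (p : n.-tuple R)
    (f : Rn R n -> \bar R) : \bar R :=
  iterated_norm 1%R p (fun x => `|f x|).

Definition sum_inv (R : realType) (n : nat) (p : n.-tuple R) : R :=
  (\sum_(i < n) (tnth p i)^-1)%R.

(* The value for r = -oo is irrelevant. *)
Definition bourgain_morrey_norm (R : realType) (n : nat) (p : n.-tuple R)
    (t : R) (r : \bar R) (f : Rn R n -> \bar R) : \bar R :=
  let mu := lebesgue_Rn R n in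
  let local_norm Q := mixed_norm p (fun x => f x * (\1_Q x)%:E) in
  match r with
  | s%:E =>
      (\esum_(Q in @dyadic_cubes R n)
         (mu Q `^ (s / t - s / n%:R * sum_inv p) * local_norm Q `^ s)) `^ s^-1
  | +oo =>
      ereal_sup [set mu Q `^ (1 / t - 1 / n%:R * sum_inv p) * local_norm Q
                | Q in @dyadic_cubes R n]
  | -oo => 0
  end.

Definition bourgain_morrey (R : realType) (n : nat) (p : n.-tuple R)
    (t : R) (r : \bar R) : set (Rn R n -> \bar R) :=
  [set f | lebesgue_measurable_fun f /\ bourgain_morrey_norm p t r f < +oo].

(* Main.v *)
Require Import Defs.
From mathcomp Require Import all_boot all_order all_algebra.
From mathcomp Require Import all_classical all_reals all_analysis.
From mathcomp Require Import measurable_realfun.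
From mathcomp Require Import ring lra zify.

(* Fix a dyadic cube Q. Balls of diameter larger than the side of Q contribute
   to M f on Q at most a constant, which Hoelder's inequality bounds by the
   local norms of f on the 3^n neighbours of the ancestors of Q. Writing b(Q)
   for the term of Q in the Bourgain-Morrey norm, the ancestor of generation l
   comes with the factor 2^(-l n/t). The smaller balls see only f on the
   neighbours of Q and are controlled by the boundedness of M on L^p with mixed
   exponents. Thus b_{M f}(Q) is at most a constant times
   sup_l 2^(-l n/t) sum_nu b_f(l-th ancestor of Q, shifted by nu). Taking r-th
   powers and summing over Q, each cube is reached from 2^(l n) cubes Q, and the
   geometric series of ratio 2^(n - r n/t) converges because t < r.

   The mixed-norm bound is proved on finite grids, with constants independent of
   the mesh, and transferred by monotone convergence. The n-dimensional
   averages over triples of dyadic cubes are dominated by iterating the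
   one-dimensional ones, and each step is a vector-valued maximal inequality
   with values in a normed lattice Phi: if M is bounded on L^q(Phi) for one q,
   then it is bounded on L^p(Phi) for all p > 1, by a good-lambda inequality
   between Phi(M a) and M(Phi(a)). Since M is bounded on L^p(l^p(Phi)) as soon as
   it is on L^p(Phi), one can pass from each exponent to the next.

   A Lebesgue measurable f is first replaced by a Borel function g <= |f| that is
   equal to |f| almost everywhere; this does not change M f. *)

Set Implicit Arguments.
Unset Strict Implicit.
Unset Printing Implicit Defensive.
Import Order.TTheory GRing.Theory Num.Theory.
Import numFieldNormedType.Exports.

Local Open Scope classical_set_scope.
Local Open Scope ring_scope.

(** * Discrete maximal functions on one-dimensional grids *)

(** The triple of a cube has 3 * 2^L cells per coordinate. On this finite grid maxima and sums are
    finite reals, and functions with values in a lattice raise no question of measurability; only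
    uniformity of the constants in L has to be watched. The obstacle is that the exponents differ.
    Once M has been removed in x_1, the other coordinates carry functions with values in l^(p_1).
    Exchanging sums gives boundedness on L^(p_1)(l^(p_1)), whereas the next coordinate asks for
    L^(p_2)(l^(p_1)), with p_2 smaller or larger than p_1. The extrapolation therefore keeps the
    lattice and moves the exponent in either direction, without duality: all dependence on p sits in
    the scalar maximal inequality for M(Phi(a)) and in the summation over levels. Its constant must
    not depend on the lattice, which changes at each coordinate. *)

(* Cells are numbered by integers; the dyadic block of level [l] containing [m] is
   [m %/ 2 ^ l], and near blocks are equal or adjacent. *)
Definition same_block (l m m' : nat) : bool := (m %/ 2 ^ l == m' %/ 2 ^ l)%N.

Definition near_block (l m m' : nat) : bool :=
  (m %/ 2 ^ l <= (m' %/ 2 ^ l).+1)%N && (m' %/ 2 ^ l <= (m %/ 2 ^ l).+1)%N.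

Lemma same_block_sym l m m' : same_block l m m' = same_block l m' m.
Proof. exact: eq_sym. Qed.

Lemma same_blockW l l' m m' :
  (l <= l')%N -> same_block l m m' -> same_block l' m m'.
Proof.
move=> /subnKC <- /eqP e; apply/eqP.
by rewrite expnD !divnMA e.
Qed.

Lemma same_block_eql l m m' k :
  same_block l m m' -> same_block l m k = same_block l m' k.
Proof. by rewrite /same_block => /eqP ->. Qed.

Lemma near_block_sym l m m' : near_block l m m' = near_block l m' m.
Proof. exact: andbC. Qed.

Lemma near_block_eql l m m' k :
  same_block l m m' -> near_block l m k = near_block l m' k.
Proof. by rewrite /near_block => /eqP ->. Qed.

Lemma near_block_eqr l m m' k :
  same_block l m m' -> near_block l k m = near_block l k m'.
Proof. by rewrite /near_block => /eqP ->. Qed.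

Lemma near_blockW l l' m m' :
  (l <= l')%N -> near_block l m m' -> near_block l' m m'.
Proof.
have key (a b d : nat) : (a <= b.+1)%N -> (a %/ 2 ^ d <= (b %/ 2 ^ d).+1)%N.
  move=> ab; apply: (leq_trans (leq_div2r _ ab)).
  rewrite -addn1 divnD ?expn_gt0//.
  have : (1 %/ 2 ^ d <= 1)%N by rewrite leq_div.
  case: d {ab} => [|d]; first by rewrite expn0 !divn1 !modn1; lia.
  have e1 : (1 < 2 ^ d.+1)%N by rewrite -{1}(expn0 2) ltn_exp2l.
  by rewrite (divn_small e1); case: leqP => _; lia.
move=> /subnKC <- /andP[h1 h2]; rewrite /near_block expnD !divnMA.
by apply/andP; split; exact: key.
Qed.

Lemma card_block_le (n l c : nat) : (#|[pred m : 'I_n | m %/ 2 ^ l == c]| <= 2 ^ l)%N.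
Proof.
have h0 : (0 < 2 ^ l)%N by rewrite expn_gt0.
pose f (m : 'I_n) : 'I_(2 ^ l) := Ordinal (ltn_pmod m h0).
rewrite -[X in (_ <= X)%N]card_ord -(card_in_imset (f := f)); first exact: max_card.
move=> m m' /=; rewrite !inE => /eqP hm /eqP hm' [] e.
by apply: val_inj => /=; rewrite (divn_eq m (2 ^ l)) (divn_eq m' (2 ^ l)) hm hm' e.
Qed.

(** An equality because 2^l divides 3 * 2^L: no block is cut off at the end of the grid. Hence
    [block_avg] is a true average. *)
Lemma card_same_block L l (k : 'I_(3 * 2 ^ L)) : (l <= L)%N ->
  #|[pred m : 'I_(3 * 2 ^ L) | same_block l k m]| = (2 ^ l)%N.
Proof.
move=> lL; apply/eqP; rewrite eqn_leq; apply/andP; split.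
  have -> : [pred m : 'I_(3 * 2 ^ L) | same_block l k m] =
            [pred m : 'I_(3 * 2 ^ L) | m %/ 2 ^ l == k %/ 2 ^ l]%N.
    by rewrite /same_block; under eq_fun do rewrite eq_sym.
  exact: card_block_le.
have h0 : (0 < 2 ^ l)%N by rewrite expn_gt0.
have hk (i : 'I_(2 ^ l)) : (k %/ 2 ^ l * 2 ^ l + i < 3 * 2 ^ L)%N.
  have hd : (2 ^ l %| 3 * 2 ^ L)%N by rewrite dvdn_mull// dvdn_exp2l.
  have hq : (k %/ 2 ^ l < (3 * 2 ^ L) %/ 2 ^ l)%N by rewrite ltn_divLR// divnK.
  apply: (@leq_trans ((k %/ 2 ^ l).+1 * 2 ^ l)%N).
    by rewrite [leqRHS]mulSn [leqRHS]addnC ltn_add2l.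
  by rewrite -[leqRHS](divnK hd) leq_mul2r hq orbT.
pose f (i : 'I_(2 ^ l)) : 'I_(3 * 2 ^ L) := Ordinal (hk i).
have finj : injective f by move=> i j [] /eqP; rewrite eqn_add2l => /eqP /val_inj.
rewrite -[X in (X <= _)%N]card_ord -(card_imset _ finj).
apply: subset_leq_card; apply/fintype.subsetP => m /imsetP[i _ ->].
by rewrite !inE /same_block /= divnMDl// (divn_small (ltn_ord i)) addn0.
Qed.

Lemma card_near_block n l (k : nat) :
  (#|[pred m : 'I_n | near_block l k m]| <= 3 * 2 ^ l)%N.
Proof.
pose P c := [pred m : 'I_n | m %/ 2 ^ l == c]%N.
have sub : {subset [pred m : 'I_n | near_block l k m] <=
    [predU [predU P (k %/ 2 ^ l).-1 & P (k %/ 2 ^ l)%N] & P (k %/ 2 ^ l).+1]}.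
  move=> m; rewrite !inE /near_block.
  by move: (k %/ 2 ^ l)%N (m %/ 2 ^ l)%N => a b; lia.
apply: (leq_trans (subset_leq_card (introT fintype.subsetP sub))).
have hU (A B : pred 'I_n) : (#|[predU A & B]| <= #|A| + #|B|)%N.
  by rewrite -cardUI leq_addr.
apply: (leq_trans (hU _ _)); apply: (leq_trans (leq_add (hU _ _) (leqnn _))).
have c c0 := card_block_le n l c0.
by rewrite (_ : 3 * 2 ^ l = 2 ^ l + 2 ^ l + 2 ^ l)%N ?leq_add ?c//; lia.
Qed.

Section stopping.
Variables (R : realType) (L : nat).
Local Notation T := 'I_(3 * 2 ^ L).

Definition block_avg (a : T -> R) (l : nat) (k : T) : R :=
  (2 ^+ l)^-1 * \sum_(m : T | same_block l k m) a m.

(** Normalised by the size of one block although up to three are summed; this is the origin of the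
    factors 3 below. *)
Definition near_avg (a : T -> R) (l : nat) (k : T) : R :=
  (2 ^+ l)^-1 * \sum_(m : T | near_block l k m) a m.

Lemma block_avg_eq a l (k k' : T) : same_block l k k' -> block_avg a l k = block_avg a l k'.
Proof. by move=> h; congr *%R; apply: eq_bigl => m; exact: same_block_eql. Qed.

Lemma near_avg_eq a l (k k' : T) : same_block l k k' -> near_avg a l k = near_avg a l k'.
Proof. by move=> h; congr *%R; apply: eq_bigl => m; exact: near_block_eql. Qed.

Lemma block_avg_ge0 a l k : (forall m, 0 <= a m) -> 0 <= block_avg a l k.
Proof. by move=> a0; rewrite mulr_ge0 ?sumr_ge0// invr_ge0 exprn_ge0. Qed.

Lemma le_near_avg a b l (k : T) : (forall m : T, near_block l k m -> a m <= b m) ->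
  near_avg a l k <= near_avg b l k.
Proof. by move=> ab; rewrite ler_wpM2l ?invr_ge0 ?exprn_ge0// ler_sum. Qed.

Lemma near_avgD a b l k :
  near_avg (fun m => a m + b m) l k = near_avg a l k + near_avg b l k.
Proof. by rewrite /near_avg big_split/= mulrDr. Qed.

Lemma block_avg_le_near a l (k m : T) : (forall m, 0 <= a m) -> near_block l k m ->
  block_avg a l m <= near_avg a l k.
Proof.
move=> a0 h; rewrite ler_wpM2l ?invr_ge0 ?exprn_ge0//.
rewrite [leRHS]big_mkcond [leLHS]big_mkcond ler_sum// => i _.
case: ifPn => [s|_]; last by case: ifPn.
by rewrite -(near_block_eqr _ s) h.
Qed.

Lemma block_avgS_le a l k : (forall m, 0 <= a m) ->
  block_avg a l k <= 2 * block_avg a l.+1 k.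
Proof.
move=> a0; rewrite /block_avg mulrA exprS invfM mulrA divff ?mul1r//.
rewrite ler_wpM2l ?invr_ge0 ?exprn_ge0//.
rewrite [leRHS]big_mkcond [leLHS]big_mkcond ler_sum// => i _.
case: ifPn => [s|_]; last by case: ifPn.
by rewrite (same_blockW (leqnSn l) s).
Qed.

(* A stopping time: [sigma m] is constant on the block of level [sigma m] around
   [m], so these blocks partition the cells. *)
Definition stopping (sigma : T -> nat) : Prop :=
  (forall m, (sigma m <= L)%N) /\
  forall m m' : T, same_block (sigma m) m m' -> sigma m' = sigma m.

(** Averaging over stopping blocks preserves sums over unions of such blocks: after exchanging the
    sums, each [a m] is collected 2^(sigma m) times with the weight 2^-(sigma m). *)
Lemma stopping_sum sigma (S : pred T) a : stopping sigma ->
  (forall m m' : T, S m -> same_block (sigma m) m m' -> S m') ->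
  \sum_(m | S m) block_avg a (sigma m) m = \sum_(m | S m) a m.
Proof.
move=> [sL sc] Sc; rewrite /block_avg.
under eq_bigr do rewrite mulr_sumr.
rewrite (exchange_big_dep S)/=; last by move=> m m' Sm /Sc; apply.
apply: eq_bigr => m Sm.
rewrite (eq_bigl (fun i : T => same_block (sigma m) m i)); last first.
  move=> i; apply/idP/idP.
    by move=> /andP[Si h]; rewrite (sc _ _ h) same_block_sym.
  by move=> h; rewrite (Sc _ _ Sm h)/= (sc _ _ h) same_block_sym.
rewrite (eq_bigr (fun=> (2 ^+ sigma m)^-1 * a m)); last by move=> i /sc ->.
rewrite sumr_const (eq_card (B := [pred i : T | same_block (sigma m) m i]))//.
rewrite card_same_block// -[LHS]mulr_natr natrX mulrAC mulVf ?mul1r//.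
Qed.

End stopping.

Section discrete_maximal.
Variables (R : realType) (L : nat).
Local Notation T := 'I_(3 * 2 ^ L).

Definition near_max (a : T -> R) (k : T) : R :=
  \big[Num.max/0]_(l < L.+1) near_avg a l k.

Lemma near_max_ge0 a k : 0 <= near_max a k.
Proof. exact: bigmax_ge_id. Qed.

Lemma near_avg_le_max a l k : (l <= L)%N -> near_avg a l k <= near_max a k.
Proof.
rewrite -ltnS => lL.
exact: (le_bigmax _ (fun l : 'I_L.+1 => near_avg a l k) (Ordinal lL)).
Qed.

Lemma near_max_le a k c : 0 <= c ->
  (forall l, (l <= L)%N -> near_avg a l k <= c) -> near_max a k <= c.
Proof. by move=> c0 h; apply: bigmax_le => // l _; rewrite h// -ltnS. Qed.

Lemma near_max_gt a k c : 0 <= c -> c < near_max a k ->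
  exists2 l, (l <= L)%N & c < near_avg a l k.
Proof.
move=> c0; apply: contraPP => h; apply/negP; rewrite -leNgt near_max_le// => l lL.
by rewrite leNgt; apply/negP => cl; apply: h; exists l.
Qed.

Lemma sum_near_const n l (k : nat) (c : R) : 0 <= c ->
  \sum_(m : 'I_n | near_block l k m) c <= 2 ^+ l * (3 * c).
Proof.
move=> c0; rewrite sumr_const -[leLHS]mulr_natl mulrA ler_wpM2r//.
rewrite -natrX -natrM ler_nat [X in (_ <= X)%N]mulnC; exact: card_near_block.
Qed.

(** If no level satisfies [P], the empty maximum is 0. This default is harmless: blocks of level 0
    are single cells. *)
Definition stop_level (P : nat -> T -> bool) (n : nat) (m : T) : nat :=
  \max_(l < n.+1 | P l m) l.

Section stop_level_theory.
Variables (P : nat -> T -> bool) (n : nat).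
Hypothesis nL : (n <= L)%N.
Hypothesis PE : forall l (m m' : T), same_block l m m' -> P l m = P l m'.
Local Notation sigma := (stop_level P n).

Lemma stop_level_le m : (sigma m <= n)%N.
Proof. by apply/bigmax_leqP => i _; rewrite -ltnS. Qed.

Lemma stop_level_ex m l : (l <= n)%N -> P l m -> (l <= sigma m)%N /\ P (sigma m) m.
Proof.
rewrite -ltnS => ln h; split.
  exact: (@leq_bigmax_cond _ _ (fun i : 'I_n.+1 => i : nat) (Ordinal ln) h).
have ne : (0 < #|[pred l : 'I_n.+1 | P l m]|)%N.
  by apply/card_gt0P; exists (Ordinal ln).
have [i] := eq_bigmax_cond (fun i : 'I_n.+1 => i : nat) ne.
by rewrite inE /stop_level => hi ->.
Qed.

Lemma stop_level_max m l : (l <= n)%N -> (sigma m < l)%N -> ~~ P l m.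
Proof.
move=> ln sl; apply/negP => /(stop_level_ex ln)[+ _].
by rewrite leqNgt sl.
Qed.

Lemma stop_level_gt0 m : (0 < sigma m)%N -> P (sigma m) m.
Proof.
move=> s0; have [/existsP[l hl]|/existsPn no] := boolP [exists l : 'I_n.+1, P l m].
  by apply: (proj2 (stop_level_ex _ hl)); rewrite -ltnS.
move: s0; rewrite /stop_level big_pred0// => l; exact/negbTE/no.
Qed.

(** If two cells of a stopping block had different levels, they would also share the block of the
    larger level, where [P] would hold for both, against maximality. *)
Lemma stop_level_stopping : stopping sigma.
Proof.
split=> [m|m m' h]; first exact: leq_trans (stop_level_le m) nL.
have [s0|s0] := posnP (sigma m).
  by move: h; rewrite s0 /same_block !divn1 => /eqP /val_inj <-.
have Pm := stop_level_gt0 s0.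
have h2 : (sigma m <= sigma m')%N.
  by apply: (proj1 (stop_level_ex (stop_level_le m) _)); rewrite -(PE h).
apply/eqP; rewrite eqn_leq h2 andbT leqNgt; apply/negP => h3.
have /negP := stop_level_max (stop_level_le m') h3; apply.
by rewrite (PE (same_blockW h2 h)) stop_level_gt0// (ltn_trans s0).
Qed.

End stop_level_theory.

Lemma near_avg_le_block (a : T -> R) l (k : T) c : (l <= L)%N ->
  (forall m : T, near_block l k m -> block_avg a l m <= c) -> 0 <= c ->
  near_avg a l k <= 3 * c.
Proof.
move=> lL h c0; rewrite /near_avg.
have st : @stopping L (fun=> l) by split.
rewrite -(@stopping_sum _ _ (fun=> l) (fun m => near_block l k m) a st); last first.
  by move=> m m' hm s; rewrite -(near_block_eqr _ s).
rewrite ler_pdivrMl ?exprn_gt0//.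
by apply: le_trans (sum_near_const _ _ _ c0); exact: ler_sum.
Qed.

(** If a near average exceeds 3 lambda, one of its blocks has average above lambda and lies in a
    maximal such block. The maximal blocks are disjoint, have total size at most the sum of [a] over
    lambda, and each is near at most three times as many cells as it contains. *)
Lemma near_max_weak (a : T -> R) (lambda : R) : (forall m, 0 <= a m) -> 0 < lambda ->
  lambda * (\sum_(k | (3 * lambda < near_max a k)%R) 1) <= 3 * \sum_m a m.
Proof.
move=> a0 l0.
pose P l (m : T) := lambda < block_avg a l m.
have PE l (m m' : T) : same_block l m m' -> P l m = P l m'.
  by move=> h; rewrite /P (block_avg_eq _ h).
pose sigma := stop_level P L.
pose Om m := P (sigma m) m.
have st : stopping sigma := stop_level_stopping (leqnn L) PE.
have OmE (m m' : T) : Om m -> same_block (sigma m) m m' -> Om m'.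
  by move=> hm h; rewrite /Om (proj2 st _ _ h) -(PE _ _ _ h).
(* The weights 2^-(sigma m) give mass 1 to each stopping block, so the sum counts the maximal blocks
   near [k]. *)
have step k : 3 * lambda < near_max a k ->
    1 <= \sum_(m | Om m && near_block (sigma m) k m) (2 ^+ sigma m)^-1 :> R.
  move=> /near_max_gt[|l lL hl]; first by rewrite mulr_ge0// ltW.
  have [m km ml] : exists2 m : T, near_block l k m & lambda < block_avg a l m.
    apply: contrapT => no; move: hl; rewrite ltNge => /negP; apply.
    apply: near_avg_le_block => //; last exact: ltW.
    by move=> m km; rewrite leNgt; apply/negP => ?; apply: no; exists m.
  have [ls oms] := stop_level_ex (P := P) lL ml.
  have sub (m' : T) : same_block (sigma m) m m' -> Om m' && near_block (sigma m') k m'.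
    move=> h; rewrite (OmE _ _ oms h)/= (proj2 st _ _ h) -(near_block_eqr _ h).
    exact: near_blockW km.
  apply: le_trans (_ : \sum_(m' : T | same_block (sigma m) m m') (2 ^+ sigma m')^-1 <= _).
    rewrite (eq_bigr (fun=> (2 ^+ sigma m)^-1)); last by move=> m' h; rewrite (proj2 st _ _ h).
    rewrite sumr_const (eq_card (B := [pred i : T | same_block (sigma m) m i]))//.
    rewrite card_same_block ?(proj1 st)// -[X in _ <= X]mulr_natr natrX mulVf//.
  rewrite [leRHS]big_mkcond [leLHS]big_mkcond ler_sum// => i _.
  by case: ifPn => [/sub ->//|_]; case: ifPn => // _; rewrite invr_ge0 exprn_ge0.
have h1 : \sum_(k | (3 * lambda < near_max a k)%R) 1 <= \sum_(m | Om m) 3 :> R.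
  apply: le_trans (_ : \sum_(k : T) \sum_(m | Om m && near_block (sigma m) k m)
     (2 ^+ sigma m)^-1 <= _).
    rewrite [leLHS]big_mkcond ler_sum// => k _; case: ifPn => [/step//|_].
    by apply: sumr_ge0 => m _; rewrite invr_ge0 exprn_ge0.
  rewrite (exchange_big_dep Om)/=; last by move=> k m _ /andP[].
  apply: ler_sum => m hm.
  rewrite (eq_bigl (fun k : T => near_block (sigma m) m k)); last first.
    by move=> k; rewrite hm near_block_sym.
  apply: le_trans (sum_near_const _ _ _ _) _; first by rewrite invr_ge0 exprn_ge0.
  by rewrite mulrCA mulfV ?mulr1// expf_eq0 pnatr_eq0 andbF.
have h2 : \sum_(m | Om m) lambda <= \sum_m a m.
  apply: le_trans (_ : \sum_(m | Om m) block_avg a (sigma m) m <= _).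
    by apply: ler_sum => m /ltW.
  rewrite stopping_sum// [leLHS]big_mkcond ler_sum// => m _.
  by case: ifPn.
apply: (le_trans (ler_wpM2l (ltW l0) h1)).
apply: le_trans (_ : 3 * (\sum_(m | Om m) lambda) <= _); last by rewrite ler_wpM2l.
by rewrite !mulr_sumr; under eq_bigr do rewrite mulrC.
Qed.

End discrete_maximal.

(** * Dyadic layer-cake sums, good-lambda summation and the scalar maximal inequality *)

Section layers.
Variable R : realType.
Implicit Types (p d x : R).

(** Sum of the geometric series of ratio 2^-p: all levels up to the highest one, relative to that
    one. *)
Definition geoC p : R := (1 - 2 `^ (- p))^-1.

Lemma two_powRN_lt1 p : 0 < p -> 2 `^ (- p) < 1 :> R.
Proof.
move=> p0; rewrite powRN invf_lt1 ?powR_gt0//.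
have {1}-> : 1 = 1 `^ p :> R by rewrite powR1.
by rewrite gt0_ltr_powR// ?nnegrE// ltr1n.
Qed.

Lemma geoC_ge1 p : 0 < p -> 1 <= geoC p.
Proof.
move=> p0; have := two_powRN_lt1 p0; have := powR_ge0 2 (- p) => h1 h2.
by rewrite /geoC invf_ge1 ?subr_gt0// lerBlDr lerDl.
Qed.

Lemma geoC_ge0 p : 0 < p -> 0 <= geoC p.
Proof. by move/geoC_ge1; exact: le_trans. Qed.

Lemma layer_powS p d i : 0 < d -> (2 ^+ i.+1 * d) `^ p = 2 `^ p * (2 ^+ i * d) `^ p.
Proof. by move=> d0; rewrite exprS -mulrA powRM// mulr_ge0 ?exprn_ge0// ltW. Qed.

Lemma layers_geometric p d n : 0 < p -> 0 < d ->
  \sum_(i < n.+1) (2 ^+ i * d) `^ p <= geoC p * (2 ^+ n * d) `^ p.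
Proof.
move=> p0 d0; elim: n => [|n IH].
  by rewrite big_ord_recl big_ord0 addr0 -[leLHS]mul1r ler_wpM2r ?powR_ge0 ?geoC_ge1.
rewrite big_ord_recr/= layer_powS//.
apply: le_trans (lerD IH (lexx _)) _.
rewrite mulrA -mulrDl ler_wpM2r ?powR_ge0//.
have h1 := two_powRN_lt1 p0; have h2 : 0 < 2 `^ p :> R by rewrite powR_gt0.
rewrite /geoC powRN in h1 *.
move: h1; rewrite invf_lt1// => h1.
have h3 : 2 `^ p - 1 != 0 :> R by rewrite gt_eqF// subr_gt0.
have h4 : (1 - (2 `^ p)^-1) ^-1 * (2 `^ p - 1) = 2 `^ p :> R.
  have -> : 1 - (2 `^ p)^-1 = (2 `^ p - 1) / 2 `^ p :> R by field; rewrite gt_eqF.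
  by rewrite invf_div mulfVK.
by move: h4; rewrite mulrBr mulr1; lra.
Qed.

Lemma layers_upper p d x n : 0 < p -> 0 < d -> 0 <= x ->
  \sum_(i < n | (2 ^+ i * d < x)%R) (2 ^+ i * d) `^ p <= geoC p * x `^ p.
Proof.
move=> p0 d0 x0; elim: n => [|n IH].
  by rewrite big_ord0 mulr_ge0 ?powR_ge0 ?geoC_ge0.
rewrite big_mkcond big_ord_recr/= -big_mkcond/=.
case: ifPn => [h|_]; last by rewrite addr0.
apply: le_trans (_ : \sum_(i < n.+1) (2 ^+ i * d) `^ p <= _).
  rewrite big_ord_recr/= lerD2r [leLHS]big_mkcond ler_sum// => i _.
  by case: ifP => // _; exact: powR_ge0.
apply: (le_trans (layers_geometric n p0 d0)).
rewrite ler_wpM2l ?geoC_ge0// ge0_ler_powR ?nnegrE ?(ltW p0) ?(ltW h)//.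
by rewrite mulr_ge0 ?exprn_ge0// ltW.
Qed.

(** Discrete layer-cake formula, with [layers_upper] as its converse. Values below the lowest level
    cost d^p, an error that [small_powR_le] removes by letting d tend to 0. *)
Lemma layers_lower p d x n : 0 < p -> 0 < d -> 0 <= x -> x <= 2 ^+ n * d ->
  x `^ p <= d `^ p + 2 `^ p * \sum_(i < n | (2 ^+ i * d < x)%R) (2 ^+ i * d) `^ p.
Proof.
move=> p0 d0 x0; elim: n => [|n IH] h.
  rewrite expr0 mul1r in h.
  by rewrite big_ord0 mulr0 addr0 ge0_ler_powR ?nnegrE ?(ltW p0) ?(ltW d0).
rewrite big_mkcond big_ord_recr/= -big_mkcond/=.
case: ifPn => [hx|]; last by rewrite -leNgt addr0; exact: IH.
rewrite mulrDr -layer_powS// addrA -[leLHS]add0r lerD//.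
  by rewrite addr_ge0 ?powR_ge0// mulr_ge0 ?powR_ge0// sumr_ge0// => i _; exact: powR_ge0.
by rewrite ge0_ler_powR ?nnegrE ?(ltW p0)// mulr_ge0 ?exprn_ge0// ltW.
Qed.

Lemma small_powR_le (x y c p : R) : 0 < p -> 0 <= c ->
  (forall d, 0 < d -> x <= d `^ p * c + y) -> x <= y.
Proof.
move=> p0 c0 h; apply/ler_addgt0Pr => e e0.
(* Choosing d^p = e / (c + 1) makes the error at most e, also for c = 0. *)
have c1 : 0 < c + 1 by rewrite ltr_wpDl.
have d0 : 0 < (e / (c + 1)) `^ p^-1 by rewrite powR_gt0// divr_gt0.
apply: (le_trans (h _ d0)).
have ec : 0 <= e / (c + 1) by rewrite divr_ge0// ltW.
rewrite -powRrM mulVf ?gt_eqF// powRr1//.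
by rewrite addrC lerD2l mulrAC ler_pdivrMr// ler_wpM2l ?(ltW e0)// lerDl.
Qed.

Lemma layers_bound (T : finType) (F : T -> R) d : 0 < d ->
  exists n, forall k, F k <= 2 ^+ n * d.
Proof.
move=> d0; pose s := \sum_k `|F k| / d.
have s0 : 0 <= s by rewrite sumr_ge0// => k _; rewrite divr_ge0// ltW.
exists (Num.truncn s).+1 => k.
rewrite -ler_pdivrMr//; apply: le_trans (_ : s <= _).
  rewrite /s (bigD1 k)//= -[leLHS]addr0 lerD//.
    by rewrite ler_wpM2r ?ler_norm// invr_ge0 ltW.
  by rewrite sumr_ge0// => i _; rewrite divr_ge0// ltW.
apply: le_trans (_ : (Num.truncn s).+1%:R <= _).
  by rewrite ltW// truncnS_gt.
by rewrite -natrX ler_nat ltnW// ltn_expl.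
Qed.

Lemma sum_layers (T : finType) (F w : T -> R) p d n :
  \sum_k w k * \sum_(i < n | (2 ^+ i * d < F k)%R) (2 ^+ i * d) `^ p =
  \sum_(i < n) (2 ^+ i * d) `^ p * \sum_(k | (2 ^+ i * d < F k)%R) w k.
Proof.
under eq_bigr do rewrite mulr_sumr.
rewrite (exchange_big_dep predT)//=; apply: eq_bigr => i _.
by rewrite mulr_sumr; apply: eq_bigr => k _; rewrite mulrC.
Qed.

Lemma sum_powR_layers (T : finType) (F : T -> R) p d n : 0 < p -> 0 < d ->
  (forall k, 0 <= F k <= 2 ^+ n * d) ->
  \sum_k F k `^ p <= d `^ p * #|T|%:R +
    2 `^ p * \sum_(i < n) (2 ^+ i * d) `^ p * \sum_(k | (2 ^+ i * d < F k)%R) 1.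
Proof.
move=> p0 d0 hF.
rewrite -sum_layers mulr_sumr mulr_natr -sumr_const -big_split/=.
apply: ler_sum => k _; rewrite mul1r; apply: layers_lower => //.
all: by have /andP[] := hF k.
Qed.

Lemma layers_sum_powR (T : finType) (F : T -> R) p d n : 0 < p -> 0 < d ->
  (forall k, 0 <= F k) ->
  \sum_(i < n) (2 ^+ i * d) `^ p * \sum_(k | (2 ^+ i * d < F k)%R) 1 <=
  geoC p * \sum_k F k `^ p.
Proof.
move=> p0 d0 hF; rewrite -sum_layers mulr_sumr.
by apply: ler_sum => k _; rewrite mul1r; exact: layers_upper.
Qed.

(** Summed over the levels, the hypothesis bounds the level 2^(i+1) d by e times the level 2^i d
    plus a term in [G]. As 2^p e <= 1/2, the sum over levels is absorbed by the left side, which is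
    legitimate because it is finite. The constant is fixed before [T] and [e]. *)
Lemma good_lambda_sum (p g : R) : 0 < p -> 0 < g ->
  exists2 C : R, 0 <= C & forall (T : finType) (F G : T -> R) e,
    (forall k, 0 <= F k) -> (forall k, 0 <= G k) -> 0 <= e ->
    2 `^ p * e <= 2^-1 ->
    (forall l, 0 < l -> \sum_(k | (2 * l < F k)%R) 1 <=
       e * (\sum_(k | (l < F k)%R) 1) + \sum_(k | (g * l < G k)%R) 1 :> R) ->
    \sum_k F k `^ p <= C * \sum_k G k `^ p.
Proof.
move=> p0 g0; have q0 := powR_ge0 2 p.
pose C0 := geoC p * (g^-1) `^ p.
have C00 : 0 <= C0 by rewrite mulr_ge0 ?geoC_ge0 ?powR_ge0.
exists (2 * 2 `^ p * 2 `^ p * C0) => [|T F G e F0 G0 e0 e2 h].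
  by rewrite mulr_ge0// !mulr_ge0.
set SG := \sum_k G k `^ p.
have CS0 : 0 <= C0 * SG by rewrite mulr_ge0// sumr_ge0// => k _; exact: powR_ge0.
apply: (@small_powR_le _ _ (#|T|%:R * (1 + 2 * 2 `^ p)) p p0).
  by rewrite mulr_ge0// addr_ge0// mulr_ge0.
move=> d d0.
have [n hn] := layers_bound F d0.
have hF k : 0 <= F k <= 2 ^+ n * d by rewrite F0 hn.
apply: (le_trans (sum_powR_layers p0 d0 hF)).
have cnt (P : pred T) : 0 <= \sum_(k | P k) 1 :> R by exact: sumr_ge0.
pose S m := \sum_(i < m) (2 ^+ i * d) `^ p * \sum_(k | (2 ^+ i * d < F k)%R) 1.
have S0 m : 0 <= S m by apply: sumr_ge0 => i _; rewrite mulr_ge0 ?powR_ge0.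
have hG m : \sum_(i < m) (2 ^+ i * d) `^ p * \sum_(k | (g * (2 ^+ i * d) < G k)%R) 1
    <= C0 * SG.
  have := layers_sum_powR m p0 d0 (F := fun k => g^-1 * G k).
  have e1 : \sum_k (g^-1 * G k) `^ p = g^-1 `^ p * SG.
    rewrite /SG mulr_sumr; apply: eq_bigr => k _.
    by rewrite powRM// invr_ge0 ltW.
  rewrite e1 mulrA -/C0 => H; apply: le_trans (H _).
    apply: ler_sum => i _; rewrite ler_wpM2l ?powR_ge0//.
    rewrite le_eqVlt; apply/orP; left; apply/eqP; apply: eq_bigl => k.
    by rewrite ltr_pdivlMl.
  by move=> k; rewrite mulr_ge0// invr_ge0 ltW.
have cT (P : pred T) : \sum_(k | P k) 1 <= #|T|%:R :> R.
  by rewrite sumr_const ler_nat max_card.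
have SS m : S m <= 2 * (d `^ p * #|T|%:R + 2 `^ p * (C0 * SG)).
  (* The lowest level has none below it and is bounded trivially by the size of [T]. *)
  have h1 : S m <= d `^ p * #|T|%:R + 2 `^ p * (e * S m + C0 * SG).
    case: m => [|m].
      rewrite /S big_ord0 mulr0 add0r.
      by apply: addr_ge0; apply: mulr_ge0 => //; exact: powR_ge0.
    rewrite {1}/S big_ord_recl expr0 mul1r lerD ?ler_wpM2l ?powR_ge0//.
    apply: le_trans (_ : \sum_(i < m) 2 `^ p * ((2 ^+ i * d) `^ p * (e *
       (\sum_(k | (2 ^+ i * d < F k)%R) 1) +
         \sum_(k | (g * (2 ^+ i * d) < G k)%R) 1)) <= _).
      apply: ler_sum => i _; rewrite lift0 layer_powS// -mulrA ler_wpM2l//.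
      rewrite ler_wpM2l ?powR_ge0// exprS -mulrA.
      by apply: h; rewrite mulr_gt0// exprn_gt0.
    rewrite -mulr_sumr ler_wpM2l//.
    under eq_bigr do rewrite mulrDr.
    rewrite big_split/= lerD// ?hG//.
    under eq_bigr do rewrite mulrCA.
    rewrite -mulr_sumr ler_wpM2l// /S [leRHS]big_ord_recr/=.
    by rewrite lerDl mulr_ge0 ?powR_ge0.
  have h2 : 2 `^ p * e * S m <= 2^-1 * S m by rewrite ler_wpM2r.
  by move: h1 h2; rewrite mulrDr mulrA; lra.
have := ler_wpM2l q0 (SS n); rewrite -/(S n).
lra.
Qed.

(** Marcinkiewicz interpolation between the weak (1,1) bound and the trivial bound for bounded
    functions, by truncating [a] differently at each level. *)
Lemma near_max_strong p : 1 < p ->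
  exists2 C : R, 0 <= C & forall L (a : 'I_(3 * 2 ^ L) -> R),
    (forall m, 0 <= a m) ->
    \sum_k near_max a k `^ p <= C * \sum_k a k `^ p.
Proof.
move=> p1; have p0 : 0 < p by rewrite (lt_trans _ p1).
have p10 : 0 < p - 1 by rewrite subr_gt0.
pose C := 2 `^ p * 18 * (geoC (p - 1) * 6 `^ (p - 1)).
exists C => [|L a a0]; first by rewrite !mulr_ge0 ?powR_ge0 ?geoC_ge0.
set SA := \sum_k a k `^ p.
apply: (@small_powR_le _ _ #|'I_(3 * 2 ^ L)|%:R p p0) => // d d0.
have [n hn] := layers_bound (near_max a) d0.
have hF k : 0 <= near_max a k <= 2 ^+ n * d by rewrite near_max_ge0 hn.
apply: (le_trans (sum_powR_layers p0 d0 hF)).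
rewrite lerD2l /C -!mulrA ler_wpM2l ?powR_ge0//.
have weak l : 0 < l -> l * (\sum_(k | (l < near_max a k)%R) 1) <=
    18 * \sum_(m | (l < 6 * a m)%R) a m.
  (* As a <= a' + l/6 and near averages of the constant l/6 are at most l/2, [near_max a] above l
     forces [near_max a'] above l/2 = 3 (l/6). The weak bound at l/6 then yields 18 = 6 * 3. *)
  move=> l0; pose a' m := if l < 6 * a m then a m else 0.
  have a'0 m : 0 <= a' m by rewrite /a'; case: ifP.
  have l60 : 0 < l / 6 by rewrite divr_gt0.
  have := near_max_weak a'0 l60.
  rewrite -big_mkcond/= => h.
  have sub : \sum_(k | (l < near_max a k)%R) 1 <=
      \sum_(k | (3 * (l / 6) < near_max a' k)%R) 1 :> R.
    rewrite [leLHS]big_mkcond [leRHS]big_mkcond ler_sum// => k _.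
    case: ifPn => [hk|_]; last by case: ifPn.
    rewrite ifT// -(ltrD2r (3 * (l / 6))).
    have -> : 3 * (l / 6) + 3 * (l / 6) = l by field.
    apply: (lt_le_trans hk); apply: near_max_le => [|j jL].
      by rewrite addr_ge0 ?near_max_ge0// mulr_ge0// ltW.
    apply: le_trans (_ : near_avg a' j k + near_avg (fun=> l / 6) j k <= _).
      rewrite -near_avgD; apply: le_near_avg => m _.
      rewrite /a'; case: ifPn => [_|]; first by rewrite lerDl ltW.
      by rewrite -leNgt add0r ler_pdivlMr// mulrC.
    rewrite lerD ?near_avg_le_max// near_avg_le_block ?ltW// => m _.
    rewrite /block_avg sumr_const (eq_card (B := [pred i : 'I_(3 * 2 ^ L) | same_block j m i]))//.
    rewrite card_same_block// ler_pdivrMl ?exprn_gt0// -[leLHS]mulr_natr natrX.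
    by rewrite mulrC.
  set x := (X in l * X <= _); set y := (X in _ <= 18 * X).
  have : l / 6 * x <= 3 * y := le_trans (ler_wpM2l (ltW l60) sub) h.
  lra.
apply: le_trans (_ : \sum_(i < n) (2 ^+ i * d) `^ (p - 1) *
   (18 * \sum_(m | (2 ^+ i * d < 6 * a m)%R) a m) <= _).
  apply: ler_sum => i _; have l0 : 0 < 2 ^+ i * d by rewrite mulr_gt0// exprn_gt0.
  rewrite -(mulr_powRB1 (ltW l0) p0) [X in X * _]mulrC -mulrA ler_wpM2l ?powR_ge0//.
  exact: weak.
under eq_bigr do rewrite mulrCA.
rewrite -mulr_sumr ler_wpM2l// -sum_layers /SA !mulr_sumr.
apply: ler_sum => k _; rewrite -(mulr_powRB1 (a0 k) p0) [in leRHS](mulrCA _ (a k)) [leRHS]mulrCA.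
rewrite ler_wpM2l// -powRM//.
by apply: layers_upper => //; rewrite mulr_ge0.
Qed.

End layers.

(** * Vector-valued maximal inequality *)

(** A monotone seminorm on nonnegative functions, general enough to include l^p norms, iterated
    norms and evaluation at a point. *)
Record lattice_norm (R : realType) (Y : Type) (Phi : (Y -> R) -> R) : Prop :=
  LatticeNorm {
    lattice_norm_le : forall a b, (forall y, 0 <= a y <= b y) -> Phi a <= Phi b ;
    lattice_normD : forall a b, (forall y, 0 <= a y) -> (forall y, 0 <= b y) ->
      Phi (fun y => a y + b y) <= Phi a + Phi b ;
    lattice_normZ : forall c a, 0 <= c -> (forall y, 0 <= a y) ->
      Phi (fun y => c * a y) = c * Phi a }.

Section lattice_norm_theory.
Variables (R : realType) (Y : Type) (Phi : (Y -> R) -> R).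
Hypothesis PhiP : lattice_norm Phi.

Lemma lattice_norm0 : Phi (fun=> 0) = 0.
Proof.
have := lattice_normZ PhiP (lexx 0) (fun=> lexx 0).
by rewrite !mul0r.
Qed.

Lemma lattice_norm_ge0 a : (forall y, 0 <= a y) -> 0 <= Phi a.
Proof.
move=> a0; rewrite -lattice_norm0; apply: lattice_norm_le => // y.
by rewrite lexx a0.
Qed.

Lemma lattice_norm_sum (I : Type) (s : seq I) (P : pred I) (a : I -> Y -> R) :
  (forall i y, 0 <= a i y) ->
  Phi (fun y => \sum_(i <- s | P i) a i y) <= \sum_(i <- s | P i) Phi (a i).
Proof.
move=> a0; elim: s => [|i s IH].
  by rewrite big_nil; under eq_fun do rewrite big_nil; rewrite lattice_norm0.
rewrite big_cons; under eq_fun do rewrite big_cons.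
case: ifPn => // Pi; apply: le_trans (lattice_normD PhiP _ _) _ => //.
  by move=> y; exact: sumr_ge0.
by rewrite lerD2l.
Qed.

Lemma lattice_norm_block_avg L (a : 'I_(3 * 2 ^ L) -> Y -> R) l k :
  (forall i y, 0 <= a i y) ->
  Phi (fun y => block_avg (a^~ y) l k) <= block_avg (fun m => Phi (a m)) l k.
Proof.
move=> a0; rewrite /block_avg lattice_normZ ?invr_ge0 ?exprn_ge0//.
  by rewrite ler_wpM2l ?invr_ge0 ?exprn_ge0// lattice_norm_sum.
by move=> y; exact: sumr_ge0.
Qed.

End lattice_norm_theory.

Section vector_valued.
Variables (R : realType) (L : nat).
Local Notation T := 'I_(3 * 2 ^ L).

(** Boundedness of M on L^q(Phi), with [y] as a parameter. Since q-th powers are compared, the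
    operator norm is at most C^(1/q). *)
Definition maximal_bounded (Y : Type) (Phi : (Y -> R) -> R) (q C : R) : Prop :=
  forall a : T -> Y -> R, (forall k y, 0 <= a k y) ->
    \sum_k Phi (fun y => near_max (a^~ y) k) `^ q <= C * \sum_k Phi (a k) `^ q.

Variables (Y : Type) (Phi : (Y -> R) -> R) (q C : R).
Hypotheses (PhiP : lattice_norm Phi) (q0 : 0 < q) (C0 : 0 <= C).
Hypothesis PhiB : maximal_bounded Phi q C.
Variable a : T -> Y -> R.
Hypothesis a0 : forall k y, 0 <= a k y.
Variables (g lambda : R).
Hypotheses (g0 : 0 < g) (l0 : 0 < lambda).

Let F k := Phi (fun y => near_max (a^~ y) k).
Let u k := Phi (a k).
Let G k := near_max u k.
Let e := C * (3 * (2 * g) `^ q).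

(** M is split at level [l]: the tail is constant on blocks of level [l], hence fit for a stopping
    rule, and the head sees only cells near at level [l]. *)
Let tail_max l k y : R := \big[Num.max/0]_(i < L.+1 | (l <= i)%N) near_avg (a^~ y) i k.
Let head_max l k y : R := \big[Num.max/0]_(i < L.+1 | (i <= l)%N) near_avg (a^~ y) i k.

Let tail_max_ge0 l k y : 0 <= tail_max l k y.
Proof. exact: bigmax_ge_id. Qed.

Let head_max_ge0 l k y : 0 <= head_max l k y.
Proof. exact: bigmax_ge_id. Qed.

Let tail_max_eq l (k k' : T) : same_block l k k' -> tail_max l k = tail_max l k'.
Proof.
move=> h; apply/funext => y; apply: eq_bigr => i li.
exact/near_avg_eq/(same_blockW li).
Qed.

Let tail_max0 k : F k = Phi (tail_max 0 k).
Proof. by []. Qed.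

Let tail_max_le l k : Phi (tail_max l k) <= F k.
Proof.
apply: lattice_norm_le => // y; rewrite tail_max_ge0/=; apply: bigmax_le.
  exact: near_max_ge0.
by move=> i _; apply: near_avg_le_max; rewrite -ltnS.
Qed.

Let P l k := lambda < Phi (tail_max l k).
Let PE l (k k' : T) : same_block l k k' -> P l k = P l k'.
Proof. by move=> h; rewrite /P (tail_max_eq h). Qed.

Let tau := stop_level P L.
Let tau_stopping : stopping tau := stop_level_stopping (leqnn L) PE.

Let tauP k : lambda < F k -> P (tau k) k.
Proof. by rewrite tail_max0 => h; exact: (proj2 (stop_level_ex (leq0n L) h)). Qed.

(** By maximality of [tau], the tail starting one level higher has norm at most lambda (it is 0 past
    [L]), which leaves more than lambda to the head. *)
Let head_gt k : 2 * lambda < F k -> lambda < Phi (head_max (tau k) k).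
Proof.
move=> h; have h1 : Phi (tail_max (tau k).+1 k) <= lambda.
  have [tL|tL] := ltnP (tau k) L.
    by rewrite leNgt; exact: (stop_level_max (P := P) (m := k) tL).
  rewrite (_ : tail_max _ _ = fun=> 0) ?lattice_norm0 ?ltW//.
  apply/funext => y; rewrite /tail_max big_pred0// => i.
  by apply/negbTE; rewrite -ltnNge ltnS (leq_trans _ tL)// -ltnS.
have : F k <= Phi (head_max (tau k) k) + Phi (tail_max (tau k).+1 k).
  apply: le_trans (lattice_normD PhiP _ _) => //.
  apply: lattice_norm_le => // y; rewrite near_max_ge0/=.
  apply: bigmax_le => [|i _]; first by rewrite addr_ge0.
  have [it|it] := leqP i (tau k).
    rewrite -[leLHS]addr0 lerD//.
    exact: (le_bigmax_cond _ (fun i : 'I_L.+1 => near_avg (a^~ y) i k)).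
  rewrite -[leLHS]add0r lerD//.
  exact: (le_bigmax_cond _ (fun i : 'I_L.+1 => near_avg (a^~ y) i k)).
lra.
Qed.

Let bad k := (2 * lambda < F k) && (G k <= g * lambda).

(* Calderon-Zygmund: on the triple of a stopping block, [a] is replaced by its
   averages [b] over the maximal blocks on which the average of [u] exceeds
   [g * lambda]. The norm of [b] is at most [2 * g * lambda], while at the bad
   points the averages at the levels below [tau] do not change. *)
Let bad_block (k0 : T) : lambda < F k0 ->
  \sum_(k : T | same_block (tau k0) k0 k && bad k) 1 <= e * 2 ^+ tau k0.
Proof.
move=> Fk0; set n := tau k0.
have nL : (n <= L)%N := proj1 tau_stopping k0.
have e0 : 0 <= e by rewrite !mulr_ge0// powR_ge0.
have u0 m : 0 <= u m by apply: lattice_norm_ge0.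
have gl0 : 0 < g * lambda by rewrite mulr_gt0.
have [/existsP[k1 /andP[sk1 /andP[Fk1 Gk1]]]|/existsPn no] :=
  boolP [exists k : T, same_block n k0 k && bad k]; last first.
  rewrite big_pred0; first by rewrite mulr_ge0// exprn_ge0.
  by move=> k; exact/negbTE/no.
pose P' l (m : T) := g * lambda < block_avg u l m.
have PE' l (m m' : T) : same_block l m m' -> P' l m = P' l m'.
  by move=> h; rewrite /P' (block_avg_eq _ h).
pose sigma := stop_level P' n.
have st : stopping sigma := stop_level_stopping nL PE'.
pose b (m : T) y := if near_block n k0 m then block_avg (a^~ y) (sigma m) m else 0.
have b0 m y : 0 <= b m y by rewrite /b; case: ifP => // _; exact: block_avg_ge0.
(* Below level n, maximality bounds the average of [u] over the parent block by [g * lambda], and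
   passing to the half at most doubles it. At level n the block of [m] is near the bad point [k1],
   so its average is at most [G k1]. *)
have Phib (m : T) : Phi (b m) <= if near_block n k0 m then 2 * g * lambda else 0.
  rewrite /b; case: ifPn => nm; last by rewrite lattice_norm0.
  apply: le_trans (lattice_norm_block_avg PhiP _ _ _) _ => //.
  have [sn|] := ltnP (sigma m) n.
    apply: (le_trans (block_avgS_le _ _ u0)); rewrite -mulrA ler_wpM2l//.
    by rewrite leNgt; exact: (stop_level_max (P := P') sn).
  move=> ns; have -> : sigma m = n.
    by apply/eqP; rewrite eqn_leq ns andbT; exact: stop_level_le.
  apply: le_trans (_ : near_avg u n k1 <= _).
    by apply: block_avg_le_near => //; rewrite -(near_block_eql _ sk1).
  apply: (le_trans (near_avg_le_max _ _ nL)).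
  by apply: (le_trans Gk1); rewrite -mulrA ler_peMl ?(ltW gl0)// ler1n.
(* The near blocks of level l form a union of stopping blocks: one sticking out would have level
   above l and average above [g * lambda] while being near the bad point [k], against the bound on
   [G k]. *)
have avgE (k : T) l y : same_block n k0 k -> bad k -> (l <= n)%N ->
    near_avg (a^~ y) l k = near_avg (b^~ y) l k.
  move=> sk /andP[_ Gk] ln; congr *%R.
  rewrite [RHS](eq_bigr (fun m => block_avg (a^~ y) (sigma m) m)); last first.
    move=> m lm; rewrite /b ifT// (near_block_eql _ sk).
    exact: near_blockW lm.
  rewrite (stopping_sum (S := fun m : T => near_block l k m))//.
  move=> m m' lm sm; have [sl|sl] := leqP (sigma m) l.
    by rewrite -(near_block_eqr _ (same_blockW sl sm)).
  have : P' (sigma m) m by apply: stop_level_gt0; exact: leq_ltn_trans sl.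
  rewrite /P' ltNge => /negP[]; apply: le_trans Gk.
  apply: le_trans (near_avg_le_max _ _ (proj1 st m)).
  by apply: block_avg_le_near => //; exact: near_blockW (ltnW sl) lm.
(* Chebyshev's inequality: at bad points M b has norm at least lambda, and [b] lives on at most 3 *
   2^n cells. *)
have lq0 : 0 < lambda `^ q by rewrite powR_gt0.
rewrite -(ler_pM2l lq0).
apply: le_trans (_ : \sum_k Phi (fun y => near_max (b^~ y) k) `^ q <= _).
  rewrite mulr_sumr [leLHS]big_mkcond ler_sum// => k _.
  case: ifPn => [/andP[sk bk]|_]; last exact: powR_ge0.
  have tk : tau k = n := proj2 tau_stopping _ _ sk.
  rewrite mulr1 ge0_ler_powR ?nnegrE ?(ltW q0) ?(ltW l0)//.
    by apply: lattice_norm_ge0 => // y; exact: near_max_ge0.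
  have /andP[Fk _] := bk.
  apply: (le_trans (ltW (head_gt Fk))); apply: lattice_norm_le => // y.
  rewrite head_max_ge0/=; apply: bigmax_le => [|i]; first exact: near_max_ge0.
  rewrite tk => li; rewrite (avgE _ _ _ sk bk li); apply: near_avg_le_max.
  by rewrite -ltnS.
apply: (le_trans (PhiB b0)).
apply: le_trans (_ : C * \sum_(m : T | near_block n k0 m) (2 * g * lambda) `^ q <= _).
  rewrite ler_wpM2l// [leRHS]big_mkcond ler_sum// => m _.
  have := Phib m; case: ifPn => _ h.
    rewrite ge0_ler_powR ?nnegrE ?(ltW q0)//; first exact: lattice_norm_ge0.
    by rewrite !mulr_ge0// ltW.
  rewrite (_ : Phi (b m) = 0) ?powR0// ?gt_eqF//.
  by apply/eqP; rewrite eq_le h lattice_norm_ge0.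
apply: le_trans (ler_wpM2l C0 (sum_near_const _ _ _ (powR_ge0 _ _))) _.
rewrite powRM ?(ltW l0)//; last by rewrite mulr_ge0// ltW.
rewrite /e le_eqVlt; apply/orP; left; apply/eqP; ring.
Qed.

(** The set where F exceeds lambda is a union of stopping blocks, and in each of them the proportion
    of bad points is at most [e]; averaging over the blocks turns this into a count. *)
Lemma vector_good_lambda :
  \sum_(k | (2 * lambda < F k)%R) 1 <=
  e * (\sum_(k | (lambda < F k)%R) 1) + \sum_(k | (g * lambda < G k)%R) 1.
Proof.
apply: le_trans (_ : \sum_k (if bad k then 1 else 0) +
    \sum_(k | (g * lambda < G k)%R) 1 <= _).
  rewrite [leLHS]big_mkcond [X in _ + X]big_mkcond -big_split ler_sum// => k _.
  rewrite /bad/=; case: ifPn => [Fk|_]; last by rewrite add0r; case: ifP.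
  by rewrite andTb; case: leP => _; rewrite ?addr0 ?add0r.
rewrite lerD2r.
have sub k : bad k -> lambda < F k.
  by move=> /andP[+ _]; apply: le_lt_trans; rewrite ler_peMl ?(ltW l0)// ler1n.
have -> : \sum_k (if bad k then 1 else 0) =
    \sum_(k | (lambda < F k)%R) (if bad k then 1 else 0) :> R.
  rewrite [RHS]big_mkcond; apply: eq_bigr => k _.
  by case: ifPn => [/sub ->//|_]; case: ifP.
rewrite -(stopping_sum (sigma := tau)) => [| |m m' Fm mm']; last 2 first.
- exact: tau_stopping.
- apply: lt_le_trans (tail_max_le (tau m) m').
  by have := tauP Fm; rewrite (PE mm').
rewrite mulr_sumr; apply: ler_sum => k Fk.
rewrite mulr1 /block_avg ler_pdivrMl ?exprn_gt0// -big_mkcondr [leRHS]mulrC.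
exact: bad_block.
Qed.

End vector_valued.

(** The constant is chosen from q, C and p, before the grid and the lattice; the induction over the
    coordinates relies on this. *)
Lemma vector_maximal (R : realType) (q C p : R) : 0 < q -> 0 <= C -> 1 < p ->
  exists2 C' : R, 0 <= C' & forall L (Y : Type) (Phi : (Y -> R) -> R),
    lattice_norm Phi -> maximal_bounded L Phi q C ->
    maximal_bounded L Phi p C'.
Proof.
move=> q0 C0 p1; have p0 : 0 < p by rewrite (lt_trans _ p1).
have A0 : 0 < 2 `^ p * (C * 3) * 2 + 1.
  by rewrite ltr_wpDl// !mulr_ge0// powR_ge0.
(* With (2g)^q = 1/A, the good-lambda factor is 3C/A, so that 2^p times it is at most 1/2. The
   summand 1 keeps A positive when C = 0. *)
set A := 2 `^ p * (C * 3) * 2 + 1 in A0.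
pose g : R := 2^-1 * A^-1 `^ q^-1.
have g0 : 0 < g by rewrite mulr_gt0// powR_gt0// invr_gt0.
have [C1 C10 H1] := good_lambda_sum p0 g0.
have [C2 C20 H2] := near_max_strong p1.
exists (C1 * C2) => [|L Y Phi PhiP PhiB a a0]; first exact: mulr_ge0.
rewrite -mulrA; apply: le_trans (ler_wpM2l C10 (H2 _ _ _)); last first.
  by move=> m; exact: lattice_norm_ge0.
apply: (H1 _ _ _ (C * (3 * (2 * g) `^ q))).
- by move=> k; apply: lattice_norm_ge0 => // y; exact: near_max_ge0.
- by move=> k; exact: near_max_ge0.
- by rewrite !mulr_ge0// powR_ge0.
- have -> : (2 * g) `^ q = A^-1.
    rewrite /g mulrA mulfV// mul1r -powRrM mulVf ?gt_eqF// powRr1//.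
    by rewrite invr_ge0 ltW.
  by rewrite !mulrA ler_pdivrMr// /A !mulrA; lra.
- by move=> l l0; exact: vector_good_lambda.
Qed.

(** * Mixed norms on grids *)

Lemma powR_convex (R : realType) (p t x y : R) : 1 <= p -> 0 <= t <= 1 ->
  0 <= x -> 0 <= y ->
  (t * x + (1 - t) * y) `^ p <= t * x `^ p + (1 - t) * y `^ p.
Proof.
move=> p1 /andP[t0 t1] x0 y0.
by apply: (convex_powR p1 (Itv01 t0 t1)); rewrite inE/= in_itv/= andbT.
Qed.

Section lpnorm.
Variables (R : realType) (T : finType).
Implicit Types (p : R) (v w : T -> R).

Definition lpnorm p v : R := (\sum_k v k `^ p) `^ p^-1.

Lemma lpnorm_ge0 p v : 0 <= lpnorm p v.
Proof. exact: powR_ge0. Qed.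

Lemma lpnorm_powR p v : p != 0 -> lpnorm p v `^ p = \sum_k v k `^ p.
Proof.
move=> p0; rewrite /lpnorm -powRrM mulVf// powRr1//.
by apply: sumr_ge0 => k _; exact: powR_ge0.
Qed.

Lemma lpnorm_le_powR p v c : 0 < p -> 0 <= c ->
  (lpnorm p v <= c) = (\sum_k v k `^ p <= c `^ p).
Proof.
move=> p0 c0; rewrite -lpnorm_powR ?gt_eqF//; apply/idP/idP => h.
  by rewrite ge0_ler_powR ?nnegrE ?(ltW p0) ?lpnorm_ge0.
rewrite leNgt; apply/negP => h2; move: h; rewrite leNgt => /negP; apply.
by rewrite gt0_ltr_powR ?nnegrE ?lpnorm_ge0.
Qed.

Lemma lpnorm_le p v w : 0 < p -> (forall k, 0 <= v k <= w k) ->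
  lpnorm p v <= lpnorm p w.
Proof.
move=> p0 vw; rewrite lpnorm_le_powR ?lpnorm_ge0// lpnorm_powR ?gt_eqF//.
apply: ler_sum => k _; have /andP[v0 h] := vw k.
by rewrite ge0_ler_powR ?nnegrE ?(ltW p0) ?(le_trans v0 h).
Qed.

Lemma lpnormZ p c v : 0 < p -> 0 <= c -> (forall k, 0 <= v k) ->
  lpnorm p (fun k => c * v k) = c * lpnorm p v.
Proof.
move=> p0 c0 v0; rewrite /lpnorm.
under eq_bigr do rewrite powRM//.
rewrite -mulr_sumr powRM ?powR_ge0//; last by apply: sumr_ge0 => *; exact: powR_ge0.
by rewrite -powRrM mulfV ?gt_eqF// powRr1.
Qed.

Lemma lpnorm_eq0 p v k : 0 < p -> lpnorm p v = 0 -> v k = 0.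
Proof.
move=> p0 /powR_eq0_eq0 /eqP; rewrite psumr_eq0; last by move=> *; exact: powR_ge0.
by move=> /allP/(_ k); rewrite mem_index_enum => /(_ isT)/= /eqP /powR_eq0_eq0.
Qed.

(* Minkowski: normalize and use the convexity of the power function. *)
Lemma lpnormD p v w : 1 <= p -> (forall k, 0 <= v k) -> (forall k, 0 <= w k) ->
  lpnorm p (fun k => v k + w k) <= lpnorm p v + lpnorm p w.
Proof.
move=> p1 v0 w0; have p0 : 0 < p by rewrite (lt_le_trans _ p1).
have [A0|A0] := eqVneq (lpnorm p v) 0.
  rewrite A0 add0r; apply: lpnorm_le => // k.
  by rewrite (lpnorm_eq0 k p0 A0) add0r w0 lexx.
have [B0|B0] := eqVneq (lpnorm p w) 0.
  rewrite B0 addr0; apply: lpnorm_le => // k.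
  by rewrite (lpnorm_eq0 k p0 B0) addr0 v0 lexx.
have {}A0 : 0 < lpnorm p v by rewrite lt_neqAle eq_sym A0 lpnorm_ge0.
have {}B0 : 0 < lpnorm p w by rewrite lt_neqAle eq_sym B0 lpnorm_ge0.
have hA := lpnorm_powR v (lt0r_neq0 p0); have hB := lpnorm_powR w (lt0r_neq0 p0).
move: (lpnorm p v) (lpnorm p w) A0 B0 hA hB => A B A0 B0 hA hB.
have S0 : 0 < A + B by rewrite addr_gt0.
rewrite lpnorm_le_powR ?(ltW S0)//.
pose t := A / (A + B).
have t01 : 0 <= t <= 1.
  by rewrite /t divr_ge0 ?(ltW A0) ?(ltW S0)//= ler_pdivrMr// mul1r lerDl ltW.
have t1 : 1 - t = B / (A + B) by rewrite /t; field; rewrite gt_eqF.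
have Ap : A `^ p != 0 by rewrite gt_eqF// powR_gt0.
have Bp : B `^ p != 0 by rewrite gt_eqF// powR_gt0.
have powRV x B' : 0 <= x -> 0 < B' -> (x / B') `^ p = x `^ p / B' `^ p.
  move=> x0 B'0; rewrite powRM// ?invr_ge0 ?(ltW B'0)//.
  by rewrite -(powR_inv1 (ltW B'0)) -powRrM mulN1r powRN.
have key k : (v k + w k) `^ p <=
    (A + B) `^ p * (t * (v k `^ p / A `^ p) + (1 - t) * (w k `^ p / B `^ p)).
  have -> : v k + w k = (A + B) * (t * (v k / A) + (1 - t) * (w k / B)).
    by rewrite t1 /t; field; rewrite !gt_eqF.
  have vA : 0 <= v k / A by rewrite divr_ge0 ?(ltW A0).
  have wB : 0 <= w k / B by rewrite divr_ge0 ?(ltW B0).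
  have /andP[t0 tl1] := t01.
  rewrite powRM ?(ltW S0)//; last by rewrite addr_ge0// mulr_ge0// subr_ge0.
  rewrite ler_wpM2l ?powR_ge0//.
  apply: le_trans (powR_convex p1 t01 vA wB) _.
  by rewrite !powRV.
apply: (le_trans (ler_sum _ (fun k _ => key k))).
rewrite -mulr_sumr big_split/= -!mulr_sumr -!mulr_suml -hA -hB !mulfV// !mulr1.
by rewrite addrCA subrr addr0 mulr1.
Qed.

Lemma lattice_lpnorm p : 1 <= p -> lattice_norm (lpnorm p).
Proof.
move=> p1; have p0 : 0 < p by rewrite (lt_le_trans _ p1).
split=> [v w|v w|c v]; first exact: lpnorm_le.
  exact: lpnormD.
exact: lpnormZ.
Qed.

End lpnorm.

Lemma lattice_norm_comp (R : realType) (X Y Z : Type) (N : (Z -> R) -> R)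
    (Phi : (Y -> R) -> R) (f : Z -> Y -> X) :
  lattice_norm N -> lattice_norm Phi ->
  lattice_norm (fun b : X -> R => N (fun z => Phi (fun y => b (f z y)))).
Proof.
move=> NP PhiP; split=> [a b ab|a b a0 b0|c a c0 a0].
- apply: lattice_norm_le => // z; rewrite lattice_norm_ge0/= ?lattice_norm_le//.
  by move=> y; have /andP[] := ab (f z y).
- apply: le_trans (lattice_normD NP _ _); try by move=> z; exact: lattice_norm_ge0.
  apply: lattice_norm_le => // z; rewrite lattice_norm_ge0//=.
    exact: lattice_normD.
  by move=> y; rewrite addr_ge0.
- under eq_fun do rewrite lattice_normZ//.
  by rewrite lattice_normZ// => z; exact: lattice_norm_ge0.
Qed.

Section dnorm.
Variables (R : realType) (T : finType).

(** Mixed norm for counting measure, first index innermost as in [iterated_norm]. [b] is evaluated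
    only at sequences as long as [ps]. *)
Fixpoint dnorm (ps : seq R) (b : seq T -> R) : R :=
  if ps is p :: ps' then dnorm ps' (fun ks => lpnorm p (fun k => b (k :: ks)))
  else b [::].

Lemma lattice_dnorm ps : all (fun p => 1 <= p) ps -> lattice_norm (dnorm ps).
Proof.
elim: ps => [_|p ps IH /= /andP[p1 /IH h]].
  by split => [a b h|//|//]; have /andP[] := h [::].
apply: (@lattice_norm_comp _ _ _ _ (dnorm ps) (lpnorm p) (fun ks k => k :: ks) h).
exact: lattice_lpnorm.
Qed.

(** Serves for the constant contribution of large balls on the cells of the central cube, and for
    constants on a one-cell grid. *)
Lemma dnorm_indic ps (S : pred T) (c : R) : all (fun p => 1 <= p) ps -> 0 <= c ->
  dnorm ps (fun ks => if all S ks then c else 0) =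
  c * #|S|%:R `^ (\sum_(p <- ps) p^-1).
Proof.
elim: ps c => [c _ _|p ps IH c /= /andP[p1 ps1] c0].
  by rewrite /= big_nil powRr0 mulr1.
have p0 : 0 < p by rewrite (lt_le_trans _ p1).
have E ks : lpnorm p (fun k => if all S (k :: ks) then c else 0) =
    if all S ks then c * #|S|%:R `^ p^-1 else 0.
  rewrite /lpnorm; case: ifPn => h; last first.
    rewrite big1 ?powR0// ?invr_eq0 ?gt_eqF// => k _.
    by rewrite /= (negbTE h) andbF powR0 ?gt_eqF.
  have -> : \sum_k (if all S (k :: ks) then c else 0) `^ p = \sum_(k | S k) c `^ p.
    rewrite [RHS]big_mkcond; apply: eq_bigr => k _.
    by rewrite /= h andbT; case: ifP => // _; rewrite powR0 ?gt_eqF.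
  rewrite sumr_const -[X in X `^ _]mulr_natr powRM ?powR_ge0//.
  by rewrite -powRrM mulfV ?gt_eqF// powRr1.
under eq_fun do rewrite E.
rewrite IH ?mulr_ge0 ?powR_ge0// big_cons -mulrA; congr *%R.
have [->|S0] := eqVneq #|S| 0%N.
  rewrite [LHS]mulrC [in RHS]powR0 ?[X in _ * X]powR0 ?mulr0// gt_eqF ?invr_gt0//.
  rewrite ltr_wpDr ?invr_gt0// big_seq sumr_ge0// => q /(allP ps1) q1.
  by rewrite invr_ge0 (le_trans _ q1).
by rewrite powRD// pnatr_eq0 S0 implybT.
Qed.

End dnorm.

(** * The maximal function in several coordinates *)

Section multi_maximal.
Variables (R : realType) (L : nat).
Local Notation T := 'I_(3 * 2 ^ L).

(** The level is the same in all coordinates: averages over triples of cubes, not of rectangles. *)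
Fixpoint multi_avg (l : nat) (a : seq T -> R) (ks : seq T) : R :=
  if ks is k :: ks' then near_avg (fun m => multi_avg l (fun ms => a (m :: ms)) ks') l k
  else a [::].

Definition multi_max (a : seq T -> R) (ks : seq T) : R :=
  \big[Num.max/0]_(l < L.+1) multi_avg l a ks.

Lemma multi_max_ge0 a ks : 0 <= multi_max a ks.
Proof. exact: bigmax_ge_id. Qed.

Lemma multi_avg_le_max l a ks : (l <= L)%N -> multi_avg l a ks <= multi_max a ks.
Proof.
rewrite -ltnS => lL.
exact: (le_bigmax _ (fun l : 'I_L.+1 => multi_avg l a ks) (Ordinal lL)).
Qed.

(** Replacing the inner average by its maximum over all levels decouples the level of the first
    coordinate from the others, so that one-dimensional operators can be iterated. *)
Lemma multi_max_cons a k ks : (forall ms, 0 <= a ms) ->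
  multi_max a (k :: ks) <= near_max (fun m => multi_max (fun ms => a (m :: ms)) ks) k.
Proof.
move=> a0; apply: bigmax_le => [|l _]; first exact: near_max_ge0.
have lL : (l <= L)%N by rewrite -ltnS.
apply: le_trans (near_avg_le_max _ _ lL); apply: le_near_avg => m _.
exact: multi_avg_le_max.
Qed.

Lemma multi_avgE l n (a : seq T -> R) (ks : n.-tuple T) :
  multi_avg l a ks = (2 ^+ l) ^- n *
    \sum_(ms : n.-tuple T | [forall i, near_block l (tnth ks i) (tnth ms i)]) a ms.
Proof.
elim: n a ks => [|n IH] a ks.
  rewrite tuple0/= expr0 invr1 mul1r (big_pred1 [tuple])// => ms.
  by rewrite [ms]tuple0 [RHS]eqxx; apply/forallP => -[].
case/tupleP: ks => k ks /=; rewrite /near_avg.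
rewrite (eq_bigr _ (fun m _ => IH (fun ms => a (m :: ms)) ks)).
rewrite -mulr_sumr mulrA -invfM -exprS; congr *%R.
rewrite pair_big_dep/=.
rewrite (reindex (fun x : T * n.-tuple T => [tuple of x.1 :: x.2]))/=; last first.
  exists (fun t : n.+1.-tuple T => (thead t, [tuple of behead t])).
    by move=> [m ms] _ /=; congr pair; apply/val_inj.
  by move=> t _ /=; rewrite [RHS]tuple_eta; apply/val_inj.
apply: eq_bigl => -[m ms] /=; apply/andP/forallP => [[h /forallP h2] i|h].
  case: (unliftP ord0 i) => [j|] ->; last by rewrite !tnth0.
  by rewrite !tnthS.
split; first by have := h ord0; rewrite !tnth0.
by apply/forallP => i; have := h (lift ord0 i); rewrite !tnthS.
Qed.

End multi_maximal.

(** M acts separately for each [k]; with equal inner and outer exponents, exchanging the two sums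
    reduces the claim to [Phi]. *)
Lemma lpnorm_maximal_bounded (R : realType) L (Y : Type) (Phi : (Y -> R) -> R) p C :
  0 < p -> maximal_bounded L Phi p C ->
  maximal_bounded L (fun b : Y * 'I_(3 * 2 ^ L) -> R =>
    lpnorm p (fun k => Phi (fun y => b (y, k)))) p C.
Proof.
move=> p0 PhiB a a0.
have E b : lpnorm p b `^ p = \sum_(k : 'I_(3 * 2 ^ L)) b k `^ p.
  by rewrite lpnorm_powR// gt_eqF.
apply: (@le_trans _ _ (\sum_k \sum_j Phi (fun y => near_max (fun m => a m (y, k)) j) `^ p)).
  by rewrite exchange_big; apply: ler_sum => j _; rewrite E.
apply: (@le_trans _ _ (C * \sum_k \sum_j Phi (fun y => a j (y, k)) `^ p)).
  by rewrite mulr_sumr; apply: ler_sum => k _; apply: PhiB.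
by rewrite exchange_big !mulr_sumr; apply: ler_sum => j _; rewrite E.
Qed.

(** After [vector_maximal] has removed M in the first coordinate, that coordinate becomes a
    parameter and the lattice becomes l^p(Phi), on which M is bounded at exponent p. The induction
    thus generalises q, C, the lattice and its parameter. *)
Lemma dnorm_multi_max_vector (R : realType) (ps : seq R) (q C : R) :
  all (fun p => 1 < p) ps -> 0 < q -> 0 <= C ->
  exists2 C' : R, 0 <= C' & forall L (Y : Type) (Phi : (Y -> R) -> R),
    lattice_norm Phi -> maximal_bounded L Phi q C ->
    forall a : Y -> seq 'I_(3 * 2 ^ L) -> R, (forall y ms, 0 <= a y ms) ->
    dnorm ps (fun ks => Phi (fun y => multi_max (a y) ks)) <=
    C' * dnorm ps (fun ks => Phi (a^~ ks)).
Proof.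
elim: ps q C => [|p ps IH] q C.
  exists 1 => // L Y Phi PhiP _ a a0 /=; rewrite mul1r; apply: lattice_norm_le => // y.
  by rewrite multi_max_ge0/=; apply: bigmax_le.
move=> /= /andP[p1 ps1] q0 C0; have p0 : 0 < p by rewrite (lt_trans _ p1).
have [C1 C10 H1] := vector_maximal q0 C0 p1.
have [C2 C20 H2] := IH p C1 ps1 p0 C10.
exists (C1 `^ p^-1 * C2) => [|L Y Phi PhiP PhiB a a0].
  by rewrite mulr_ge0// powR_ge0.
have psW : all (fun p => 1 <= p) ps by apply: sub_all ps1 => x /ltW.
have dP := lattice_dnorm 'I_(3 * 2 ^ L) psW.
have {}H1 := H1 _ _ _ PhiP PhiB.
pose a' (z : Y * 'I_(3 * 2 ^ L)) ms := a z.1 (z.2 :: ms).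
pose Phi' (b : Y * 'I_(3 * 2 ^ L) -> R) := lpnorm p (fun k => Phi (fun y => b (y, k))).
have Phi'P : lattice_norm Phi'.
  exact: (@lattice_norm_comp R (Y * 'I_(3 * 2 ^ L)) Y 'I_(3 * 2 ^ L) (lpnorm p) Phi
    (fun k y => (y, k)) (lattice_lpnorm _ (ltW p1)) PhiP).
have {}H2 := H2 _ _ _ Phi'P (lpnorm_maximal_bounded p0 H1) a' (fun z ms => a0 _ _).
rewrite -mulrA; apply: le_trans (ler_wpM2l (powR_ge0 _ _) H2).
rewrite -lattice_normZ ?powR_ge0//; last by move=> ks; exact: lpnorm_ge0.
apply: lattice_norm_le => // ks; rewrite lpnorm_ge0/=.
pose b y k := multi_max (a' (y, k)) ks.
apply: le_trans (_ : lpnorm p (fun k => Phi (fun y => near_max (b y) k)) <= _).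
  apply: lpnorm_le => // k; rewrite lattice_norm_ge0//=; last first.
    by move=> y; exact: multi_max_ge0.
  apply: lattice_norm_le => // y; rewrite multi_max_ge0/=.
  exact: multi_max_cons.
rewrite lpnorm_le_powR ?mulr_ge0 ?powR_ge0//.
rewrite powRM ?powR_ge0// -powRrM mulVf ?gt_eqF// powRr1//.
rewrite lpnorm_powR ?gt_eqF//.
by apply: (H1 (fun k y => b y k)) => k y; exact: multi_max_ge0.
Qed.

Lemma dnorm_multi_max (R : realType) (ps : seq R) : all (fun p => 1 < p) ps ->
  exists2 C : R, 0 <= C & forall L (a : seq 'I_(3 * 2 ^ L) -> R),
    (forall ms, 0 <= a ms) -> dnorm ps (multi_max a) <= C * dnorm ps a.
Proof.
move=> ps1; have [C C0 H] := near_max_strong (ltr1n R 2).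
have [C' C'0 H'] := dnorm_multi_max_vector ps1 (ltr0n R 2) C0.
exists C' => // L a a0.
apply: (H' L unit (fun f => f tt) _ _ (fun=> a)) => //.
  by split => [f g h|//|//]; have /andP[] := h tt.
by move=> f f0; apply: H.
Qed.

(** * Mixed norms on R^n *)

Local Open Scope ereal_scope.

(* No measurability: [f] and [g] may be merely Lebesgue measurable, and their
   slices not even that. *)
Lemma ge0_le_integral_raw d (T : measurableType d) (R : realType)
    (mu : {measure set T -> \bar R}) (D : set T) (f g : T -> \bar R) :
  (forall x, D x -> 0 <= f x) -> (forall x, D x -> f x <= g x) ->
  \int[mu]_(x in D) f x <= \int[mu]_(x in D) g x.
Proof.
move=> f0 fg; rewrite integral_mkcond [leRHS]integral_mkcond.
have f0' x : 0 <= (f \_ D) x.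
  by rewrite patchE; case: ifPn => // /set_mem; exact: f0.
have fg' x : (f \_ D) x <= (g \_ D) x.
  by rewrite !patchE; case: ifPn => // /set_mem; exact: fg.
rewrite !ge0_integralTE//; last by move=> x; exact: le_trans (fg' x).
apply: le_ereal_sup => _ [h hf <-]; exists h => // x.
exact: le_trans (hf x) (fg' x).
Qed.

Section Rn_integral.
Variables (R : realType).
Local Notation leb := (@lebesgue_measure R).

Lemma measurable_Rn_cons1 n (y : Rn R n) :
  measurable_fun [set: measurableTypeR R] (fun x => Rn_cons (x, y)).
Proof.
apply: (measurableT_comp (@measurable_Rn_cons R n)).
exact: measurable_pair2.
Qed.

Lemma measurable_Rn_slice n (f : Rn R n.+1 -> \bar R) (y : Rn R n) :
  measurable_fun setT f -> measurable_fun setT (fun x => f (Rn_cons (x, y))).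
Proof. by move=> mf; apply: (measurableT_comp mf); exact: measurable_Rn_cons1. Qed.

Lemma measurable_Rn_integral n (f : Rn R n.+1 -> \bar R) :
  measurable_fun setT f -> (forall x, 0 <= f x) ->
  measurable_fun setT (fun y : Rn R n => \int[leb]_x f (Rn_cons (x, y))).
Proof.
move=> mf f0.
have := @measurable_fun_fubini_tonelli_G _ _ (measurableTypeR R) (Rn R n) R
  leb (f \o @Rn_cons R n).
apply; last by move=> x; exact: f0.
exact: (measurableT_comp mf (@measurable_Rn_cons R n)).
Qed.

Lemma integral_Rn0 (f : Rn R 0 -> \bar R) : measurable_fun setT f ->
  \int[lebesgue_Rn R 0]_z f z = f [tuple].
Proof. by move=> mf; rewrite /= integral_dirac// diracT mul1e. Qed.

Lemma integral_RnS n (f : Rn R n.+1 -> \bar R) :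
  measurable_fun setT f -> (forall x, 0 <= f x) ->
  \int[lebesgue_Rn R n.+1]_z f z =
  \int[lebesgue_Rn R n]_y \int[leb]_x f (Rn_cons (x, y)).
Proof.
move=> mf f0; rewrite /= /lebesgue_step.
rewrite ge0_integral_pushforward//=; last exact: measurable_Rn_cons.
rewrite preimage_setT fubini_tonelli1//; last exact: (measurableT_comp mf (@measurable_Rn_cons R n)).
by rewrite fubini_tonelli//; exact: (measurableT_comp mf (@measurable_Rn_cons R n)).
Qed.

End Rn_integral.

Section poweR_extra.
Variable R : realType.
Implicit Types (x y : \bar R) (r : R).

Lemma le_poweR x y r : (0 <= r)%R -> 0 <= x -> x <= y -> x `^ r <= y `^ r.
Proof.
move=> r0 x0 xy; apply: gt0_ler_poweR => //; rewrite in_itv/= leey andbT//.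
exact: le_trans xy.
Qed.

Lemma poweRK x r : r != 0%R -> 0 <= x -> (x `^ r) `^ r^-1 = x.
Proof. by move=> r0 x0; rewrite -poweRrM mulfV// poweRe1. Qed.

Lemma poweRVK x r : r != 0%R -> 0 <= x -> (x `^ r^-1) `^ r = x.
Proof. by move=> r0 x0; rewrite -poweRrM mulVf// poweRe1. Qed.

Lemma poweR_le_inv x y r : (0 < r)%R -> 0 <= x -> 0 <= y ->
  (x `^ r <= y) = (x <= y `^ r^-1).
Proof.
move=> r0 x0 y0; apply/idP/idP => h.
  by rewrite -[x](@poweRK _ r) ?gt_eqF// le_poweR ?invr_ge0 ?(ltW r0) ?poweR_ge0.
by rewrite -[y](@poweRVK _ r) ?gt_eqF// le_poweR ?(ltW r0).
Qed.

Lemma poweR_ereal_sup (u : nat -> \bar R) r : (0 < r)%R -> (forall n, 0 <= u n) ->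
  ereal_sup (range u) `^ r = ereal_sup (range (fun n => u n `^ r)).
Proof.
move=> r0 u0; have s0 : 0 <= ereal_sup (range u).
  by apply: le_trans (u0 0%N) _; apply: ereal_sup_ubound; exists 0%N.
have s0' : 0 <= ereal_sup (range (fun n => u n `^ r)).
  apply: le_trans (poweR_ge0 (u 0%N) r) _.
  by apply: ereal_sup_ubound; exists 0%N.
apply/eqP; rewrite eq_le; apply/andP; split.
  rewrite poweR_le_inv//; apply: ge_ereal_sup => _ [n _ <-].
  by rewrite -poweR_le_inv//; apply: ereal_sup_ubound; exists n.
apply: ge_ereal_sup => _ [n _ <-]; apply: le_poweR => //; first exact: ltW.
by apply: ereal_sup_ubound; exists n.
Qed.

End poweR_extra.

Lemma integral_ereal_sup d (T : measurableType d) (R : realType)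
    (mu : {measure set T -> \bar R}) (u : nat -> T -> \bar R) :
  (forall n, measurable_fun setT (u n)) -> (forall n x, 0 <= u n x) ->
  (forall x m n, (m <= n)%N -> u m x <= u n x) ->
  \int[mu]_x ereal_sup (range (u^~ x)) =
  ereal_sup (range (fun n => \int[mu]_x u n x)).
Proof.
move=> mu_ u0 ndu.
have := @cvg_monotone_convergence _ _ _ mu setT measurableT u mu_
  (fun n x _ => u0 n x) (fun x _ => ndu x).
have nd : {homo (fun n => \int[mu]_x u n x) : m n / (m <= n)%N >-> m <= n}.
  by move=> m n mn; apply: ge0_le_integral_raw => // x _; exact: ndu.
have /cvg_lim <- // := ereal_nondecreasing_cvgn nd.
move=> /cvg_lim -> //; apply: eq_integral => x _.
by apply/esym/cvg_lim => //; apply: ereal_nondecreasing_cvgn; exact: ndu.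
Qed.

Section mixed_norm_theory.
Variable R : realType.
Local Notation leb := (@lebesgue_measure R).

(** Absorbs into the function the exponent carried by the recursion. This leads to the usual form
    [mixed_normS]: the norm in the first variable, then the mixed norm of the result. *)
Lemma iterated_norm_poweR n (q : R) (p : n.-tuple R) (g : Rn R n -> \bar R) :
  (forall x, 0 <= g x) ->
  iterated_norm q p g = iterated_norm 1%R p (fun x => g x `^ q^-1).
Proof.
case: n p g => [|n] p g g0 /=; first by rewrite invr1 poweRe1// poweR_ge0.
congr iterated_norm; apply/funext => y; apply: eq_integral => x _.
by rewrite -poweRrM divr1 mulrC.
Qed.

Lemma mixed_norm0 (p : 0.-tuple R) (f : Rn R 0 -> \bar R) :
  mixed_norm p f = `|f [tuple]|.
Proof. by rewrite /mixed_norm/= invr1 poweRe1. Qed.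

Lemma mixed_normS n (p : n.+1.-tuple R) (f : Rn R n.+1 -> \bar R) :
  mixed_norm p f = mixed_norm [tuple of behead p]
    (fun y => (\int[leb]_x `|f (Rn_cons (x, y))| `^ thead p) `^ (thead p)^-1).
Proof.
rewrite /mixed_norm [LHS]/= iterated_norm_poweR; last first.
  by move=> y; apply: integral_ge0 => x _; exact: poweR_ge0.
congr iterated_norm; apply/funext => y; rewrite gee0_abs ?poweR_ge0// divr1//.
Qed.

Lemma mixed_norm_ge0 n (p : n.-tuple R) (f : Rn R n -> \bar R) : 0 <= mixed_norm p f.
Proof.
elim: n p f => [|n IH] p f; first by rewrite mixed_norm0.
by rewrite mixed_normS.
Qed.

Lemma tnth_behead_lift n (T : Type) (p : n.+1.-tuple T) (i : 'I_n) :
  tnth [tuple of behead p] i = tnth p (lift ord0 i).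
Proof. by rewrite [in RHS](tuple_eta p) tnthS. Qed.

Lemma le_mixed_norm n (p : n.-tuple R) (f g : Rn R n -> \bar R) :
  (forall i, 0 < tnth p i)%R -> (forall x, `|f x| <= `|g x|) ->
  mixed_norm p f <= mixed_norm p g.
Proof.
elim: n p f g => [|n IH] p f g p0 fg; first by rewrite !mixed_norm0.
rewrite !mixed_normS; apply: IH => [i|y]; first by rewrite tnth_behead_lift.
have pp : (0 < thead p)%R by exact: p0.
rewrite !gee0_abs ?poweR_ge0// le_poweR ?invr_ge0 ?(ltW pp)//.
  by apply: integral_ge0 => x _; exact: poweR_ge0.
apply: ge0_le_integral_raw => x _; first exact: poweR_ge0.
by rewrite le_poweR// ltW.
Qed.

Lemma measurable_mixed_slice n (q : R) (f : Rn R n.+1 -> \bar R) :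
  measurable_fun setT f ->
  measurable_fun setT (fun y => (\int[leb]_x `|f (Rn_cons (x, y))| `^ q) `^ q^-1).
Proof.
move=> mf.
apply: (measurableT_comp (measurable_poweR _)).
apply: (measurable_Rn_integral (f := fun z => `|f z| `^ q)) => [|z]; last exact: poweR_ge0.
apply: (measurableT_comp (measurable_poweR _)).
exact: measurableT_comp.
Qed.

(** Monotone convergence in each variable in turn: powers commute with suprema and inner norms stay
    measurable by Tonelli. *)
Lemma mixed_norm_ereal_sup n (p : n.-tuple R) (u : nat -> Rn R n -> \bar R) :
  (forall i, 0 < tnth p i)%R -> (forall k, measurable_fun setT (u k)) ->
  (forall k x, 0 <= u k x) -> (forall x k m, (k <= m)%N -> u k x <= u m x) ->
  mixed_norm p (fun x => ereal_sup (range (u^~ x))) =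
  ereal_sup (range (fun k => mixed_norm p (u k))).
Proof.
have sup0 (v : nat -> \bar R) : (forall k, 0 <= v k) -> 0 <= ereal_sup (range v).
  by move=> v0; apply: le_trans (v0 0%N) _; apply: ereal_sup_ubound; exists 0%N.
elim: n p u => [|n IH] p u p0 mu u0 ndu.
  rewrite mixed_norm0 gee0_abs; last exact: sup0.
  by congr ereal_sup; apply: eq_imagel => k _; rewrite mixed_norm0 gee0_abs.
have pp : (0 < thead p)%R by exact: p0.
rewrite mixed_normS.
pose v k y := (\int[leb]_x `|u k (Rn_cons (x, y))| `^ thead p) `^ (thead p)^-1.
rewrite (_ : (fun y => _) = fun y => ereal_sup (range (v^~ y))); last first.
  apply/funext => y; rewrite /v -poweR_ereal_sup ?invr_gt0//; last first.
    by move=> k; apply: integral_ge0 => x _; exact: poweR_ge0.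
  congr poweR; rewrite -integral_ereal_sup//.
  - apply: eq_integral => x _; rewrite gee0_abs; last exact: sup0.
    rewrite poweR_ereal_sup//; congr ereal_sup; apply: eq_imagel => k _.
    by rewrite gee0_abs.
  - move=> k; apply: (measurableT_comp (measurable_poweR _)).
    by apply: measurableT_comp => //; exact: measurable_Rn_slice.
  - by move=> k x; exact: poweR_ge0.
  - move=> x k m km; rewrite !gee0_abs// le_poweR ?(ltW pp)//.
    exact: ndu.
rewrite IH.
- by congr ereal_sup; apply: eq_imagel => k _; rewrite mixed_normS.
- by move=> i; rewrite tnth_behead_lift.
- by move=> k; exact: measurable_mixed_slice.
- by move=> k y; exact: poweR_ge0.
- move=> y k m km; apply: le_poweR.
  + by rewrite invr_ge0 ltW.
  + by apply: integral_ge0 => x _; exact: poweR_ge0.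
  + apply: ge0_le_integral_raw => x _; first exact: poweR_ge0.
    by rewrite le_poweR ?(ltW pp)// !gee0_abs// ndu.
Qed.

End mixed_norm_theory.

(** * Comparison of discrete and continuous mixed norms on a grid *)

Section cells.
Variables (R : realType) (T : finType).
Local Notation leb := (@lebesgue_measure R).

(* [J i m] is the set of admissible values of the coordinate [i] in the cells
   whose index in that coordinate is [m]. *)
Fixpoint cell (n : nat) (J : nat -> T -> set R) (ms : seq T) : set (Rn R n) :=
  match n, ms return set (Rn R n) with
  | n'.+1, m :: ms' => fun z : Rn R n'.+1 => J 0%N m (thead z) /\
       cell (fun i => J i.+1) ms' [tuple of behead z]
  | _, _ => fun=> True
  end.

Definition disjoint_cells (J : nat -> T -> set R) : Prop :=
  forall i m m' x, J i m x -> J i m' x -> m = m'.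

Lemma cell_cons n J m ms x (y : Rn R n) :
  cell J (m :: ms) (Rn_cons (x, y)) <-> J 0%N m x /\ cell (fun i => J i.+1) ms y.
Proof.
rewrite /=; have -> : thead (Rn_cons (x, y)) = x by [].
by have -> : [tuple of behead (Rn_cons (x, y))] = y by exact/val_inj.
Qed.

Lemma Rn_consK n (z : Rn R n.+1) : z = Rn_cons (thead z, [tuple of behead z]).
Proof. by rewrite [LHS]tuple_eta; exact/val_inj. Qed.

Lemma cell_tupleP n J (ms : n.-tuple T) (z : Rn R n) :
  cell J ms z <-> forall i : 'I_n, J i (tnth ms i) (tnth z i).
Proof.
elim: n J ms z => [|n IH] J ms z; first by split=> // _ [].
case/tupleP: ms => m ms; rewrite (Rn_consK z) cell_cons IH.
move: (thead z) [tuple of behead z] => x y.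
split=> [[h1 h2] i|h]; last first.
  split; first by have := h ord0; rewrite !tnth0.
  by move=> i; have := h (lift ord0 i); rewrite !tnthS.
case: (unliftP ord0 i) => [j ->|->]; last by rewrite !tnth0.
by rewrite !tnthS; exact: h2.
Qed.

Lemma cell_inj n J (ms ms' : seq T) (z : Rn R n) : disjoint_cells J ->
  size ms = n -> size ms' = n -> cell J ms z -> cell J ms' z -> ms = ms'.
Proof.
elim: n J ms ms' z => [|n IH] J ms ms' z dJ.
  by move=> /size0nil -> /size0nil ->.
case: ms => // m ms; case: ms' => // m' ms' [s1] [s2].
move=> [h1 h2] [h3 h4]; rewrite (dJ _ _ _ _ h1 h3); congr cons.
by apply: (IH (fun i => J i.+1) _ _ _ _ s1 s2 h2 h4) => i; exact: dJ.
Qed.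

Variables (h : R) (h0 : (0 < h)%R).

Definition grid (J : nat -> T -> set R) : Prop :=
  (forall i m, measurable (J i m : set (measurableTypeR R))) /\
  forall i m, leb (J i m) = h%:E.

Lemma gridS J : grid J -> grid (fun i => J i.+1).
Proof. by move=> [mJ hJ]; split=> i m. Qed.

Lemma measurable_cell n J (ms : seq T) : grid J ->
  measurable (cell J ms : set (Rn R n)).
Proof.
elim: n J ms => [|n IH] J ms gJ; first by case: ms => [|m ms]; exact: measurableT.
case: ms => [|m ms]; first exact: measurableT.
have -> : cell J (m :: ms) = (@thead n R : Rn R n.+1 -> measurableTypeR R) @^-1` J 0%N m `&`
    (fun z : Rn R n.+1 => [tuple of behead z] : Rn R n) @^-1` cell (fun i => J i.+1) ms.
  by apply/seteqP; split=> z.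
apply: measurableI; rewrite -[X in measurable X]setTI.
  by apply: measurable_tnth => //; exact: (proj1 gJ).
by apply: measurable_behead => //; apply: IH; exact: gridS.
Qed.

Lemma measure_cell n J (ms : seq T) : grid J -> size ms = n ->
  lebesgue_Rn R n (cell J ms) = (h ^+ n)%:E.
Proof.
elim: n J ms => [|n IH] J ms gJ.
  by move=> /size0nil ->; rewrite /= diracT.
case: ms => // m ms [sz]; rewrite [LHS]/= /lebesgue_step /pushforward.
rewrite (_ : _ @^-1` _ = J 0%N m `*` cell (fun i => J i.+1) ms); last first.
  by apply/seteqP; split=> -[x y]; rewrite /preimage /= => /cell_cons.
rewrite product_measure1E; [|exact: (proj1 gJ)|by apply: measurable_cell; exact: gridS].
rewrite (IH _ _ (gridS gJ) sz) [X in X * _](_ : _ = h%:E); last exact: (proj2 gJ).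
by rewrite -EFinM -exprS.
Qed.

Lemma integral_cell_cons n J m ms (f : Rn R n.+1 -> \bar R) : grid J ->
  measurable_fun setT f -> (forall z, 0 <= f z) ->
  \int[lebesgue_Rn R n.+1]_(z in cell J (m :: ms)) f z =
  \int[lebesgue_Rn R n]_(y in cell (fun i => J i.+1) ms)
     \int[leb]_(x in J 0%N m) f (Rn_cons (x, y)).
Proof.
move=> gJ mf f0; rewrite integral_mkcond integral_RnS; last 2 first.
- apply/(measurable_restrictT _ _).1; first exact: measurable_cell.
  exact: measurable_funTS.
- by move=> z; rewrite patchE; case: ifP.
rewrite [RHS]integral_mkcond; apply: eq_integral => y _.
rewrite patchE; case: ifPn => [/set_mem hy|hy].
  rewrite [RHS]integral_mkcond; apply: eq_integral => x _; rewrite !patchE.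
  case: ifPn => [/set_mem/cell_cons[hx _]|/negP hxy]; first by rewrite mem_set.
  rewrite memNset// => hx; apply: hxy; apply/mem_set/cell_cons; split=> //.
rewrite integral0_eq// => x _; rewrite patchE memNset// => /cell_cons[_ ?].
by move/negP : hy; apply; exact/mem_set.
Qed.

Lemma integral_step (A : T -> set R) (c : T -> R) :
  (forall m, measurable (A m : set (measurableTypeR R))) ->
  (forall m, leb (A m) = h%:E) ->
  (forall m, 0 <= c m)%R ->
  \int[leb]_x (\sum_m (c m)%:E * (\1_(A m) x)%:E) = (h * \sum_m c m)%:E.
Proof.
move=> mA hA c0; rewrite ge0_integral_sum//; last 2 first.
- move=> m; apply: emeasurable_funM => //.
  by apply/measurable_EFinP; exact: measurable_indic.
- by move=> m x _; rewrite mule_ge0// lee_fin.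
rewrite mulr_sumr -sumEFin; apply: eq_bigr => m _.
rewrite ge0_integralZl//; last 2 first.
- by apply/measurable_EFinP; exact: measurable_indic.
- by rewrite lee_fin.
rewrite integral_indic// setIT [X in _ * X](_ : _ = h%:E); last exact: hA.
by rewrite -EFinM mulrC.
Qed.

(** [G] lies below a step function that vanishes off the cells; integrating x_i over intervals of
    length h yields the factor h^(1/p_i). *)
Lemma mixed_norm_step n (p : n.-tuple R) J (b : seq T -> R) (G : Rn R n -> \bar R) :
  (forall i, 1 <= tnth p i)%R -> grid J -> disjoint_cells J ->
  (forall ms, 0 <= b ms)%R -> (forall z, 0 <= G z) ->
  (forall z, 0 < G z -> exists ms : seq T,
     [/\ size ms = n, cell J ms z & G z <= (b ms)%:E]) ->
  mixed_norm p G <= (h `^ sum_inv p * dnorm p b)%:E.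
Proof.
elim: n p J b G => [|n IH] p J b G p1 gJ dJ b0 G0 hG.
  rewrite mixed_norm0 (tuple0 p) /sum_inv big_ord0 powRr0 mul1r /= gee0_abs//.
  have [->|Gp] := eqVneq (G [tuple]) 0; first by rewrite lee_fin.
  have {}Gp : 0 < G [tuple] by rewrite lt_neqAle eq_sym Gp G0.
  by have [ms [/size0nil -> _]] := hG _ Gp.
case/tupleP: p p1 => q p p1.
have q1 : (1 <= q)%R by have := p1 ord0; rewrite tnth0.
have q0 : (0 < q)%R by rewrite (lt_le_trans _ q1).
have p1' i : (1 <= tnth p i)%R by have := p1 (lift ord0 i); rewrite tnthS.
have bE : [tuple of behead [tuple of q :: p]] = p by exact/val_inj.
rewrite mixed_normS theadE bE.
pose b' ks := (h `^ q^-1 * lpnorm q (fun k => b (k :: ks)))%R.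
have b'0 ks : (0 <= b' ks)%R by rewrite mulr_ge0 ?powR_ge0 ?lpnorm_ge0.
have pa : all (fun p => 1 <= p)%R p by apply/all_tnthP.
apply: (@le_trans _ _ (h `^ sum_inv p * dnorm p b')%:E).
  apply: (IH p (fun i => J i.+1)) => //.
  - exact: gridS.
  - by move=> i; exact: dJ.
  - by move=> y; exact: poweR_ge0.
  move=> y Hy.
  have [[ms [sz cy]]|no] := pselect (exists ms, size ms = n /\ cell (fun i => J i.+1) ms y);
      last first.
    move: Hy; rewrite integral0_eq ?poweR0r ?ltxx ?invr_eq0 ?gt_eqF// => x _.
    have [->|Gp] := eqVneq (G (Rn_cons (x, y))) 0; first by rewrite abse0 poweR0r ?gt_eqF.
    have {}Gp : 0 < G (Rn_cons (x, y)) by rewrite lt_neqAle eq_sym Gp G0.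
    have [[|m ms] [// [sz] /cell_cons[_ cy] _]] := hG _ Gp.
    by exfalso; apply: no; exists ms.
  exists ms; split=> //.
  have -> : (b' ms)%:E = ((h * \sum_k b (k :: ms) `^ q)%:E `^ q^-1).
    rewrite poweR_EFin powRM ?(ltW h0)//.
    by apply: sumr_ge0 => k _; exact: powR_ge0.
  apply: le_poweR; first by rewrite invr_ge0 ltW.
    by apply: integral_ge0 => x _; exact: poweR_ge0.
  rewrite -(integral_step (A := J 0%N)); last 3 first.
  - exact: (proj1 gJ).
  - exact: (proj2 gJ).
  - by move=> k; exact: powR_ge0.
  apply: ge0_le_integral_raw => x _; first exact: poweR_ge0.
  rewrite gee0_abs//.
  have s0 : 0 <= \sum_m (b (m :: ms) `^ q)%:E * (\1_(J 0%N m) x)%:E.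
    by apply: sume_ge0 => m _; rewrite mule_ge0// lee_fin ?powR_ge0.
  have [->|Gp] := eqVneq (G (Rn_cons (x, y))) 0; first by rewrite poweR0r ?gt_eqF.
  have {}Gp : 0 < G (Rn_cons (x, y)) by rewrite lt_neqAle eq_sym Gp G0.
  have [[|m ms'] [// [sz'] /cell_cons[cx cy'] Gb]] := hG _ Gp.
  have <- : ms' = ms by apply: cell_inj cy' cy => // i; exact: dJ.
  apply: le_trans (le_poweR (ltW q0) (G0 _) Gb) _.
  rewrite poweR_EFin (bigD1 m)//= indicE mem_set// mule1 leeDl//.
  by apply: sume_ge0 => k _; rewrite mule_ge0// lee_fin ?powR_ge0.
rewrite lee_fin lattice_normZ ?powR_ge0//; last 2 first.
- exact: lattice_dnorm.
- by move=> ks; exact: lpnorm_ge0.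
rewrite mulrA -powRD ?(gt_eqF h0) ?implybT// /sum_inv big_ord_recl tnth0.
under [X in (_ <= _ `^ (_ + X) * _)%R]eq_bigr do rewrite tnthS.
by rewrite addrC.
Qed.

(* Hoelder's inequality for [g] against the step function with the value
   [v k `^ (p - 1)] on [A k]. *)
Lemma hoelder_step (p : R) (A : T -> set R) (v : T -> R) (g : R -> \bar R) :
  (1 < p)%R ->
  (forall m, measurable (A m : set (measurableTypeR R))) ->
  (forall m, leb (A m) = h%:E) ->
  (forall m m' x, A m x -> A m' x -> m = m') ->
  (forall k, 0 <= v k)%R -> (0 < lpnorm p v)%R ->
  measurable_fun [set: measurableTypeR R] g -> (forall x, 0 <= g x) ->
  \sum_k (v k `^ (p - 1))%:E * \int[leb]_(x in A k) g x <=
  (h `^ (1 - p^-1) * lpnorm p v `^ (p - 1))%:E *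
    (\int[leb]_x (g x `^ p)) `^ p^-1.
Proof.
move=> p1 mA hA dA v0 V0 mg g0.
have p0 : (0 < p)%R by rewrite (lt_trans _ p1).
have VpE : (lpnorm p v `^ p = \sum_k v k `^ p)%R by rewrite lpnorm_powR// gt_eqF.
move: (lpnorm p v) V0 VpE => V V0 VpE.
have p10 : (0 < p - 1)%R by rewrite subr_gt0.
set K := (h `^ (1 - p^-1) * V `^ (p - 1))%R.
have K0 : (0 < K)%R by rewrite /K mulr_gt0// powR_gt0.
have I0 : 0 <= \int[leb]_x (g x `^ p) by apply: integral_ge0 => *; exact: poweR_ge0.
have [->|Ioo] := eqVneq (\int[leb]_x (g x `^ p)) +oo.
  rewrite poweRyr ?invr_eq0 ?gt_eqF//.
  by rewrite gt0_muley ?leey// lte_fin.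
have Ifin : \int[leb]_x (g x `^ p) \is a fin_num.
  by rewrite ge0_fin_numE// lt_neqAle Ioo leey.
set N := fine ((\int[leb]_x (g x `^ p)) `^ p^-1).
have N0 : (0 <= N)%R by rewrite fine_ge0// poweR_ge0.
have NE : (\int[leb]_x (g x `^ p)) `^ p^-1 = N%:E by rewrite fineK// fin_num_poweR.
have INE : \int[leb]_x (g x `^ p) = (N `^ p)%:E.
  by rewrite -poweR_EFin -NE poweRVK ?gt_eqF.
rewrite NE -EFinM.
(* Young's inequality after normalization; [N'] avoids a division by zero. *)
have key N' : (N < N')%R ->
    \sum_k (v k `^ (p - 1))%:E * \int[leb]_(x in A k) g x <= (K * N')%:E.
  move=> NN'; have N'0 : (0 < N')%R by rewrite (le_lt_trans N0).
  pose q := (p / (p - 1))%R.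
  have q0 : (0 < q)%R by rewrite divr_gt0.
  have pq : (p^-1 + q^-1 = 1)%R by rewrite /q invf_div; field; rewrite gt_eqF.
  have Vp0 : (0 < V `^ p)%R by rewrite powR_gt0.
  pose c1 := (K * N' * p^-1 * (N' `^ p)^-1)%R.
  pose c2 k := (K * N' * q^-1 * (v k `^ p / (h * V `^ p)))%R.
  have KN0 : (0 <= K * N')%R by rewrite mulr_ge0// ltW.
  have c10 : (0 <= c1)%R.
    by rewrite /c1 -mulrA mulr_ge0// mulr_ge0 ?invr_ge0 ?powR_ge0 ?(ltW p0).
  have c20 k : (0 <= c2 k)%R.
    rewrite /c2 -mulrA mulr_ge0// mulr_ge0 ?invr_ge0 ?(ltW q0)//.
    by rewrite divr_ge0 ?powR_ge0// mulr_ge0 ?(ltW h0) ?(ltW Vp0).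
  have young k x : (v k `^ (p - 1))%:E * g x <= c1%:E * (g x `^ p) + (c2 k)%:E.
    have := g0 x; case: (g x) => [u u0|_|//]; last first.
      rewrite poweRyr ?gt_eqF// [X in _ <= X + _]gt0_muley ?addye ?leey// lte_fin.
      by rewrite /c1 -mulrA mulr_gt0 ?mulr_gt0 ?invr_gt0 ?powR_gt0.
    rewrite poweR_EFin -!EFinM -EFinD lee_fin.
    have uN : (0 <= u / N')%R by rewrite divr_ge0 ?(ltW N'0).
    have hq : (0 < h `^ q^-1 * V `^ (p - 1))%R by rewrite mulr_gt0 ?powR_gt0.
    have vV : (0 <= v k `^ (p - 1) / (h `^ q^-1 * V `^ (p - 1)))%R.
      by rewrite divr_ge0 ?powR_ge0 ?(ltW hq).
    have KE : K = (h `^ q^-1 * V `^ (p - 1))%R by rewrite /K -pq addrC addKr.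
    have -> : (v k `^ (p - 1) * u = K * N' * (u / N' * (v k `^ (p - 1) /
        (h `^ q^-1 * V `^ (p - 1)))))%R.
      by rewrite KE; field; rewrite !gt_eqF// powR_gt0.
    have pq1 : ((p - 1) * q = p)%R by rewrite /q mulrCA mulfV ?mulr1// gt_eqF.
    have e1 : ((u / N') `^ p = u `^ p / N' `^ p)%R.
      rewrite powRM// ?invr_ge0 ?(ltW N'0)//.
      by rewrite -(powR_inv1 (ltW N'0)) -powRrM mulN1r powRN.
    have e2 : ((v k `^ (p - 1) / (h `^ q^-1 * V `^ (p - 1))) `^ q =
        v k `^ p / (h * V `^ p))%R.
      rewrite powRM ?powR_ge0 ?invr_ge0 ?(ltW hq)// -powRrM pq1; congr (_ * _)%R.
      rewrite -(powR_inv1 (ltW hq)) -powRrM mulN1r powRN; congr (_^-1)%R.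
      by rewrite powRM ?powR_ge0// -!powRrM pq1 mulVf ?gt_eqF// powRr1// ltW.
    have := conjugate_powR uN vV p0 q0 pq; rewrite e1 e2 => Y.
    apply: le_trans (ler_wpM2l _ Y) _; first by rewrite mulr_ge0 ?(ltW K0) ?(ltW N'0).
    by rewrite mulrDr /c1 /c2 le_eqVlt; apply/orP; left; apply/eqP; ring.
  apply: (@le_trans _ _ (\sum_k (c1%:E * \int[leb]_(x in A k) (g x `^ p) +
     (c2 k)%:E * h%:E))).
    apply: lee_sum => k _.
    have mgA : measurable_fun (A k : set (measurableTypeR R)) g by exact: measurable_funTS.
    have mgp : measurable_fun (A k : set (measurableTypeR R)) (fun x => g x `^ p).
      exact: (measurableT_comp (measurable_poweR _)).
    rewrite -ge0_integralZl//; last by rewrite lee_fin powR_ge0.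
    apply: (@le_trans _ _ (\int[leb]_(x in A k) (c1%:E * (g x `^ p) + (c2 k)%:E))).
      apply: ge0_le_integral_raw => x _; last exact: young.
      by rewrite mule_ge0// lee_fin powR_ge0.
    rewrite ge0_integralD//; last 3 first.
    - by move=> x _; rewrite mule_ge0// ?lee_fin// poweR_ge0.
    - exact: measurable_funeM.
    - by move=> x _; rewrite lee_fin.
    have -> : \int[leb]_(x in A k) (c2 k)%:E = (c2 k)%:E * h%:E.
      by rewrite -(hA k); exact: (integral_cst _ (mA k)).
    by rewrite ge0_integralZl ?lee_fin// => x _; exact: poweR_ge0.
  rewrite big_split/= -ge0_sume_distrr; last first.
    by move=> k _; apply: integral_ge0 => x _; exact: poweR_ge0.
  have hsum : \sum_k \int[leb]_(x in A k) (g x `^ p) <= (N' `^ p)%:E.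
    apply: (@le_trans _ _ (\int[leb]_x (g x `^ p))).
      under eq_bigr do rewrite integral_mkcond.
      rewrite -ge0_integral_sum//; last 2 first.
      - move=> k; apply/(measurable_restrictT _ _).1 => //.
        by apply: measurable_funTS; exact: (measurableT_comp (measurable_poweR _)).
      - by move=> k x _; rewrite patchE; case: ifP => // _; exact: poweR_ge0.
      apply: ge0_le_integral_raw => x _.
        by apply: sume_ge0 => k _; rewrite patchE; case: ifP => // _; exact: poweR_ge0.
      have [[k kx]|no] := pselect (exists k, A k x).
        rewrite (bigD1 k)//= big1 ?adde0; first by rewrite patchE mem_set.
        move=> i ik; rewrite patchE memNset// => ix.
        by move/eqP : ik; apply; exact: dA ix kx.
      rewrite big1 ?poweR_ge0// => k _; rewrite patchE memNset// => kx.
      by apply: no; exists k.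
    by rewrite INE lee_fin ge0_ler_powR ?nnegrE ?(ltW p0) ?(ltW N'0) ?(ltW NN').
  apply: le_trans (leeD (lee_wpmul2l _ hsum) (lexx _)) _; first by rewrite lee_fin.
  under eq_bigr do rewrite -EFinM.
  rewrite sumEFin -EFinM -EFinD lee_fin.
  have -> : (\sum_k c2 k * h = K * N' * q^-1)%R.
    rewrite -mulr_suml /c2 -mulr_sumr -mulr_suml -VpE.
    by field; rewrite !gt_eqF.
  have -> : (c1 * N' `^ p = K * N' * p^-1)%R.
    by rewrite /c1 mulfVK// gt_eqF// powR_gt0.
  by rewrite -mulrDr pq mulr1.
apply/lee_addgt0Pr => e e0.
have eK : (0 < e / K)%R by rewrite divr_gt0.
apply: le_trans (key (N + e / K)%R _) _; first by rewrite ltrDl.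
by rewrite -EFinD lee_fin mulrDr mulrCA mulfV ?mulr1// gt_eqF.
Qed.

(** Averaging over cells is a contraction for the mixed norm. Pairing with v^(q-1), which is dual to
    v in l^q, and Hoelder in the first variable bound the discrete norm of a row of cells by the
    average of the slice norm [H], to which the induction applies. *)
Lemma dnorm_avg_le n (p : n.-tuple R) J (b : seq T -> R) (f : Rn R n -> \bar R) :
  (forall i, 1 < tnth p i)%R -> grid J -> disjoint_cells J ->
  (forall ms, 0 <= b ms)%R -> measurable_fun setT f -> (forall z, 0 <= f z) ->
  (forall ms, size ms = n ->
     (h ^+ n * b ms)%:E <= \int[lebesgue_Rn R n]_(z in cell J ms) f z) ->
  (h `^ sum_inv p * dnorm p b)%:E <= mixed_norm p f.
Proof.
elim: n p J b f => [|n IH] p J b f p1 gJ dJ b0 mf f0 hb.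
  rewrite mixed_norm0 (tuple0 p) /sum_inv big_ord0 powRr0 mul1r /= gee0_abs//.
  have := hb [::] erefl; rewrite expr0 mul1r => /le_trans; apply.
  by rewrite (_ : cell J [::] = setT)// integral_Rn0.
case/tupleP: p p1 => q p p1.
have q1 : (1 < q)%R by have := p1 ord0; rewrite tnth0.
have q0 : (0 < q)%R by rewrite (lt_trans _ q1).
have p1' i : (1 < tnth p i)%R by have := p1 (lift ord0 i); rewrite tnthS.
have bE : [tuple of behead [tuple of q :: p]] = p by exact/val_inj.
rewrite mixed_normS theadE bE.
pose b' ks := (h `^ q^-1 * lpnorm q (fun k => b (k :: ks)))%R.
have b'0 ks : (0 <= b' ks)%R by rewrite mulr_ge0 ?powR_ge0 ?lpnorm_ge0.
have pa : all (fun p => 1 <= p)%R p by apply/all_tnthP => i; exact/ltW/p1'.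
apply: (@le_trans _ _ (h `^ sum_inv p * dnorm p b')%:E).
  rewrite lee_fin lattice_normZ ?powR_ge0//; last 2 first.
  - exact: lattice_dnorm.
  - by move=> ks; exact: lpnorm_ge0.
  rewrite mulrA -powRD ?(gt_eqF h0) ?implybT// /sum_inv big_ord_recl tnth0.
  under [X in (_ `^ (_ + X) * _ <= _)%R]eq_bigr do rewrite tnthS.
  by rewrite addrC.
apply: (IH p (fun i => J i.+1)) => //.
- exact: gridS.
- by move=> i; exact: dJ.
- exact: measurable_mixed_slice.
- by move=> y; exact: poweR_ge0.
move=> ms sz.
set v := fun k => b (k :: ms); set C' := cell (fun i => J i.+1) ms.
pose H y := (\int[leb]_x (f (Rn_cons (x, y)) `^ q)) `^ q^-1.
rewrite (_ : (fun y => _) = H); last first.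
  by apply/funext => y; rewrite /H; congr poweR; apply: eq_integral => x _; rewrite gee0_abs.
have mH : measurable_fun setT H.
  rewrite (_ : H = fun y => (\int[leb]_x (`|f (Rn_cons (x, y))| `^ q)) `^ q^-1).
    exact: measurable_mixed_slice.
  by apply/funext => y; rewrite /H; congr poweR; apply: eq_integral => x _; rewrite gee0_abs.
have H0 y : 0 <= H y by exact: poweR_ge0.
have mC' : measurable (C' : set (Rn R n)) by apply: measurable_cell; exact: gridS.
have [V0|V0] := eqVneq (lpnorm q v) 0%R.
  by rewrite /b' -/v V0 !mulr0; apply: integral_ge0 => y _; exact: H0.
have {}V0 : (0 < lpnorm q v)%R by rewrite lt_neqAle eq_sym V0 lpnorm_ge0.
have VpE : (lpnorm q v `^ q = \sum_k v k `^ q)%R by rewrite lpnorm_powR// gt_eqF.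
have slice k : measurable_fun C' (fun y => \int[leb]_(x in J 0%N k) f (Rn_cons (x, y))).
  apply: measurable_funTS.
  rewrite (_ : (fun y => _) = fun y => \int[leb]_x
      (f \_ [set z : Rn R n.+1 | J 0%N k (thead z)]) (Rn_cons (x, y))).
    apply: measurable_Rn_integral; last by move=> z; rewrite patchE; case: ifP.
    apply/(measurable_restrictT _ _).1; last exact: measurable_funTS.
    rewrite -[X in measurable X]setTI.
    by apply: (measurable_tnth (ord0 : 'I_n.+1)) => //; exact: (proj1 gJ).
  apply/funext => y; rewrite integral_mkcond; apply: eq_integral => x _.
  by rewrite !patchE; congr (if _ then _ else _); apply/idP/idP => /set_mem ?; exact/mem_set.
have main : (h ^+ n.+1 * lpnorm q v `^ q)%:E <=
    (h `^ (1 - q^-1) * lpnorm q v `^ (q - 1))%:E * \int[lebesgue_Rn R n]_(y in C') H y.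
  rewrite -ge0_integralZl//; last 2 first.
  - exact: measurable_funTS.
  - by rewrite lee_fin mulr_ge0 ?powR_ge0.
  apply: (@le_trans _ _ (\int[lebesgue_Rn R n]_(y in C')
      \sum_k (v k `^ (q - 1))%:E * \int[leb]_(x in J 0%N k) f (Rn_cons (x, y)))); last first.
    apply: ge0_le_integral_raw => y _.
      by apply: sume_ge0 => k _; rewrite mule_ge0 ?lee_fin ?powR_ge0 ?integral_ge0.
    apply: (hoelder_step (v := v)) => //.
    - exact: (proj1 gJ).
    - exact: (proj2 gJ).
    - by move=> m m' x; exact: dJ.
    - by move=> k; exact: b0.
    - exact: measurable_Rn_slice.
  rewrite ge0_integral_sum//; last 2 first.
  - by move=> k; exact: measurable_funeM.
  - by move=> k y _; rewrite mule_ge0 ?lee_fin ?powR_ge0 ?integral_ge0.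
  rewrite VpE mulr_sumr -sumEFin; apply: lee_sum => k _.
  rewrite ge0_integralZl//; last 2 first.
  - by move=> y _; exact: integral_ge0.
  - by rewrite lee_fin powR_ge0.
  rewrite -integral_cell_cons//.
  apply: le_trans (lee_wpmul2l _ (hb (k :: ms) _)); last 2 first.
  - by rewrite lee_fin powR_ge0.
  - by rewrite /= sz.
  rewrite -EFinM lee_fin -(mulr_powRB1 (b0 (k :: ms)) q0).
  by rewrite le_eqVlt; apply/orP; left; apply/eqP; rewrite /v; ring.
have W0 : (0 < h `^ (1 - q^-1) * lpnorm q v `^ (q - 1))%R.
  by apply: mulr_gt0; exact: powR_gt0.
rewrite -(@lee_pmul2l _ (h `^ (1 - q^-1) * lpnorm q v `^ (q - 1))%:E)//.
apply: le_trans main; rewrite -EFinM lee_fin /b' -/v.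
rewrite -(mulr_powRB1 (ltW V0) q0) exprS.
have hE : (h `^ (1 - q^-1) * h `^ q^-1 = h)%R.
  by rewrite -powRD ?(gt_eqF h0) ?implybT// subrK powRr1// ltW.
rewrite -[X in (_ <= X * _ * _)%R]hE le_eqVlt; apply/orP; left; apply/eqP; ring.
Qed.

End cells.

(** * Balls and dyadic cubes *)

Section box_open.
Variables (R : realType) (n : nat).

(** Openness for the sup distance, that is, for the product topology of R^n. *)
Definition box_open (U : set (Rn R n)) : Prop := forall x, U x ->
  exists2 d : R, (0 < d)%R & forall z, (forall i, `|tnth z i - tnth x i| < d)%R -> U z.

Lemma box_open_bigcup I (D : set I) (F : I -> set (Rn R n)) :
  (forall i, D i -> box_open (F i)) -> box_open (\bigcup_(i in D) F i).
Proof.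
move=> oF x [i Di Fx]; have [d d0 dF] := oF i Di x Fx.
by exists d => // z /dF Fz; exists i.
Qed.

(* A union of rational boxes. *)
Lemma box_open_measurable (U : set (Rn R n)) : box_open U -> measurable U.
Proof.
move=> oU.
pose box (q : n.-tuple rat * nat) : set (Rn R n) :=
  [set z | forall i, (`|tnth z i - ratr (tnth q.1 i)| < q.2.+1%:R^-1)%R].
pose F q : set (Rn R n) := if pselect (box q `<=` U) then box q else set0.
have -> : U = \bigcup_q F q.
  apply/seteqP; split=> [x Ux|x [q _]]; last first.
    by rewrite /F; case: pselect => // h; exact: h.
  have [d d0 dU] := oU x Ux.
  pose k := Num.truncn (2 / d)%R.
  pose s : R := (k.+1%:R^-1)%R.
  have s0 : (0 < s)%R by rewrite invr_gt0.
  have sd : (2 * s < d)%R.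
    rewrite /s ltr_pdivrMr// mulrC -ltr_pdivrMr//.
    by rewrite truncnS_gt.
  have hq i : {q : rat | (`|tnth x i - ratr q| < s)%R}.
    apply/cid; have [|q /[!in_itv]/= /andP[q1 q2]] := @rat_in_itvoo R (tnth x i - s) (tnth x i + s).
      by rewrite ltrBlDr -addrA ltrDl addr_gt0.
    by exists q; rewrite ltr_distlC; apply/andP; split=> //; lra.
  pose q := ([tuple sval (hq i) | i < n], k).
  have xq : box q x by move=> i; rewrite /= tnth_mktuple; exact: (svalP (hq i)).
  exists q => //; rewrite /F; case: pselect => // -[] z zq; apply: dU => i.
  have := xq i; have := zq i; rewrite /= -/s => h1 h2.
  have -> : (tnth z i - tnth x i = (tnth z i - ratr (tnth q.1 i)) -
    (tnth x i - ratr (tnth q.1 i)))%R by ring.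
  by apply: le_lt_trans (ler_normB _ _) _; move: h1 h2 sd; rewrite /=; lra.
apply: countable_bigcupT_measurable; first exact: countableP.
move=> q; rewrite /F; case: pselect => //= H; clear H.
have -> : box q = \bigcap_(i in [set: 'I_n])
    [set z : Rn R n | (`|tnth z i - ratr (tnth q.1 i)| < q.2.+1%:R^-1)%R].
  by apply/seteqP; split=> [z h i _|z h i]; [exact: h|exact: (h i I)].
apply: fin_bigcap_measurable => // i _.
have -> : [set z : Rn R n | (`|tnth z i - ratr (tnth q.1 i)| < q.2.+1%:R^-1)%R] =
    (fun z : Rn R n => tnth z i) @^-1` ball (ratr (tnth q.1 i) : R) (q.2.+1%:R^-1)%R.
  by apply/seteqP; split=> z; rewrite /preimage /ball /= distrC.
rewrite -[X in measurable X]setTI.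
by apply: measurable_tnth => //; exact: measurable_ball.
Qed.

(** Superlevel sets are unions of members of [W], hence open. As [w] is arbitrary, M f is Borel
    whatever f is. *)
Lemma measurable_box_open_sup (W : set (set (Rn R n))) (w : set (Rn R n) -> \bar R) :
  (forall B, W B -> box_open B) ->
  measurable_fun setT (fun x => ereal_sup [set w B | B in [set B | W B /\ B x]]).
Proof.
move=> oW; apply: (measurability _ (ErealGenOInfty.measurableE R)).
move=> _ [_ [c ->] <-]; rewrite setTI.
have -> : (fun x => ereal_sup [set w B | B in [set B | W B /\ B x]]) @^-1` `]c%:E, +oo[ =
    \bigcup_(B in [set B | W B /\ c%:E < w B]) B.
  apply/seteqP; split=> x; rewrite /preimage /= in_itv/= andbT.
    move=> /ereal_sup_gt[_ [B [WB Bx] <-] cB]; by exists B.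
  move=> [B [WB cB] Bx]; apply: lt_le_trans cB _.
  by apply: ereal_sup_ubound; exists B.
by apply: box_open_measurable; apply: box_open_bigcup => B [WB _]; exact: oW.
Qed.

End box_open.

Section euclidean_balls.
Variables (R : realType) (n : nat).
Implicit Types (c x y : Rn R n) (rho : R).

Let dist2 x y : R := (\sum_(i < n) (tnth x i - tnth y i) ^+ 2)%R.

Lemma euclidean_ballE c rho x : (0 < rho)%R ->
  euclidean_ball c rho x <-> (dist2 x c < rho ^+ 2)%R.
Proof.
move=> r0; rewrite /euclidean_ball /=; split=> h.
  rewrite -[dist2 x c]sqr_sqrtr; last by apply: sumr_ge0 => i _; exact: sqr_ge0.
  by rewrite ltr_pXn2r// ?nnegrE ?sqrtr_ge0// ltW.
by rewrite -[ltRHS](ger0_norm (ltW r0)) -sqrtr_sqr ltr_sqrt// exprn_gt0.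
Qed.

Lemma euclidean_ball_open c rho : (0 < rho)%R -> box_open (euclidean_ball c rho).
Proof.
move=> r0 x /(euclidean_ballE _ _ r0) xc.
(* For |u| <= d <= 1, (u + v)^2 <= v^2 + d (1 + 2 |v|): a displacement by u in each coordinate
   raises the squared distance to [c] by at most d K. *)
pose K := (\sum_(i < n) (1 + 2 * `|tnth x i - tnth c i|))%R.
have K0 : (0 <= K)%R by apply: sumr_ge0 => i _; rewrite addr_ge0// mulr_ge0.
pose e := (rho ^+ 2 - dist2 x c)%R.
have e0 : (0 < e)%R by rewrite subr_gt0.
pose d := Num.min 1%R (e / (K + 1))%R.
have K1 : (0 < K + 1)%R by rewrite ltr_wpDl.
have d0 : (0 < d)%R by rewrite lt_min ltr01 divr_gt0.
exists d => // z zx; apply/(euclidean_ballE _ _ r0).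
have d1 : (d <= 1)%R by rewrite ge_min lexx.
have dK : (d * K < e)%R.
  apply: (@le_lt_trans _ _ (e / (K + 1) * K)%R).
    by rewrite ler_wpM2r// ge_min lexx orbT.
  by rewrite mulrAC ltr_pdivrMr// ltr_pM2l// ltrDl.
suff : (dist2 z c <= dist2 x c + d * K)%R.
  by move/le_lt_trans; apply; move: dK; rewrite /e; lra.
rewrite /dist2 /K mulr_sumr -big_split/=; apply: ler_sum => i _.
set u := (tnth z i - tnth x i)%R; set v := (tnth x i - tnth c i)%R.
have -> : (tnth z i - tnth c i = u + v)%R by rewrite /u /v; ring.
have ud : (`|u| <= d)%R by rewrite ltW// zx.
have u0 := normr_ge0 u; have v0 := normr_ge0 v.
have h1 : (u ^+ 2 <= d)%R.
  by rewrite -[(u ^+ 2)%R]real_normK ?num_real// expr2; nra.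
have h2 : (u * v <= d * `|v|)%R.
  by apply: (le_trans (ler_norm _)); rewrite normrM ler_wpM2r.
by rewrite sqrrD -mulr_natl; nra.
Qed.

Lemma balls_open (B : set (Rn R n)) : balls B -> box_open B.
Proof. by move=> [c [rho [r0 ->]]]; exact: euclidean_ball_open. Qed.

Lemma euclidean_ball_coord c rho x y i : (0 < rho)%R ->
  euclidean_ball c rho x -> euclidean_ball c rho y ->
  (`|tnth x i - tnth y i| < 2 * rho)%R.
Proof.
move=> r0 hx hy.
have key z : euclidean_ball c rho z -> (`|tnth z i - tnth c i| < rho)%R.
  move=> /(euclidean_ballE _ _ r0) h.
  rewrite -(@ltr_pXn2r _ 2)// ?nnegrE// ?(ltW r0)// real_normK ?num_real//.
  apply: le_lt_trans h; rewrite /dist2 (bigD1 i)//= lerDl.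
  by apply: sumr_ge0 => j _; exact: sqr_ge0.
have -> : (tnth x i - tnth y i = (tnth x i - tnth c i) - (tnth y i - tnth c i))%R by ring.
by apply: le_lt_trans (ler_normB _ _) _; have := key _ hx; have := key _ hy; lra.
Qed.

(** The ball contains the cube of side rho / (n + 1) with lower corner [c], because n < (n + 1)^2,
    also for n = 0. *)
Lemma measure_euclidean_ball c rho : (0 < rho)%R ->
  ((rho / n.+1%:R) ^+ n)%:E <= lebesgue_Rn R n (euclidean_ball c rho).
Proof.
move=> r0; set s := (rho / n.+1%:R)%R.
have s0 : (0 < s)%R by rewrite divr_gt0.
pose J (i : nat) (_ : unit) : set R := [set` `[nth 0 c i, nth 0 c i + s[%R].
have gJ : grid s J.
  split=> i m; first exact: measurable_itv.
  rewrite lebesgue_measure_itv /= lte_fin ltrDl s0.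
  by rewrite -EFinB addrAC subrr add0r.
rewrite -(measure_cell gJ (size_nseq n tt)).
apply: le_measure; rewrite ?inE.
- exact: measurable_cell gJ.
- by apply: box_open_measurable; exact: euclidean_ball_open.
move=> z; rewrite (_ : nseq n tt = [tuple of nseq n tt])// => /cell_tupleP hz.
apply/(euclidean_ballE _ _ r0).
apply: (@le_lt_trans _ _ (\sum_(i < n) s ^+ 2)%R).
  apply: ler_sum => i _; have := hz i; rewrite /J /= in_itv/= -tnth_nth => /andP[h1 h2].
  by rewrite ler_pXn2r ?nnegrE ?(ltW s0)//; lra.
rewrite sumr_const card_ord -mulr_natl /s exprMn mulrCA gtr_pMr ?exprn_gt0//.
rewrite exprVn ltr_pdivrMr ?exprn_gt0// mul1r -natrX ltr_nat.
by rewrite expnS expn1; nia.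
Qed.

End euclidean_balls.

Lemma integral_cover d (T : measurableType d) (R : realType)
    (mu : {measure set T -> \bar R}) (I : finType) (P : pred I) (A : I -> set T)
    (B : set T) (f : T -> \bar R) :
  measurable_fun setT f -> (forall x, 0 <= f x) -> (forall i, measurable (A i)) ->
  (forall x, B x -> exists2 i, P i & A i x) ->
  \int[mu]_(x in B) f x <= \sum_(i | P i) \int[mu]_(x in A i) f x.
Proof.
move=> mf f0 mA BA; rewrite integral_mkcond.
under eq_bigr do rewrite integral_mkcond.
have r0 i x : 0 <= (f \_ (A i)) x by rewrite patchE; case: ifP.
rewrite -big_filter -ge0_integral_sum//; last first.
  move=> i; apply/(measurable_restrictT _ _).1 => //; exact: measurable_funTS.
apply: ge0_le_integral_raw => x _; first by rewrite patchE; case: ifP.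
rewrite big_filter patchE; case: ifPn => [/set_mem/BA[i Pi Ax]|_]; last exact: sume_ge0.
rewrite (bigD1 i)//= patchE mem_set// leeDl//; exact: sume_ge0.
Qed.

(** * Dyadic intervals and cubes, neighbours and ancestors *)

Section dyadic_index.
Variable R : realType.
Implicit Types (x y : R) (j : int).

Definition dyadic_index j x : int := Num.floor (2 ^ j * x)%R.

Lemma exp2z_gt0 j : (0 < (2 : R) ^ j)%R.
Proof. by rewrite exprz_gt0. Qed.

Lemma exp2zN j : ((2 : R) ^ (- j) = (2 ^ j)^-1)%R.
Proof. by rewrite invr_expz. Qed.

Lemma exp2zD j j' : ((2 : R) ^ (j + j') = 2 ^ j * 2 ^ j')%R.
Proof. by rewrite expfzDr. Qed.

Lemma dyadic_indexP j x (k : int) :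
  dyadic_index j x = k <-> (2 ^ (- j) * k%:~R <= x < 2 ^ (- j) * (k + 1)%:~R)%R.
Proof.
rewrite exp2zN ler_pdivrMl ?exp2z_gt0// ltr_pdivlMl ?exp2z_gt0//.
split=> [<-|]; last exact: floor_def.
by apply: real_floor_itv; exact: num_real.
Qed.

Lemma dyadic_index_set j (k : int) : [set x | dyadic_index j x = k] =
  [set` `[(2 ^ (- j) * k%:~R)%R, (2 ^ (- j) * (k + 1)%:~R)%R[ ] :> set R.
Proof. by apply/seteqP; split=> x /=; rewrite in_itv/= => /dyadic_indexP. Qed.

Lemma dyadic_index_shift j (l : nat) x :
  dyadic_index (j - l%:Z) x = (dyadic_index j x %/ 2 ^+ l)%Z.
Proof.
set d := (2 ^+ l)%R; have d0 : (0 < d)%R by rewrite exprn_gt0.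
set m := dyadic_index j x; set q := (m %/ d)%Z.
have h2 : ((2 : R) ^ (j - l%:Z) = 2 ^ j / d%:~R)%R.
  by rewrite exp2zD exp2zN rmorphXn.
have dR : (0 < d%:~R :> R)%R by rewrite ltr0z.
have /andP[hm1 hm2] : (m%:~R <= 2 ^ j * x < (m + 1)%:~R)%R.
  by apply: real_floor_itv; exact: num_real.
apply: floor_def; rewrite h2 mulrAC ler_pdivlMr// ltr_pdivrMr//; apply/andP; split.
  apply: le_trans hm1; rewrite -rmorphM ler_int /q.
  by rewrite [leRHS](divz_eq m d) lerDl modz_ge0// gt_eqF.
apply: (lt_le_trans hm2); rewrite -rmorphM ler_int lezD1 /q mulrDl mul1r.
by rewrite [ltLHS](divz_eq m d) ltrD2l ltz_pmod.
Qed.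

Lemma dyadic_index_near j x y : (2 ^ j * `|x - y| < 1)%R ->
  (dyadic_index j x <= dyadic_index j y + 1)%R.
Proof.
move=> h; rewrite -ltzD1 -(@ltr_int R).
have /andP[h1 _] : ((dyadic_index j x)%:~R <= 2 ^ j * x < (dyadic_index j x + 1)%:~R)%R.
  by apply: real_floor_itv; exact: num_real.
have /andP[_ h2] : ((dyadic_index j y)%:~R <= 2 ^ j * y < (dyadic_index j y + 1)%:~R)%R.
  by apply: real_floor_itv; exact: num_real.
have h3 : (2 ^ j * (x - y) < 1)%R.
  by apply: le_lt_trans h; rewrite ler_wpM2l ?ler_norm// ltW ?exp2z_gt0.
by rewrite [ltRHS]rmorphD/=; move: h1 h2 h3; rewrite mulrBr; lra.
Qed.

Lemma exists_dyadic_scale y : (0 < y)%R ->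
  exists j : int, (2 ^ (- (j + 1)) < y <= 2 ^ (- j))%R.
Proof.
move=> y0; have l2 : (0 < ln 2 :> R)%R by rewrite ln_gt0// ltr1n.
have lnz (i : int) : (ln (2 ^ i) = i%:~R * ln 2 :> R)%R.
  by rewrite -powR_intmul// ln_powR.
pose i := (Num.ceil (ln y / ln 2))%R.
have /andP[h1 h2] : ((i - 1)%:~R < ln y / ln 2 <= i%:~R)%R.
  by apply: real_ceil_itv; exact: num_real.
exists (- i)%R; rewrite opprD !opprK; apply/andP; split.
  rewrite ltNge; apply/negP => h; move: h1; rewrite ltNge => /negP; apply.
  by rewrite ler_pdivrMr// -lnz ler_ln ?posrE ?exp2z_gt0.
rewrite leNgt; apply/negP => h; move: h2; rewrite leNgt => /negP; apply.
by rewrite ltr_pdivlMr// -lnz ltr_ln ?posrE ?exp2z_gt0.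
Qed.

End dyadic_index.

Section dyadic_cubes.
Variables (R : realType) (n : nat).
Implicit Types (j : int) (k : n.-tuple int) (x : Rn R n).

(* [nu] stands for the shift [nu - 1], with entries in {-1, 0, 1}. *)
Definition neighbour k (nu : n.-tuple 'I_3) : n.-tuple int :=
  [tuple (tnth k i + (tnth nu i)%:Z - 1)%R | i < n].

Definition ancestor (l : nat) k : n.-tuple int :=
  [tuple (tnth k i %/ 2 ^+ l)%Z | i < n].

Lemma dyadic_cubeP j k x :
  dyadic_cube j k x <-> forall i, dyadic_index j (tnth x i) = tnth k i.
Proof. by split=> h i; have := h i => /dyadic_indexP. Qed.

(** Lets the sum over the set of cubes be indexed by pairs (j, k). If 2^-j' < 2^-j, the lower corner
    and its translate by 2^-j' both lie in the cube, which is impossible in a half-open cube of side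
    2^-j'. *)
Lemma dyadic_cube_inj : (0 < n)%N ->
  forall j k j' k', dyadic_cube j k = dyadic_cube j' k' :> set (Rn R n) ->
  j = j' /\ k = k'.
Proof.
move=> n0.
pose corner j k : Rn R n := [tuple (2 ^ (- j) * (tnth k i)%:~R)%R | i < n].
have cornerP j k : dyadic_cube j k (corner j k).
  by move=> i; rewrite tnth_mktuple lexx/= ltr_pM2l ?exp2z_gt0// ltr_int ltzD1.
have len j k j' k' : dyadic_cube j k = dyadic_cube j' k' :> set (Rn R n) ->
    ((2 : R) ^ (- j) <= 2 ^ (- j'))%R.
  move=> e; pose i0 := Ordinal n0; rewrite leNgt; apply/negP => lt.
  have h1 : dyadic_cube j' k' (corner j k) by rewrite -e; exact: cornerP.
  pose y : Rn R n := [tuple (tnth (corner j k) i + 2 ^ (- j'))%R | i < n].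
  have : dyadic_cube j' k' y.
    rewrite -e => i; rewrite !tnth_mktuple; apply/andP; split.
      by rewrite lerDl ltW ?exp2z_gt0.
    by rewrite rmorphD/= mulrDr mulr1 ltrD2l.
  move=> /(_ i0) /andP[_]; have /andP[+ _] := h1 i0.
  by rewrite [tnth y _]tnth_mktuple rmorphD/= mulrDr mulr1; lra.
move=> j k j' k' e.
have jj : j = j'.
  have /eqP : ((2 : R) ^ (- j) = 2 ^ (- j'))%R.
    by apply/eqP; rewrite eq_le (len _ _ _ _ e) (len _ _ _ _ (esym e)).
  move/eqP/(congr1 (@ln R)); rewrite -!powR_intmul// !ln_powR => /mulIf.
  rewrite gt_eqF ?ln_gt0 ?ltr1n// => /(_ isT) /eqP.
  by rewrite eqr_int eqr_opp => /eqP.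
split=> //; apply: eq_from_tnth => i.
have := cornerP j k; rewrite e jj => /dyadic_cubeP <-.
by apply/esym; have := cornerP j k; rewrite -jj => /dyadic_cubeP ->.
Qed.

(** A grid with a single cell, so that the results on cells apply to one cube. *)
Definition cube_side j (k : n.-tuple int) (i : nat) (_ : unit) : set R :=
  [set x | dyadic_index j x = nth 0%R k i].

Lemma cube_cell j k : dyadic_cube j k = cell (cube_side j k) (nseq n tt).
Proof.
apply/seteqP; split=> x; rewrite (_ : nseq n tt = [tuple of nseq n tt])//.
  by move=> /dyadic_cubeP h; apply/cell_tupleP => i; rewrite /cube_side/= -tnth_nth h.
by move=> /cell_tupleP h; apply/dyadic_cubeP => i; rewrite [RHS](tnth_nth 0%R); exact: (h i).
Qed.

Lemma dyadic_index_measure j (k : int) :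
  lebesgue_measure [set x : R | dyadic_index j x = k] = ((2 : R) ^ (- j))%:E.
Proof.
rewrite dyadic_index_set lebesgue_measure_itv/= lte_fin ltr_pM2l ?exp2z_gt0//.
rewrite ltr_int ltzD1 lexx -EFinB -mulrBr rmorphD/= addrAC subrr add0r mulr1//.
Qed.

Lemma dyadic_index_measurable j (k : int) :
  measurable ([set x : R | dyadic_index j x = k] : set (measurableTypeR R)).
Proof. by rewrite dyadic_index_set; exact: measurable_itv. Qed.

Lemma cube_grid j k : grid ((2 : R) ^ (- j)) (cube_side j k).
Proof.
by split=> i m; [exact: dyadic_index_measurable|exact: dyadic_index_measure].
Qed.

Lemma measurable_dyadic_cube j k : measurable (dyadic_cube j k : set (Rn R n)).
Proof. by rewrite cube_cell; apply: measurable_cell (cube_grid j k); exact: exp2z_gt0. Qed.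

Lemma measure_dyadic_cube j k :
  lebesgue_Rn R n (dyadic_cube j k) = (((2 : R) ^ (- j)) ^+ n)%:E.
Proof.
by rewrite cube_cell; exact: measure_cell (cube_grid j k) (size_nseq n tt).
Qed.

End dyadic_cubes.

Section cube_norms.
Variables (R : realType) (n : nat) (p : n.-tuple R).
Hypothesis p1 : (forall i, 1 < tnth p i)%R.
Implicit Types (j : int) (k : n.-tuple int) (f : Rn R n -> \bar R).

Definition on_cube f j k : Rn R n -> \bar R :=
  fun x => f x * (\1_(dyadic_cube j k) x)%:E.

Lemma on_cubeE f j k : on_cube f j k = f \_ (dyadic_cube j k).
Proof.
apply/funext => x; rewrite /on_cube patchE indicE.
by case: ifPn => [/set_mem h|/negP h]; rewrite ?mule1 ?mule0.
Qed.

Lemma on_cube_ge0 f j k : (forall x, 0 <= f x) -> forall x, 0 <= on_cube f j k x.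
Proof. by move=> f0 x; rewrite on_cubeE patchE; case: ifP. Qed.

Lemma measurable_on_cube f j k : measurable_fun setT f ->
  measurable_fun setT (on_cube f j k).
Proof.
move=> mf; rewrite on_cubeE; apply/(measurable_restrictT _ _).1.
  exact: measurable_dyadic_cube.
exact: measurable_funTS.
Qed.

Let h j : R := (2 ^ (- j))%R.

Let h0 j : (0 < h j)%R := exp2z_gt0 R (- j).

(** Hoelder for the mean over a cube, read off from [dnorm_avg_le] on the one-cell grid: every
    constant c not exceeding the mean obeys the bound. *)
Lemma integral_cube_le f j k : measurable_fun setT f -> (forall x, 0 <= f x) ->
  (((2 ^ j) ^+ n)%:E * \int[lebesgue_Rn R n]_(x in dyadic_cube j k) f x <=
    ((2 ^ j) `^ sum_inv p)%:E * mixed_norm p (on_cube f j k)).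
Proof.
move=> mf f0; set I := \int[_]_(x in _) f x; set F := mixed_norm _ _.
have I0 : 0 <= I by exact: integral_ge0.
have F0 : 0 <= F by exact: mixed_norm_ge0.
have e0 : (0 < 2 ^ j :> R)%R by exact: exp2z_gt0.
have hE : (h j = (2 ^ j)^-1)%R by rewrite /h exp2zN.
have pa : all (fun p => 1 <= p)%R p by apply/all_tnthP => i; exact/ltW/p1.
have key (c : R) : (0 <= c)%R -> (h j ^+ n * c)%:E <= I ->
    (h j `^ sum_inv p * c)%:E <= F.
  move=> c0 hc.
  have := @dnorm_avg_le R unit (h j) (h0 j) n p (cube_side j k) (fun=> c)
    (on_cube f j k) p1 (cube_grid R j k) _ (fun=> c0) (measurable_on_cube j k mf)
    (on_cube_ge0 j k f0).
  have -> : dnorm p (fun _ : seq unit => c) = c.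
    have := dnorm_indic (xpredT : pred unit) pa c0.
    under eq_fun do rewrite all_predT.
    by rewrite cardT enumT unlock/= powR1 mulr1.
  apply; first by move=> i [] [].
  move=> ms sz; rewrite (_ : ms = nseq n tt); last first.
    by rewrite -sz; elim: {sz} ms => //= -[] ms IH; congr cons.
  rewrite -cube_cell on_cubeE -integral_mkcondr setIid; exact: hc.
have [->|Foo] := eqVneq F +oo.
  by rewrite gt0_muley ?leey// lte_fin powR_gt0.
have Ffin : F \is a fin_num by rewrite ge0_fin_numE// lt_neqAle Foo leey.
pose c0 := (fine F / h j `^ sum_inv p)%R.
have c00 : (0 <= c0)%R by rewrite divr_ge0 ?powR_ge0 ?fine_ge0.
have hp : (0 < h j `^ sum_inv p)%R by rewrite powR_gt0.
have hn : (0 < h j ^+ n)%R by rewrite exprn_gt0.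
have key2 (c : R) : (0 <= c)%R -> (h j ^+ n * c)%:E <= I -> (c <= c0)%R.
  by move=> c1 /(key _ c1); rewrite -[F]fineK// lee_fin /c0 ler_pdivlMr// mulrC.
have Ic : I <= (h j ^+ n * c0)%:E.
  (* An infinite integral would admit every constant, among them c0 + 1. *)
  have [Ioo|Ioo] := eqVneq I +oo.
    have := key2 (c0 + 1)%R; rewrite Ioo leey => /(_ _ isT).
    by rewrite addr_ge0// => /(_ isT); rewrite gerDl ler10.
  have Ifin : I \is a fin_num by rewrite ge0_fin_numE// lt_neqAle Ioo leey.
  have := key2 (fine I / h j ^+ n)%R; rewrite divr_ge0 ?fine_ge0 ?(ltW hn)//.
  rewrite mulrCA mulfV ?gt_eqF// mulr1 fineK// => /(_ isT (lexx _)).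
  by rewrite ler_pdivrMr// mulrC -[X in _ -> X <= _]fineK// lee_fin.
apply: le_trans (lee_wpmul2l _ Ic) _; first by rewrite lee_fin exprn_ge0 ?ltW.
rewrite -[F]fineK// -!EFinM lee_fin /c0 hE exprVn mulVKf; last by rewrite gt_eqF// exprn_gt0.
have -> : ((2 ^ j)^-1 `^ sum_inv p = ((2 ^ j) `^ sum_inv p)^-1)%R.
  by rewrite -[in LHS]powR_inv1 ?(ltW e0)// -powRrM mulN1r powRN.
by rewrite invrK mulrC.
Qed.

End cube_norms.

Section balls_and_cubes.
Variables (R : realType) (n : nat).
Implicit Types (f : Rn R n -> \bar R) (j : int).

Definition ball_average f (B : set (Rn R n)) : \bar R :=
  (lebesgue_Rn R n B)^-1 * \int[lebesgue_Rn R n]_(y in B) `|f y|.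

(** The ball has measure at least (rho / (n + 1))^n and 4 rho 2^j > 1; the 4 is a factor 2 for the
    diameter and a factor 2 for rounding to a dyadic scale. *)
Lemma ball_average_le f c (rho : R) j : (forall x, 0 <= f x) ->
  (0 < rho)%R -> (2 ^ (- (j + 1)) < 2 * rho)%R ->
  ball_average f (euclidean_ball c rho) <=
  ((4 * n.+1%:R) ^+ n)%:E *
    (((2 ^ j) ^+ n)%:E * \int[lebesgue_Rn R n]_(y in euclidean_ball c rho) f y).
Proof.
move=> f0 r0 jr; rewrite /ball_average.
have -> : \int[lebesgue_Rn R n]_(y in euclidean_ball c rho) `|f y| =
    \int[lebesgue_Rn R n]_(y in euclidean_ball c rho) f y.
  by apply: eq_integral => y _; rewrite gee0_abs.
set I := \int[_]_(y in _) f y; have I0 : 0 <= I by exact: integral_ge0.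
have s0 : (0 < (rho / n.+1%:R) ^+ n)%R by rewrite exprn_gt0// divr_gt0.
have e0 := exp2z_gt0 R j.
apply: (@le_trans _ _ ((((rho / n.+1%:R) ^+ n)^-1)%:E * I)).
  rewrite lee_wpmul2r//.
  have -> : (((rho / n.+1%:R) ^+ n)^-1)%:E = (((rho / n.+1%:R) ^+ n)%:E)^-1.
    by rewrite inver gt_eqF.
  by rewrite lee_pV2 ?inE ?measure_euclidean_ball// lee_fin ltW.
rewrite muleA -EFinM lee_wpmul2r// lee_fin -exprMn -exprVn lerXn2r ?nnegrE//.
- by rewrite invr_ge0 divr_ge0// ltW.
- by rewrite !mulr_ge0// ltW.
rewrite invf_div ler_pdivrMr//.
have -> : (4 * n.+1%:R * 2 ^ j * rho = n.+1%:R * (2 ^ j * (4 * rho)))%R by ring.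
rewrite ler_peMr//.
move: jr; rewrite opprD exp2zD !exp2zN expr1z => jr.
have : ((2 ^ j)^-1 < 4 * rho)%R by lra.
by rewrite -(ltr_pM2l e0) mulfV ?gt_eqF// => /ltW.
Qed.

Lemma ball_dyadic_index_near j c (rho : R) (x y : Rn R n) i : (0 < rho)%R ->
  (2 * rho <= 2 ^ (- j))%R ->
  euclidean_ball c rho x -> euclidean_ball c rho y ->
  (dyadic_index j (tnth x i) <= dyadic_index j (tnth y i) + 1)%R.
Proof.
move=> r0 rj Bx By; apply: dyadic_index_near.
have := euclidean_ball_coord i r0 Bx By => /lt_le_trans/(_ rj).
by rewrite exp2zN -(ltr_pM2l (exp2z_gt0 R j)) mulfV// gt_eqF// exp2z_gt0.
Qed.

Lemma near_neighbour (a b : int) : (a <= b + 1)%R -> (b <= a + 1)%R ->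
  exists m : 'I_3, a = (b + m%:Z - 1)%R.
Proof.
move=> ab ba; have lt : (absz (a - b + 1)%R < 3)%N by lia.
by exists (Ordinal lt); rewrite /=; lia.
Qed.

Lemma near_cube_neighbour j (k : n.-tuple int) (x : Rn R n) :
  (forall i, dyadic_index j (tnth x i) <= tnth k i + 1)%R ->
  (forall i, tnth k i <= dyadic_index j (tnth x i) + 1)%R ->
  exists nu, dyadic_cube j (neighbour k nu) x.
Proof.
move=> h1 h2.
pose nu := [tuple sval (cid (near_neighbour (h1 i) (h2 i))) | i < n].
exists nu; apply/dyadic_cubeP => i; rewrite !tnth_mktuple.
exact: (svalP (cid (near_neighbour (h1 i) (h2 i)))).
Qed.

End balls_and_cubes.

Section subcubes.
Variables (R : realType) (j0 : int) (L : nat).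
Local Notation T := 'I_(3 * 2 ^ L).

(* The cells of side [2 ^ - (j0 + L)] in the triple of a cube of side [2 ^ - j0]
   are numbered by [T], starting from [fine_base] in each coordinate. *)
Definition fine_level : int := (j0 + L%:Z)%R.

Definition fine_base (k : int) : int := ((k - 1) * 2 ^+ L)%R.

Lemma fine_index k (z : R) : (k <= dyadic_index j0 z + 1)%R ->
  (dyadic_index j0 z <= k + 1)%R ->
  exists m : T, dyadic_index fine_level z = (fine_base k + m%:Z)%R.
Proof.
move=> h1 h2; set D := dyadic_index fine_level z.
have e : dyadic_index j0 z = (D %/ 2 ^+ L)%Z.
  by rewrite -dyadic_index_shift /fine_level addrK.
have d0 : (0 < 2 ^+ L :> int)%R by rewrite exprn_gt0.
have := divz_eq D (2 ^+ L); rewrite -e.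
have := modz_ge0 D (lt0r_neq0 d0); have := ltz_pmod D d0.
have e3 : (3 * 2 ^ L)%N%:Z = (3 * 2 ^+ L)%R by rewrite -natz natrM natrX.
move: (D %% 2 ^+ L)%Z h1 h2 => r; move: (dyadic_index j0 z) => q h1 h2 r1 r0 DE.
have w0 : (0 <= D - fine_base k)%R by rewrite DE /fine_base; nia.
have w3 : (D - fine_base k < (3 * 2 ^ L)%N%:Z)%R by rewrite DE e3 /fine_base; nia.
have lt : (absz (D - fine_base k)%R < 3 * 2 ^ L)%N by lia.
by exists (Ordinal lt); rewrite /=; lia.
Qed.

(** [fine_base] is a multiple of 2^L, so for l <= L the blocks of level l are true dyadic intervals
    and [near_block] is adjacency on the line. *)
Lemma fine_index_shift k (m : nat) (l : nat) : (l <= L)%N ->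
  ((fine_base k + m%:Z) %/ 2 ^+ l)%Z = ((k - 1) * 2 ^+ (L - l) + (m %/ 2 ^ l)%N%:Z)%R.
Proof.
move=> lL; rewrite /fine_base -{1}(subnK lL) exprD mulrA divzMDl; last first.
  by rewrite gt_eqF// exprn_gt0.
by congr +%R; rewrite -divz_nat; congr divz; rewrite -natz natrX.
Qed.

Lemma fine_index_near k (z z' : R) (m m' : T) (l : nat) : (l <= L)%N ->
  dyadic_index fine_level z = (fine_base k + m%:Z)%R ->
  dyadic_index fine_level z' = (fine_base k + m'%:Z)%R ->
  (dyadic_index (fine_level - l%:Z) z <= dyadic_index (fine_level - l%:Z) z' + 1)%R ->
  (dyadic_index (fine_level - l%:Z) z' <= dyadic_index (fine_level - l%:Z) z + 1)%R ->
  near_block l m m'.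
Proof.
move=> lL e e'; rewrite !dyadic_index_shift e e' !fine_index_shift//.
by rewrite /near_block => h1 h2; apply/andP; split; lia.
Qed.

Lemma fine_index_center k (z : R) (m : T) : dyadic_index j0 z = k ->
  dyadic_index fine_level z = (fine_base k + m%:Z)%R -> (m %/ 2 ^ L = 1)%N.
Proof.
have -> : j0 = (fine_level - L%:Z)%R by rewrite /fine_level addrK.
rewrite dyadic_index_shift => + e; rewrite e fine_index_shift// subnn expr0.
lia.
Qed.

Definition fine_side n (k : n.-tuple int) (i : nat) (m : T) : set R :=
  [set z | dyadic_index fine_level z = (fine_base (nth 0%R k i) + m%:Z)%R].

Lemma fine_grid n (k : n.-tuple int) : grid (2 ^ (- fine_level))%R (fine_side k).
Proof.
by split=> i m; [exact: dyadic_index_measurable|exact: dyadic_index_measure].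
Qed.

Lemma fine_disjoint n (k : n.-tuple int) : disjoint_cells (fine_side k).
Proof.
move=> i m m' z; rewrite /fine_side /= => -> /addrI [] e; exact: val_inj.
Qed.

Lemma fine_cellP n (k : n.-tuple int) (ms : n.-tuple T) (x : Rn R n) :
  cell (fine_side k) ms x <-> forall i,
    dyadic_index fine_level (tnth x i) = (fine_base (tnth k i) + (tnth ms i)%:Z)%R.
Proof.
split=> [/cell_tupleP h i|h]; last apply/cell_tupleP => i.
  by have := h i; rewrite /fine_side /= -tnth_nth.
by rewrite /fine_side /= -tnth_nth.
Qed.

Lemma fine_cell_exists n (k : n.-tuple int) (x : Rn R n) :
  (forall i, tnth k i <= dyadic_index j0 (tnth x i) + 1)%R ->
  (forall i, dyadic_index j0 (tnth x i) <= tnth k i + 1)%R ->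
  exists ms : n.-tuple T, cell (fine_side k) ms x.
Proof.
move=> h1 h2; exists [tuple sval (cid (fine_index (h1 i) (h2 i))) | i < n].
apply/fine_cellP => i; rewrite tnth_mktuple.
exact: (svalP (cid (fine_index (h1 i) (h2 i)))).
Qed.

End subcubes.

Lemma exp2z_le (R : realType) (i j : int) : (i <= j)%R -> ((2 : R) ^ i <= 2 ^ j)%R.
Proof. by move=> ij; rewrite -!powR_intmul// ler_powR ?ler1n// ler_int. Qed.

Lemma int_subz_absz (i j : int) : (j <= i)%R -> j = (i - `|i - j|%N%:Z)%R.
Proof. lia. Qed.

(** * Local estimate of the maximal function *)

Section truncated_maximal.
Variables (R : realType) (n : nat) (f : Rn R n -> \bar R).

Definition large_balls (s : R) : set (set (Rn R n)) :=
  [set B | exists c rho, [/\ (0 < rho)%R, (s < 2 * rho)%R & B = euclidean_ball c rho]].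

Definition trunc_maximal (s : R) (x : Rn R n) : \bar R :=
  ereal_sup [set ball_average f B | B in [set B | large_balls s B /\ B x]].

Lemma measurable_trunc_maximal s : measurable_fun setT (trunc_maximal s).
Proof.
apply: measurable_box_open_sup => B [c [rho [r0 _ ->]]].
exact: euclidean_ball_open.
Qed.

Lemma measurable_hl_maximal : measurable_fun setT (hl_maximal f).
Proof. by apply: measurable_box_open_sup => B; exact: balls_open. Qed.

Lemma ball_average_ge0 B : 0 <= ball_average f B.
Proof.
by rewrite mule_ge0 ?inve_ge0// integral_ge0.
Qed.

Lemma trunc_maximal_le s s' x : (s' <= s)%R -> trunc_maximal s x <= trunc_maximal s' x.
Proof.
move=> ss; apply: le_ereal_sup => _ [B [[c [rho [r0 sr ->]]] Bx] <-].
exists (euclidean_ball c rho) => //; split=> //; exists c, rho; split=> //.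
exact: le_lt_trans sr.
Qed.

Lemma trunc_maximal_ge0 s x : 0 <= trunc_maximal s x.
Proof.
pose rho := (`|s| + 1)%R.
have r0 : (0 < rho)%R by rewrite ltr_wpDl.
have Bx : euclidean_ball x rho x.
  apply/euclidean_ballE => //.
  rewrite big1 ?exprn_gt0// => i _; by rewrite subrr expr0n.
apply: le_trans (ball_average_ge0 (euclidean_ball x rho)) _.
apply: ereal_sup_ubound; exists (euclidean_ball x rho) => //; split=> //.
exists x, rho; split=> //; rewrite /rho mulrDr mulr1.
by have := ler_norm s; have := normr_ge0 s; lra.
Qed.

Lemma hl_maximal_trunc (j0 : int) x :
  hl_maximal f x =
  ereal_sup (range (fun L : nat => trunc_maximal (2 ^ (- (fine_level j0 L + 1)))%R x)).
Proof.
apply/eqP; rewrite eq_le; apply/andP; split; apply: ge_ereal_sup.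
  move=> _ [B [[c [rho [r0 ->]]] Bx] <-].
  have [j /andP[jr _]] := exists_dyadic_scale (mulr_gt0 (ltr0n R 2) r0).
  pose L := `|j - j0|%N.
  apply: (@le_trans _ _ (trunc_maximal (2 ^ (- (fine_level j0 L + 1)))%R x)); last first.
    by apply: ereal_sup_ubound; exists L.
  apply: ereal_sup_ubound; exists (euclidean_ball c rho) => //; split=> //.
  exists c, rho; split=> //; apply: le_lt_trans jr.
  by apply: exp2z_le; rewrite /fine_level /L; lia.
move=> _ [L _ <-]; apply: le_ereal_sup => _ [B [[c [rho [r0 _ ->]]] Bx] <-].
by exists (euclidean_ball c rho) => //; split=> //; exists c, rho.
Qed.

End truncated_maximal.

Section local_estimate.
Variables (R : realType) (n : nat) (p : n.-tuple R).
Hypothesis p1 : (forall i, 1 < tnth p i)%R.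
Variables (f : Rn R n -> \bar R).
Hypotheses (mf : measurable_fun setT f) (f0 : forall x, 0 <= f x).
Variables (j0 : int) (k0 : n.-tuple int).
Hypothesis finF : forall k, mixed_norm p (on_cube f j0 k) < +oo.
Local Notation mu := (lebesgue_Rn R n).

(** Ensures that [fine] loses nothing in the cell averages [a] below. *)
Lemma integral_cube_lty k : \int[mu]_(x in dyadic_cube j0 k) f x < +oo.
Proof.
have := integral_cube_le p1 j0 k mf f0; rewrite ltNge leye_eq => h; apply/negP => /eqP e.
move: h; rewrite e gt0_muley ?lte_fin ?exprn_gt0 ?exp2z_gt0// leye_eq => /eqP.
have := finF k; have := mixed_norm_ge0 p (on_cube f j0 k).
by case: (mixed_norm _ _).
Qed.

Section fine.
Variable L : nat.
Local Notation T := 'I_(3 * 2 ^ L).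
Let h : R := (2 ^ (- fine_level j0 L))%R.
Let h0 : (0 < h)%R := exp2z_gt0 R _.
Local Notation J := (@fine_side R j0 L n k0).

(** The averages are kept apart for each neighbour, so that each family is controlled by the local
    norm of [f] on a single cube. *)
Let a (nu : n.-tuple 'I_3) (ms : seq T) : R :=
  (fine (\int[mu]_(x in cell J ms) on_cube f j0 (neighbour k0 nu) x) / h ^+ n)%R.

Let a_ge0 nu ms : (0 <= a nu ms)%R.
Proof.
rewrite divr_ge0 ?exprn_ge0 ?(ltW h0)// fine_ge0// integral_ge0// => x _.
exact: on_cube_ge0.
Qed.

Let integral_a nu ms :
  \int[mu]_(x in cell J ms) on_cube f j0 (neighbour k0 nu) x = (h ^+ n * a nu ms)%:E.
Proof.
rewrite /a mulrC divfK ?gt_eqF ?exprn_gt0// fineK//.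
have g0 := on_cube_ge0 j0 (neighbour k0 nu) f0.
rewrite ge0_fin_numE; last by apply: integral_ge0.
apply: le_lt_trans (integral_cube_lty (neighbour k0 nu)).
rewrite integral_mkcond [leRHS]integral_mkcond -on_cubeE.
apply: ge0_le_integral_raw => x _; rewrite patchE; case: ifP => //.
Qed.

Let dnorm_a nu : (h `^ sum_inv p * dnorm p (a nu))%:E <=
  mixed_norm p (on_cube f j0 (neighbour k0 nu)).
Proof.
apply: (dnorm_avg_le h0 p1 (fine_grid R j0 L k0)).
- exact: fine_disjoint.
- exact: a_ge0.
- exact: measurable_on_cube.
- exact: on_cube_ge0.
- by move=> ms _; rewrite integral_a.
Qed.

(** Such a ball stays in the triple of the cube and meets only cells near that of [x] at level l.
    Covering it by intersections of cells with neighbours splits the integral into the sums behind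
    [multi_avg]. *)
Let fine_ball c (rho : R) x (ms : n.-tuple T) (l : nat) : (0 < rho)%R -> (l <= L)%N ->
  (2 * rho <= 2 ^ (- (fine_level j0 L - l%:Z)))%R ->
  euclidean_ball c rho x -> dyadic_cube j0 k0 x -> cell J ms x ->
  ((2 ^ (fine_level j0 L - l%:Z)) ^+ n)%:E * \int[mu]_(y in euclidean_ball c rho) f y <=
  (\sum_nu multi_avg l (a nu) ms)%:E.
Proof.
move=> r0 lL rj Bx /dyadic_cubeP Qx /fine_cellP cx.
set j := (fine_level j0 L - l%:Z)%R in rj *.
have rj0 : (2 * rho <= 2 ^ (- j0))%R.
  by apply: (le_trans rj); apply: exp2z_le; rewrite /j /fine_level; lia.
pose I := (n.-tuple 'I_3 * n.-tuple T)%type.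
pose P (ms' : n.-tuple T) := [forall i, near_block l (tnth ms i) (tnth ms' i)].
pose A (x : I) := cell J x.2 `&` dyadic_cube j0 (neighbour k0 x.1).
have mA i : measurable (A i : set (Rn R n)).
  apply: measurableI; last exact: measurable_dyadic_cube.
  exact: measurable_cell (fine_grid R j0 L k0).
have cov y : euclidean_ball c rho y -> exists2 i : I, xpredT i.1 && P i.2 & A i y.
  move=> By.
  have n1 i : (tnth k0 i <= dyadic_index j0 (tnth y i) + 1)%R.
    by rewrite -(Qx i); exact: ball_dyadic_index_near Bx By.
  have n2 i : (dyadic_index j0 (tnth y i) <= tnth k0 i + 1)%R.
    by rewrite -(Qx i); exact: ball_dyadic_index_near By Bx.
  have [nu hnu] := near_cube_neighbour n2 n1.
  have [ms' hms'] := fine_cell_exists L n1 n2.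
  exists (nu, ms') => //=; apply/forallP => i; move/fine_cellP : hms' => hms'.
  apply: (fine_index_near lL (cx i) (hms' i)).
    exact: ball_dyadic_index_near Bx By.
  exact: ball_dyadic_index_near By Bx.
apply: le_trans (lee_wpmul2l _ (integral_cover mu mf f0 mA cov)) _.
  by rewrite lee_fin exprn_ge0// ltW// exp2z_gt0.
have -> : \sum_(i : I | xpredT i.1 && P i.2) \int[mu]_(x in A i) f x =
    (\sum_(i : I | xpredT i.1 && P i.2) h ^+ n * a i.1 i.2)%:E.
  rewrite -sumEFin; apply: eq_bigr => i _.
  by rewrite -integral_a on_cubeE -integral_mkcondr.
rewrite -EFinM lee_fin -(pair_big xpredT P (fun nu (ms' : n.-tuple T) => h ^+ n * a nu ms')%R)/=.
rewrite mulr_sumr; apply: ler_sum => nu _; rewrite multi_avgE -mulr_sumr mulrA.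
rewrite /h -exprMn exp2zN /j exp2zD exp2zN mulrAC mulfV ?mul1r; last first.
  by rewrite gt_eqF// exp2z_gt0.
by rewrite exprVn.
Qed.

Let coarse_ball c (rho : R) x (l : nat) : (0 < rho)%R ->
  (2 * rho <= 2 ^ (- (j0 - l%:Z)))%R ->
  euclidean_ball c rho x -> dyadic_cube j0 k0 x ->
  \int[mu]_(y in euclidean_ball c rho) f y <=
  \sum_nu \int[mu]_(y in dyadic_cube (j0 - l%:Z) (neighbour (ancestor l k0) nu)) f y.
Proof.
move=> r0 rj Bx /dyadic_cubeP Qx.
apply: integral_cover => // [nu|y By]; first exact: measurable_dyadic_cube.
have ax i : dyadic_index (j0 - l%:Z) (tnth x i) = tnth (ancestor l k0) i.
  by rewrite dyadic_index_shift Qx tnth_mktuple.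
have [|i|nu hnu] := @near_cube_neighbour R n (j0 - l%:Z)%R (ancestor l k0) y.
- by move=> i; rewrite -ax; exact: ball_dyadic_index_near By Bx.
- by rewrite -ax; exact: ball_dyadic_index_near Bx By.
by exists nu.
Qed.

Variables (C c : R).
Hypotheses (C0 : (0 <= C)%R) (c0 : (0 <= c)%R).
Hypothesis dnormC : forall b : seq T -> R, (forall ms, 0 <= b ms)%R ->
  (dnorm p (multi_max b) <= C * dnorm p b)%R.
Hypothesis coarse : forall l, (0 < l)%N ->
  \sum_nu ((2 ^ (j0 - l%:Z)) ^+ n)%:E *
    \int[mu]_(y in dyadic_cube (j0 - l%:Z) (neighbour (ancestor l k0) nu)) f y <= c%:E.

Let Cn : R := ((4 * n.+1%:R) ^+ n)%R.

Let center (m : T) : bool := (m %/ 2 ^ L == 1)%N.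

(** Majorant on the cube, constant on cells; [center] selects the middle third in each coordinate,
    which is the cube itself. *)
Let bound (ms : seq T) : R :=
  (if all center ms then Cn * (\sum_nu multi_max (a nu) ms + c) else 0)%R.

Let trunc_le_bound x (ms : n.-tuple T) : dyadic_cube j0 k0 x -> cell J ms x ->
  trunc_maximal f (2 ^ (- (fine_level j0 L + 1)))%R x <= (bound ms)%:E.
Proof.
move=> Qx cx; have -> : bound ms = (Cn * (\sum_nu multi_max (a nu) ms + c))%R.
  rewrite /bound ifT//; apply/all_tnthP => i; rewrite /center; apply/eqP.
  move/dyadic_cubeP : Qx => Qx; move/fine_cellP : cx => cx.
  exact: fine_index_center (Qx i) (cx i).
apply: ge_ereal_sup => _ [B [[c' [rho [r0 sr ->]]] Bx] <-].
have [j /andP[jr rj]] := exists_dyadic_scale (mulr_gt0 (ltr0n R 2) r0).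
apply: (le_trans (ball_average_le c' f0 r0 jr)).
have Cn0 : (0 <= Cn)%R by rewrite exprn_ge0.
rewrite EFinM lee_wpmul2l ?lee_fin//.
have S0 : (0 <= \sum_nu multi_max (a nu) ms)%R.
  by apply: sumr_ge0 => nu _; exact: multi_max_ge0.
(* Scales above the cube fall under [coarse], those between mesh and cube under [fine_ball]; the
   truncation excludes the rest. *)
have [jj|jj] := leP j0 j; last first.
  pose l := `|j0 - j|%N.
  have jE : j = (j0 - l%:Z)%R by exact/int_subz_absz/ltW.
  have l0 : (0 < l)%N by rewrite /l absz_gt0 subr_eq0 gt_eqF.
  rewrite jE in rj jr *.
  apply: le_trans (lee_wpmul2l _ (coarse_ball r0 rj Bx Qx)) _.
    by rewrite lee_fin exprn_ge0// ltW// exp2z_gt0.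
  rewrite ge0_sume_distrr; last by move=> nu _; exact: integral_ge0.
  by apply: (le_trans (coarse l0)); rewrite lee_fin lerDr.
have jN : (j <= fine_level j0 L)%R.
  rewrite leNgt; apply/negP => lt.
  have := lt_le_trans sr rj; rewrite ltNge => /negP; apply.
  by apply: exp2z_le; rewrite lerN2 lezD1.
pose l := `|fine_level j0 L - j|%N.
have jE : j = (fine_level j0 L - l%:Z)%R by exact: int_subz_absz.
have lL : (l <= L)%N.
  by move: jN jj; rewrite /l /fine_level; move: L j {jr rj l jE} => L' j; clear; lia.
rewrite jE in rj jr *.
apply: (le_trans (fine_ball r0 lL rj Bx Qx cx)); rewrite lee_fin.
rewrite -[leLHS]addr0 lerD// ler_sum// => nu _.
exact: multi_avg_le_max.
Qed.

Lemma trunc_maximal_local :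
  mixed_norm p (on_cube (trunc_maximal f (2 ^ (- (fine_level j0 L + 1)))%R) j0 k0) <=
  (Cn * (C + 1))%:E * (\sum_nu mixed_norm p (on_cube f j0 (neighbour k0 nu)) +
    ((2 ^ (- j0)) `^ sum_inv p * c)%:E).
Proof.
have pa : all (fun p => 1 <= p)%R p by apply/all_tnthP => i; exact/ltW/p1.
have dP := lattice_dnorm T pa.
have Cn0 : (0 <= Cn)%R by rewrite exprn_ge0.
have M0 ms : (0 <= \sum_nu multi_max (a nu) ms)%R.
  by apply: sumr_ge0 => nu _; exact: multi_max_ge0.
have b0 ms : (0 <= bound ms)%R.
  by rewrite /bound; case: ifP => // _; rewrite mulr_ge0// addr_ge0.
apply: (@le_trans _ _ (h `^ sum_inv p * dnorm p bound)%:E).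
  apply: (mixed_norm_step h0 _ (fine_grid R j0 L k0)) => //.
  - by move=> i; exact/ltW/p1.
  - exact: fine_disjoint.
  - by apply: on_cube_ge0 => x; exact: trunc_maximal_ge0.
  move=> x; rewrite on_cubeE patchE; case: ifPn => [/set_mem Qx _|]; last by rewrite ltxx.
  have /dyadic_cubeP Qx' := Qx.
  have [||ms cx] := @fine_cell_exists R j0 L n k0 x.
  - by move=> i; rewrite Qx' lerDl.
  - by move=> i; rewrite Qx' lerDl.
  by exists ms; split; [exact: size_tuple|exact: cx|exact: trunc_le_bound].
pose call (ms : seq T) : R := if all center ms then c else 0%R.
have call0 ms : (0 <= call ms)%R by rewrite /call; case: ifP.
have d1 : (dnorm p bound <= Cn * (\sum_nu C * dnorm p (a nu) + dnorm p call))%R.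
  apply: (@le_trans _ _ (dnorm p (fun ms => Cn * (\sum_nu multi_max (a nu) ms + call ms))%R)).
    apply: lattice_norm_le => // ms; rewrite b0/= /bound /call; case: ifP => // _.
    by rewrite mulr_ge0// addr0.
  rewrite lattice_normZ//; last by move=> ms; rewrite addr_ge0.
  rewrite ler_wpM2l//; apply: le_trans (lattice_normD dP _ _) _ => //.
  rewrite lerD2r; apply: le_trans (lattice_norm_sum dP _ _ _) _.
    by move=> nu ms; exact: multi_max_ge0.
  by apply: ler_sum => nu _; apply: dnormC => ms; exact: a_ge0.
have d2 : (dnorm p call <= c * (2 ^+ L) `^ sum_inv p)%R.
  rewrite dnorm_indic// ler_wpM2l// big_tuple -/(sum_inv p).
  rewrite ge0_ler_powR ?nnegrE ?exprn_ge0//.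
    by apply: sumr_ge0 => i _; rewrite invr_ge0 ltW// (lt_trans _ (p1 i)).
  by rewrite -natrX ler_nat; exact: card_block_le.
(* The mesh cancels: h 2^L is the side of the cube for every [L]. *)
have hL : (h `^ sum_inv p * (2 ^+ L) `^ sum_inv p = (2 ^ (- j0)) `^ sum_inv p)%R.
  rewrite -powRM ?exprn_ge0 ?(ltW h0)//; congr powR.
  by rewrite /h /fine_level opprD exp2zD (exp2zN R L) -exprnP mulfVK// expf_neq0.
have hs0 : (0 <= h `^ sum_inv p)%R by exact: powR_ge0.
have CC : (0 <= Cn * (C + 1))%R by rewrite mulr_ge0// addr_ge0.
apply: (@le_trans _ _ ((Cn * (C + 1))%:E * (\sum_nu (h `^ sum_inv p * dnorm p (a nu))%:E +
    ((2 ^ (- j0)) `^ sum_inv p * c)%:E))); last first.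
  by rewrite lee_wpmul2l ?lee_fin// leeD2r// lee_sum// => nu _; exact: dnorm_a.
rewrite sumEFin -EFinD -EFinM lee_fin -mulr_sumr -hL.
have dS0 : (0 <= \sum_nu dnorm p (a nu))%R.
  by apply: sumr_ge0 => nu _; apply: lattice_norm_ge0.
move: d1; rewrite -mulr_sumr; move: dS0; set S := (\sum_nu dnorm p (a nu))%R => S0 d1.
apply: (@le_trans _ _ (h `^ sum_inv p * (Cn * (C * S + c * (2 ^+ L) `^ sum_inv p)))%R).
  rewrite ler_wpM2l//; apply: (le_trans d1); rewrite ler_wpM2l// lerD2l//.
have -> : (h `^ sum_inv p * (Cn * (C * S + c * (2 ^+ L) `^ sum_inv p)) =
  Cn * (C * (h `^ sum_inv p * S) + h `^ sum_inv p * (2 ^+ L) `^ sum_inv p * c))%R by ring.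
rewrite -[leRHS]mulrA ler_wpM2l// mulrDr lerD//.
  by rewrite mulrDl mul1r lerDl mulr_ge0.
by rewrite mulrDl mul1r lerDr mulr_ge0// mulr_ge0// mulr_ge0// powR_ge0.
Qed.

End fine.
End local_estimate.

(** [c] stands for the contribution of balls larger than the cube, estimated later from the
    Bourgain-Morrey terms of the ancestors. *)
Lemma maximal_local (R : realType) (n : nat) (p : n.-tuple R) :
  (forall i, 1 < tnth p i)%R ->
  exists2 K : R, (0 <= K)%R & forall (f : Rn R n -> \bar R) (j0 : int)
    (k0 : n.-tuple int) (c : R),
  measurable_fun setT f -> (forall x, 0 <= f x) ->
  (forall k, mixed_norm p (on_cube f j0 k) < +oo) -> (0 <= c)%R ->
  (forall l, (0 < l)%N -> \sum_nu ((2 ^ (j0 - l%:Z)) ^+ n)%:E *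
    \int[lebesgue_Rn R n]_(y in
      dyadic_cube (j0 - l%:Z) (neighbour (ancestor l k0) nu)) f y <= c%:E) ->
  mixed_norm p (on_cube (hl_maximal f) j0 k0) <=
  K%:E * (\sum_nu mixed_norm p (on_cube f j0 (neighbour k0 nu)) +
    ((2 ^ (- j0)) `^ sum_inv p * c)%:E).
Proof.
move=> p1; have pa : all (fun p => 1 < p)%R p by exact/all_tnthP.
have [C C0 H] := dnorm_multi_max pa.
exists ((4 * n.+1%:R) ^+ n * (C + 1))%R.
  by rewrite mulr_ge0 ?exprn_ge0// addr_ge0.
move=> f j0 k0 c mf f0 finF c0 coarse.
pose u L := on_cube (trunc_maximal f (2 ^ (- (fine_level j0 L + 1)))%R) j0 k0.
rewrite (_ : on_cube (hl_maximal f) j0 k0 = fun x => ereal_sup (range (u^~ x))); last first.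
  apply/funext => x; rewrite /u on_cubeE patchE.
  case: ifPn => Qx.
    rewrite (hl_maximal_trunc f j0); congr ereal_sup; apply: eq_imagel => L _.
    by rewrite on_cubeE patchE Qx.
  apply/eqP; rewrite eq_le; apply/andP; split.
    by apply: ereal_sup_ubound; exists 0%N => //; rewrite on_cubeE patchE (negbTE Qx).
  by apply: ge_ereal_sup => _ [L _ <-]; rewrite on_cubeE patchE (negbTE Qx).
rewrite mixed_norm_ereal_sup.
- apply: ge_ereal_sup => _ [L _ <-]; apply: trunc_maximal_local => //.
  by move=> b b0; exact: H.
- by move=> i; rewrite (lt_trans _ (p1 i)).
- by move=> L; apply: measurable_on_cube; exact: measurable_trunc_maximal.
- by move=> L; apply: on_cube_ge0 => x; exact: trunc_maximal_ge0.
- move=> x L L' LL'; rewrite /u !on_cubeE !patchE; case: ifP => // _.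
  apply: trunc_maximal_le; apply: exp2z_le; rewrite /fine_level; lia.
Qed.

(** * From Lebesgue to Borel measurable functions *)

Section completion.
Context d (T : measurableType d) (R : realType).
Variable mu : {measure set T -> \bar R}.

(** The sets so enclosed form a sigma-algebra containing the generators; a complement is enclosed
    from below by the complement of the union of A and N, with the same N. *)
Lemma completed_sandwich (E : set T) : <<s completed_algebra_gen mu >> E ->
  exists A N, [/\ measurable A, measurable N, mu N = 0, A `<=` E & E `<=` A `|` N].
Proof.
pose S := [set E : set T | exists A N,
  [/\ measurable A, measurable N, mu N = 0, A `<=` E & E `<=` A `|` N]].
apply: (@smallest_sub _ (sigma_algebra setT) _ S); last first.
  move=> _ [A mA [N [N' [mN' N'0 NN']]] <-]; exists A, N'; split=> //.
  by move=> x [Ax|/NN' ?]; [left|right].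
split.
- by exists set0, set0; split.
- move=> E' [A [N [mA mN N0 AE EAN]]]; rewrite setTD.
  exists (~` (A `|` N)), N; split=> //.
  + by apply: measurableC; exact: measurableU.
  + by move=> x h /EAN.
  + move=> x Ex; have [Nx|Nx] := pselect (N x); first by right.
    by left=> -[/AE|].
- move=> F SF; pose A k := sval (cid (SF k)).
  pose N k := sval (cid (svalP (cid (SF k)))).
  have AN k : [/\ measurable (A k), measurable (N k), mu (N k) = 0, A k `<=` F k &
    F k `<=` A k `|` N k] := svalP (cid (svalP (cid (SF k)))).
  exists (\bigcup_k A k), (\bigcup_k N k); split.
  + by apply: bigcupT_measurable => k; have [] := AN k.
  + by apply: bigcupT_measurable => k; have [] := AN k.
  + apply/negligibleP; first by apply: bigcupT_measurable => k; have [] := AN k.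
    by apply: negligible_bigcup => k; have [_ mN N0 _ _] := AN k; exists (N k); split.
  + by move=> x [k _ Akx]; exists k => //; have [_ _ _ h _] := AN k; exact: h.
  + move=> x [k _ Fkx]; have [_ _ _ _ h] := AN k.
    by have [Ax|Nx] := h _ Fkx; [left|right]; exists k.
Qed.

Lemma measurable_completed (f : T -> \bar R) : measurable_fun setT f ->
  measurable_fun [set: g_sigma_algebraType (completed_algebra_gen mu)] f.
Proof.
move=> mf _ Y mY; apply: sub_sigma_algebra.
exists (f @^-1` Y); first by rewrite -[X in measurable X]setTI; exact: mf.
by exists set0; [exact: negligible_set0|rewrite setU0 setTI].
Qed.

(* [g] is the supremum of [q] on measurable lower approximations of [{q < f}]. *)
Lemma measurable_lower_version (f : T -> \bar R) : (forall x, 0 <= f x) ->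
  measurable_fun [set: g_sigma_algebraType (completed_algebra_gen mu)] f ->
  exists (g : T -> \bar R) N, [/\ measurable_fun setT g, (forall x, 0 <= g x <= f x),
    measurable N, mu N = 0 & forall x, ~ N x -> g x = f x].
Proof.
move=> f0 mf.
have sand (q : rat) : exists A N, [/\ measurable A, measurable N, mu N = 0,
    A `<=` [set x | (ratr q)%:E < f x] & [set x | (ratr q)%:E < f x] `<=` A `|` N].
  apply: completed_sandwich.
  have := @emeasurable_fun_o_infty _ (g_sigma_algebraType (completed_algebra_gen mu)) R
    setT f measurableT mf (ratr q)%:E.
  by rewrite setTI.
pose A q := sval (cid (sand q)); pose N q := sval (cid (svalP (cid (sand q)))).
have AN q : [/\ measurable (A q), measurable (N q), mu (N q) = 0,
    A q `<=` [set x | (ratr q)%:E < f x] & [set x | (ratr q)%:E < f x] `<=` A q `|` N q].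
  exact: (svalP (cid (svalP (cid (sand q))))).
pose g x : \bar R := ereal_sup ([set (ratr q : R)%:E | q in [set q | A q x]] `|` [set 0]).
have g0 x : 0 <= g x by apply: ereal_sup_ubound; right.
have gf x : g x <= f x.
  apply: ge_ereal_sup => _ [[q Aqx <-]|-> //].
  by have [_ _ _ h _] := AN q; exact/ltW/h.
have mNN : measurable (\bigcup_q N q).
  by apply: bigcupT_measurable_rat => q; have [] := AN q.
exists g, (\bigcup_q N q); split=> //.
- apply: (measurability _ (ErealGenOInfty.measurableE R)) => _ [_ [c ->] <-].
  rewrite setTI.
  have -> : g @^-1` `]c%:E, +oo[ =
      \bigcup_q (A q `&` [set x | c < ratr q]%R) `|` [set x | (c < 0)%R].
    apply/seteqP; split=> x; rewrite /preimage /= in_itv/= andbT.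
      move=> /ereal_sup_gt[_ [[q Aqx <-]|->]]; rewrite lte_fin => cq; last by right.
      by left; exists q.
    move=> [[q _ [Aqx cq]]|c0].
      apply: (@lt_le_trans _ _ (ratr q)%:E); first by rewrite lte_fin.
      by apply: ereal_sup_ubound; left; exists q.
    by apply: lt_le_trans (g0 x); rewrite lte_fin.
  have mP (P : Prop) : measurable [set x : T | P].
    have [h|h] := pselect P.
      by rewrite (_ : [set _ | _] = setT)//; apply/seteqP; split.
    by rewrite (_ : [set _ | _] = set0)//; apply/seteqP; split.
  apply: measurableU; last exact: mP.
  apply: bigcupT_measurable_rat => q; apply: measurableI; last exact: mP.
  by have [] := AN q.
- by move=> x; rewrite g0 gf.
- pose F k := if unpickle k is Some q then N q else set0.
  apply/(negligibleP _ mNN); apply: (@negligibleS _ _ _ mu (\bigcup_k F k)).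
    move=> x [q _ Nx]; exists (pickle q); first exact: I.
    by rewrite /F pickleK.
  apply: negligible_bigcup => k; rewrite /F; case: unpickle => [q|].
    by have [_ mN N0 _ _] := AN q; exists (N q); split.
  exact: negligible_set0.
(* A rational q strictly between g x and f x would put x in [A q] off the null set, whence q <= g
   x. *)
- move=> x Nx; apply/eqP; rewrite eq_le gf/= leNgt; apply/negP => gfx.
  have g1 : g x \is a fin_num.
    by rewrite ge0_fin_numE//; apply: lt_le_trans gfx _; exact: leey.
  have [q gq qf] : exists2 q : rat, g x < (ratr q)%:E & (ratr q)%:E < f x.
    move: gfx; rewrite -[g x]fineK//; case: (f x) (f0 x) => [r _|_ _|//].
      rewrite lte_fin => /rat_in_itvoo[q]; rewrite in_itv/= => /andP[q1 q2].
      by exists q; rewrite lte_fin.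
    have /rat_in_itvoo[q] : (fine (g x) < fine (g x) + 1)%R by rewrite ltrDl.
    rewrite in_itv/= => /andP[q1 q2]; exists q; rewrite ?lte_fin ?ltry//.
  have [_ _ _ _ h] := AN q.
  have [Aqx|Nqx] := h x qf; last by apply: Nx; exists q.
  by move: gq; rewrite ltNge => /negP; apply; apply: ereal_sup_ubound; left; exists q.
Qed.

End completion.

Section borel_reduction.
Variables (R : realType) (n : nat).

Lemma hl_maximal_borel (f : Rn R n -> \bar R) : lebesgue_measurable_fun f ->
  exists g : Rn R n -> \bar R, [/\ measurable_fun setT g, (forall x, 0 <= g x),
    (forall x, g x <= `|f x|) & hl_maximal f = hl_maximal g].
Proof.
move=> mf.
have mabs : measurable_fun
    [set: g_sigma_algebraType (completed_algebra_gen (lebesgue_Rn R n))] (fun x => `|f x|).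
  by apply: measurableT_comp => //; exact: mf.
have [g [N [mg g0f mN N0 gf]]] := measurable_lower_version (fun x => abse_ge0 (f x)) mabs.
have g0 x : 0 <= g x by have /andP[] := g0f x.
exists g; split=> //; first by move=> x; have /andP[] := g0f x.
apply/funext => x; rewrite /hl_maximal; congr ereal_sup.
apply: eq_imagel => B [bB Bx]; congr (_ * _).
have mB : measurable B by apply: box_open_measurable; exact: balls_open.
apply/eqP; rewrite eq_le; apply/andP; split; last first.
  apply: ge0_le_integral_raw => y _; first exact: abse_ge0.
  by rewrite gee0_abs//; have /andP[] := g0f y.
(* [|f|] may fail to be Borel; [h] is Borel, dominates it everywhere and equals [g] off the null
   set. *)
pose h y := g y + +oo * (\1_N y)%:E.
have mh : measurable_fun setT h.
  apply: emeasurable_funD => //; apply: measurable_funeM.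
  by apply/measurable_EFinP; exact: measurable_indic.
have h0 y : 0 <= h y by rewrite adde_ge0// mule_ge0// lee_fin.
apply: (@le_trans _ _ (\int[lebesgue_Rn R n]_(y in B) h y)).
  apply: ge0_le_integral_raw => y _; first exact: abse_ge0.
  have [yN|yN] := pselect (N y).
    by rewrite /h indicE mem_set// mule1 addey ?leey// -ltNye (lt_le_trans _ (g0 y)).
  by rewrite /h indicE memNset// mule0 adde0 gf.
rewrite le_eqVlt; apply/orP; left; apply/eqP.
apply: ge0_ae_eq_integral => //; try exact: measurable_funTS.
- by apply: measurable_funTS; exact: measurableT_comp.
- by exists N; split=> // y /= hy; apply: contrapT => Ny; apply: hy => _;
    rewrite /h indicE memNset// mule0 adde0 gee0_abs.
Qed.

End borel_reduction.

(** * Summation over the dyadic cubes *)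

Section esum_extra.
Variable R : realType.

Lemma esumZ_le (T : choiceType) (c : \bar R) (a : T -> \bar R) :
  0 <= c -> (forall x, 0 <= a x) ->
  \esum_(x in [set: T]) (c * a x) <= c * \esum_(x in [set: T]) a x.
Proof.
move=> c0 a0; apply: ge_ereal_sup => _ [A [finA _] <-].
rewrite -ge0_mule_fsumr//; apply: lee_wpmul2l => //.
by apply: ereal_sup_ubound; exists A.
Qed.

Lemma le_esum_subset (T : choiceType) (A : set T) (a : T -> \bar R) :
  (forall x, 0 <= a x) -> \esum_(x in A) a x <= \esum_(x in [set: T]) a x.
Proof.
by move=> a0; rewrite esum_mkcond; apply: le_esum => x _; case: ifP.
Qed.

Lemma esum_ge_term (T : choiceType) (a : T -> \bar R) x : (forall x, 0 <= a x) ->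
  a x <= \esum_(y in [set: T]) a y.
Proof.
by move=> a0; rewrite -[leLHS](@esum_set1 _ _ x a)//; exact: le_esum_subset.
Qed.

Lemma esum_exchange (T T' : choiceType) (a : T -> T' -> \bar R) :
  (forall x y, 0 <= a x y) ->
  \esum_(x in [set: T]) \esum_(y in [set: T']) a x y =
  \esum_(y in [set: T']) \esum_(x in [set: T]) a x y.
Proof.
move=> a0; rewrite !esum_esum//.
rewrite (@reindex_esum R _ _ ([set: T'] `*`` (fun=> [set: T])) _
  (fun z => (z.2, z.1)))//.
by split=> [z|z z' _ _ /= [e1 e2]|[x y] _]; [|case: z z' e1 e2 => ? ? [? ?] /= -> ->|exists (y, x)].
Qed.

Lemma sume_const (I : finType) (x : \bar R) : 0 <= x ->
  \sum_(i : I) x = #|I|%:R%:E * x.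
Proof.
by move=> x0; rewrite mule_natl; exact: sumr_const.
Qed.

(** [phi] is injective where the label [rho] is constant, so each y is reached at most #|D|
    times. *)
Lemma esum_fibre (T T' : choiceType) (D : finType) (phi : T -> T') (rho : T -> D)
    (g : T' -> \bar R) :
  (forall y, 0 <= g y) ->
  (forall x x', phi x = phi x' -> rho x = rho x' -> x = x') ->
  \esum_(x in [set: T]) g (phi x) <= #|D|%:R%:E * \esum_(y in [set: T']) g y.
Proof.
move=> g0 inj.
have -> : \esum_(x in [set: T]) g (phi x) =
    \esum_(x in [set: T]) \sum_(d : D) (if x \in [set x | rho x = d] then g (phi x) else 0).
  apply: eq_esum => x _; rewrite (bigD1 (rho x))//= mem_set// big1 ?adde0// => d dx.
  by rewrite memNset// => /esym e; rewrite e eqxx in dx.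
rewrite esum_sum; last by move=> x d _ _; case: ifP.
rewrite -sume_const; last exact: esum_ge0.
apply: lee_sum => d _; rewrite -esum_mkcond.
rewrite -(@esum_image R _ _ _ phi g); first exact: le_esum_subset.
by move=> x x'; rewrite !inE /= => xd x'd e; apply: inj => //; rewrite xd x'd.
Qed.

Lemma poweR_sum_le (I : finType) (x : I -> \bar R) (s : R) : (0 < s)%R ->
  (forall i, 0 <= x i) ->
  (\sum_i x i) `^ s <= (#|I|%:R `^ s)%:E * \sum_i (x i `^ s).
Proof.
move=> s0 x0; set M := \sum_i (x i `^ s).
have M0 : 0 <= M by apply: sume_ge0 => i _; exact: poweR_ge0.
have xM i : x i <= M `^ s^-1.
  rewrite -poweR_le_inv// /M (bigD1 i)//= leeDl// sume_ge0// => j _.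
  exact: poweR_ge0.
apply: (@le_trans _ _ ((#|I|%:R%:E * M `^ s^-1) `^ s)).
  apply: le_poweR; [exact: ltW|exact: sume_ge0|].
  by rewrite -sume_const ?poweR_ge0//; apply: lee_sum.
by rewrite poweRM ?poweR_ge0 ?lee_fin// poweRVK// gt_eqF.
Qed.

Lemma poweR_sup_le_esum (v : nat -> \bar R) (s : R) : (0 < s)%R -> (forall l, 0 <= v l) ->
  ereal_sup (range v) `^ s <= \esum_(l in [set: nat]) (v l `^ s).
Proof.
move=> s0 v0; rewrite poweR_ereal_sup//; apply: ge_ereal_sup => _ [l _ <-].
by apply: (esum_ge_term (a := fun l => v l `^ s)) => l'; exact: poweR_ge0.
Qed.

Lemma esum_geometric_le (q : R) : (0 <= q < 1)%R ->
  \esum_(l in [set: nat]) (q ^+ l)%:E <= ((1 - q)^-1)%:E.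
Proof.
move=> /andP[q0 q1]; rewrite -nneseries_esumT; last first.
  by move=> l; rewrite lee_fin exprn_ge0.
apply: lime_le; first by apply: is_cvg_nneseries => l _ _; rewrite lee_fin exprn_ge0.
apply: nearW => m; rewrite big_mkord sumEFin lee_fin.
have q1' : (0 < 1 - q)%R by rewrite subr_gt0.
rewrite -(ler_pM2l q1') mulfV ?gt_eqF//.
have := subrX1 q m; have := exprn_ge0 m q0.
by move: (\sum_(i < m) _)%R => S; nra.
Qed.

End esum_extra.

(** * Estimate of the terms of the norm of M f and their summation *)

Section bourgain_morrey_bounds.
Variables (R : realType) (n : nat) (p : n.-tuple R) (t : R).
Hypotheses (n0 : (0 < n)%N) (p1 : (forall i, 1 < tnth p i)%R) (t0 : (0 < t)%R).
Implicit Types (f : Rn R n -> \bar R) (j : int) (k : n.-tuple int) (l : nat).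
Local Notation S := (sum_inv p).
Local Notation nt := (n%:R / t)%R.

Lemma pow2z_powR j (s : R) : ((2 ^ j) `^ s = 2 `^ (j%:~R * s))%R.
Proof. by rewrite -powR_intmul// -powRrM. Qed.

Lemma pow2D (x y : R) : (2 `^ (x + y) = 2 `^ x * 2 `^ y)%R.
Proof. by rewrite powRD// pnatr_eq0 implybT. Qed.

(* [weight j] is the factor [|Q| ^ (1 / t - S / n)] of the cubes of side [2 ^ - j]. *)
Definition weight j : R := (2 `^ (- j%:~R * (nt - S)))%R.

Lemma weight_gt0 j : (0 < weight j)%R.
Proof. by rewrite powR_gt0. Qed.

Lemma weightE j k :
  lebesgue_Rn R n (dyadic_cube j k) `^ (1 / t - 1 / n%:R * S) = (weight j)%:E.
Proof.
rewrite measure_dyadic_cube poweR_EFin -powR_mulrn ?ltW ?exp2z_gt0//.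
rewrite -powRrM pow2z_powR /weight rmorphN/=; congr (_ `^ _)%:E.
by field; rewrite gt_eqF//= pnatr_eq0 -lt0n n0.
Qed.

Definition bnorm f j k : \bar R := (weight j)%:E * mixed_norm p (on_cube f j k).

Lemma bnorm_ge0 f j k : 0 <= bnorm f j k.
Proof. by rewrite mule_ge0 ?mixed_norm_ge0// lee_fin ltW ?weight_gt0. Qed.

(** On an ancestor of generation l, the Hoelder factor 2^((j-l)S) divided by [weight (j - l)] is
    2^(j n/t) times this number. *)
Definition decay l : R := (2 `^ (- (l%:R * nt)))%R.

Definition maximal_majorant f j k l : \bar R :=
  (decay l)%:E * \sum_nu bnorm f (j - l%:Z) (neighbour (ancestor l k) nu).

Lemma maximal_majorant_ge0 f j k l : 0 <= maximal_majorant f j k l.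
Proof.
by rewrite mule_ge0 ?lee_fin ?powR_ge0// sume_ge0// => nu _; exact: bnorm_ge0.
Qed.

Lemma ancestor0 k : ancestor 0 k = k.
Proof. by apply: eq_from_tnth => i; rewrite tnth_mktuple expr0 divz1. Qed.

(** [maximal_local] is applied with c = 2^(j n/t) U, U being the supremum. As [weight j] times
    2^(-jS) times 2^(j n/t) is 1, the large balls contribute U; the neighbours, which are the term l
    = 0, contribute at most U again, whence 2K. *)
Lemma bnorm_maximal : exists2 K : R, (0 < K)%R & forall f,
  measurable_fun setT f -> (forall x, 0 <= f x) ->
  (forall j k, mixed_norm p (on_cube f j k) < +oo) ->
  forall j k, bnorm (hl_maximal f) j k <=
    K%:E * ereal_sup (range (maximal_majorant f j k)).
Proof.
have [K K0 H] := maximal_local p1; exists (2 * K + 1)%R.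
  by rewrite ltr_wpDl// mulr_ge0.
move=> f mf f0 finF j k.
have K20 : (0 < 2 * K + 1)%R by rewrite ltr_wpDl// mulr_ge0.
set U := ereal_sup _.
have UM l : maximal_majorant f j k l <= U by apply: ereal_sup_ubound; exists l.
have U0 : 0 <= U := le_trans (maximal_majorant_ge0 f j k 0) (UM 0%N).
have [->|Uoo] := eqVneq U +oo; first by rewrite gt0_muley ?leey ?lte_fin.
have Ufin : U \is a fin_num by rewrite ge0_fin_numE// lt_neqAle Uoo leey.
pose u := fine U; have UE : U = u%:E by rewrite /u fineK.
have u0 : (0 <= u)%R by rewrite fine_ge0.
pose P := (2 `^ (j%:~R * nt))%R : R.
have P0 : (0 < P)%R by rewrite powR_gt0.
have h := H f j k _ mf f0 (finF j) (mulr_ge0 (ltW P0) u0).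
apply: (@le_trans _ _ ((weight j)%:E * (K%:E *
    (\sum_nu mixed_norm p (on_cube f j (neighbour k nu)) +
      ((2 ^ (- j)) `^ S * (P * u))%:E)))).
  apply: lee_wpmul2l; first by rewrite lee_fin ltW ?weight_gt0.
  apply: h => l l0.
  apply: (@le_trans _ _ (\sum_nu (P * decay l)%:E *
      bnorm f (j - l%:Z) (neighbour (ancestor l k) nu))).
    apply: lee_sum => nu _.
    apply: (le_trans (integral_cube_le p1 _ _ mf f0)).
    rewrite /bnorm muleA -EFinM lee_wpmul2r ?mixed_norm_ge0// lee_fin.
    rewrite pow2z_powR /P /decay /weight -!pow2D le_eqVlt; apply/orP; left; apply/eqP.
    by congr (_ `^ _)%R; rewrite rmorphB/=; ring.
  rewrite -ge0_sume_distrr; last by move=> nu _; exact: bnorm_ge0.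
  rewrite EFinM -muleA [X in _ <= X]EFinM lee_wpmul2l ?lee_fin ?(ltW P0)//.
  by rewrite -UE; exact: UM.
rewrite muleCA ge0_muleDr; last 2 first.
- by apply: sume_ge0 => nu _; exact: mixed_norm_ge0.
- by rewrite lee_fin !mulr_ge0 ?powR_ge0// ltW.
have -> : (weight j)%:E * ((2 ^ (- j)) `^ S * (P * u))%:E = U.
  rewrite -EFinM UE; congr EFin; rewrite pow2z_powR /weight /P !mulrA -!pow2D rmorphN/=.
  by rewrite (_ : _ + _ + _ = 0)%R ?powRr0 ?mul1r//; ring.
rewrite ge0_sume_distrr; last by move=> nu _; exact: mixed_norm_ge0.
have h0 : \sum_nu bnorm f j (neighbour k nu) <= U.
  apply: le_trans (UM 0%N); rewrite /maximal_majorant ancestor0 subr0.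
  by rewrite /decay mul0r oppr0 powRr0 mul1e.
apply: (@le_trans _ _ (K%:E * (U + U))).
  by rewrite lee_wpmul2l ?lee_fin// leeD2r.
rewrite UE -EFinD -!EFinM lee_fin; nra.
Qed.

Lemma decay_le1 l : (decay l <= 1)%R.
Proof.
rewrite -(powRr0 2) /decay ler_powR ?ler1n// oppr_le0 mulr_ge0// divr_ge0// ltW//.
Qed.

Lemma residue_lt (d : nat) (z : int) : (0 < d)%N -> (absz (z %% d%:Z)%Z < d)%N.
Proof. by move=> d0; rewrite -ltz_nat gez0_abs ?modz_ge0 ?ltz_pmod -?lt0n. Qed.

Lemma maximal_majorant_esum (s : R) : (t < s)%R ->
  exists2 K : R, (0 < K)%R & forall f,
  \esum_(x in [set: int * n.-tuple int])
    (ereal_sup (range (maximal_majorant f x.1 x.2)) `^ s) <=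
  K%:E * \esum_(x in [set: int * n.-tuple int]) (bnorm f x.1 x.2 `^ s).
Proof.
move=> ts; have s0 : (0 < s)%R by rewrite (lt_trans t0).
pose Nn := #|{: n.-tuple 'I_3}|.
have Nn0 : (0 < Nn)%N by rewrite /Nn card_tuple card_ord expn_gt0.
pose q := (2 `^ (n%:R - nt * s))%R : R.
have q0 : (0 <= q)%R by rewrite powR_ge0.
have q1 : (q < 1)%R.
  rewrite /q -opprB two_powRN_lt1// subr_gt0 mulrAC ltr_pdivlMr// ltr_pM2l//.
  by rewrite ltr0n.
pose C l : R := (decay l `^ s * Nn%:R `^ s)%R.
have C0 l : (0 <= C l)%R by rewrite mulr_ge0 ?powR_ge0.
pose K := (Nn%:R * Nn%:R `^ s * (1 - q)^-1)%R : R.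
have K0 : (0 < K)%R.
  by rewrite !mulr_gt0 ?powR_gt0 ?invr_gt0 ?subr_gt0 ?ltr0n.
exists K => // f; set B := \esum_(x in _) (bnorm f x.1 x.2 `^ s).
have B0 : 0 <= B by apply: esum_ge0 => x _; exact: poweR_ge0.
pose phi l (nu : n.-tuple 'I_3) (x : int * n.-tuple int) :=
  ((x.1 - l%:Z)%R, neighbour (ancestor l x.2) nu).
pose b (x : int * n.-tuple int) := bnorm f x.1 x.2 `^ s.
have b0 x : 0 <= b x by exact: poweR_ge0.
have term0 l nu x : 0 <= (C l)%:E * b (phi l nu x) by rewrite mule_ge0 ?lee_fin.
apply: (@le_trans _ _ (\esum_(x in [set: int * n.-tuple int]) \esum_(l in [set: nat])
    \sum_nu (C l)%:E * b (phi l nu x))).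
  apply: le_esum => x _.
  apply: le_trans (poweR_sup_le_esum s0 (maximal_majorant_ge0 f x.1 x.2)) _.
  apply: le_esum => l _; rewrite /maximal_majorant poweRM ?lee_fin ?powR_ge0//; last first.
    by apply: sume_ge0 => nu _; exact: bnorm_ge0.
  rewrite -[leRHS]ge0_sume_distrr// poweR_EFin /C EFinM -muleA lee_wpmul2l ?lee_fin ?powR_ge0//.
  by apply: poweR_sum_le => // nu; exact: bnorm_ge0.
rewrite esum_exchange; last by move=> x l; exact: sume_ge0.
have fib l nu : \esum_(x in [set: int * n.-tuple int]) b (phi l nu x) <=
    ((2 ^ l) ^ n)%N%:R%:E * B.
  have d0 : (0 < 2 ^ l)%N by rewrite expn_gt0.
  (* The residues of k modulo 2^l label the cubes that have the same ancestor. *)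
  pose rho (x : int * n.-tuple int) : n.-tuple 'I_(2 ^ l) :=
    [tuple Ordinal (residue_lt (tnth x.2 i) d0) | i < n].
  have := @esum_fibre R _ _ _ (phi l nu) rho b b0.
  rewrite card_tuple card_ord; apply=> -[j k] [j' k'] E er.
  have /addIr -> : (j - l%:Z = j' - l%:Z)%R := congr1 fst E.
  congr pair; apply: eq_from_tnth => i.
  have := congr1 (fun x => tnth x.2 i) E; rewrite !tnth_mktuple => /addIr /addIr eq1.
  have := congr1 (fun x : n.-tuple 'I_(2 ^ l) => nat_of_ord (tnth x i)) er; rewrite !tnth_mktuple /= => eq2.
  have dE : (2 ^+ l = (2 ^ l)%N%:Z :> int)%R by rewrite -natz natrX.
  rewrite dE in eq1.
  rewrite (divz_eq (tnth k i) (2 ^ l)%N%:Z) (divz_eq (tnth k' i) (2 ^ l)%N%:Z) eq1.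
  congr +%R; have m0 (z : int) : (0 <= (z %% (2 ^ l)%N%:Z)%Z)%R.
    by rewrite modz_ge0// eqz_nat -lt0n.
  by rewrite -(gez0_abs (m0 (tnth k i))) -(gez0_abs (m0 (tnth k' i))) eq2.
apply: (@le_trans _ _ (\esum_(l in [set: nat])
    ((Nn%:R * Nn%:R `^ s)%:E * B) * (q ^+ l)%:E)).
  apply: le_esum => l _; rewrite esum_sum//.
  apply: (@le_trans _ _ (\sum_(nu : n.-tuple 'I_3) (C l)%:E * (((2 ^ l) ^ n)%N%:R%:E * B))).
    apply: lee_sum => nu _; apply: le_trans (esumZ_le _ _) _ => //.
      by rewrite lee_fin.
    by rewrite lee_wpmul2l ?lee_fin.
  rewrite sume_const; last by rewrite !mule_ge0// lee_fin.
  rewrite [leRHS]muleAC -EFinM !muleA -!EFinM lee_wpmul2r// lee_fin.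
  rewrite le_eqVlt; apply/orP; left; apply/eqP.
  have -> : (q ^+ l = decay l `^ s * ((2 ^ l) ^ n)%N%:R)%R.
    rewrite /q /decay -powR_mulrn ?powR_ge0// -!powRrM !natrX -exprM -powR_mulrn//.
    by rewrite -pow2D; congr (_ `^ _)%R; rewrite natrM; ring.
  by rewrite /C /Nn; ring.
apply: (le_trans (esumZ_le _ _)).
- by rewrite mule_ge0// lee_fin mulr_ge0 ?powR_ge0.
- by move=> l; rewrite lee_fin exprn_ge0.
rewrite muleAC lee_wpmul2r// /K [leRHS]EFinM.
rewrite lee_wpmul2l ?lee_fin ?mulr_ge0 ?powR_ge0//.
by apply: esum_geometric_le; rewrite q0.
Qed.

End bourgain_morrey_bounds.

Section bourgain_morrey_norm_theory.
Variables (R : realType) (n : nat) (p : n.-tuple R) (t : R).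
Hypotheses (n0 : (0 < n)%N) (p1 : (forall i, 1 < tnth p i)%R) (t0 : (0 < t)%R).
Implicit Types (f g : Rn R n -> \bar R) (s : R).
Local Notation index := (int * n.-tuple int)%type.
Local Notation bnormi f x := (bnorm p t f x.1 x.2).

Lemma bourgain_morrey_norm_fin s f : (0 < s)%R ->
  bourgain_morrey_norm p t s%:E f =
  (\esum_(x in [set: index]) (bnormi f x `^ s)) `^ s^-1.
Proof.
move=> s0; rewrite /bourgain_morrey_norm; congr (_ `^ _).
rewrite (@reindex_esum R _ _ [set: index] _
  (fun x => dyadic_cube x.1 x.2 : set (Rn R n))); last first.
  split=> [[j k] _|[j k] [j' k'] _ _ /(dyadic_cube_inj n0)[/= e e']|_ [j [k ->]]].
  - by exists j, k.
  - by rewrite e e'.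
  - by exists (j, k).
apply: eq_esum => -[j k] _ /=.
have -> : (s / t - s / n%:R * sum_inv p = (1 / t - 1 / n%:R * sum_inv p) * s)%R by ring.
by rewrite poweRrM weightE// -poweRM ?mixed_norm_ge0// lee_fin ltW ?weight_gt0.
Qed.

Lemma bourgain_morrey_norm_sup f :
  bourgain_morrey_norm p t +oo f = ereal_sup (range (fun x : index => bnormi f x)).
Proof.
rewrite /bourgain_morrey_norm; congr ereal_sup; apply/seteqP; split.
  by move=> _ [_ [j [k ->]] <-]; exists (j, k); rewrite //= weightE.
by move=> _ [[j k] _ <-]; exists (dyadic_cube j k); [exists j, k|rewrite weightE].
Qed.

Lemma le_bnorm f g j k : (forall x, `|f x| <= `|g x|) -> bnorm p t f j k <= bnorm p t g j k.
Proof.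
move=> fg; rewrite lee_wpmul2l ?lee_fin ?(ltW (weight_gt0 _ _ _))//.
apply: le_mixed_norm => [i|x]; first exact: lt_trans (p1 i).
by rewrite /on_cube !abseM lee_wpmul2r.
Qed.

Lemma bnorm_lty f j k : bnorm p t f j k < +oo -> mixed_norm p (on_cube f j k) < +oo.
Proof.
apply: contraTT; rewrite -!leNgt !leye_eq /bnorm => /eqP ->.
by rewrite gt0_muley// lte_fin weight_gt0.
Qed.

Section sum_norm.
Variable s : R.
Hypothesis ts : (t < s)%R.
Let s0 : (0 < s)%R := lt_trans t0 ts.
Let esum_bnorm_ge0 f : 0 <= \esum_(x in [set: index]) (bnormi f x `^ s).
Proof. by apply: esum_ge0 => x _; exact: poweR_ge0. Qed.

Lemma le_bourgain_morrey_norm_fin f g : (forall x, `|f x| <= `|g x|) ->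
  bourgain_morrey_norm p t s%:E f <= bourgain_morrey_norm p t s%:E g.
Proof.
move=> fg; rewrite !bourgain_morrey_norm_fin//.
apply: le_poweR; rewrite ?invr_ge0 ?(ltW s0)// ?esum_bnorm_ge0//.
apply: le_esum => x _; apply: le_poweR; rewrite ?bnorm_ge0 ?(ltW s0)//.
exact: le_bnorm.
Qed.

Lemma bourgain_morrey_norm_fin_lty f j k :
  bourgain_morrey_norm p t s%:E f < +oo -> mixed_norm p (on_cube f j k) < +oo.
Proof.
rewrite bourgain_morrey_norm_fin// => foo; apply: bnorm_lty.
apply: le_lt_trans foo; rewrite -poweR_le_inv ?bnorm_ge0//.
by apply: (esum_ge_term (a := fun x : index => bnormi f x `^ s) (j, k)) => x; exact: poweR_ge0.
Qed.

Lemma bourgain_morrey_maximal_fin : exists2 C : R, (0 <= C)%R & forall f,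
  measurable_fun setT f -> (forall x, 0 <= f x) ->
  bourgain_morrey_norm p t s%:E f < +oo ->
  bourgain_morrey_norm p t s%:E (hl_maximal f) <=
    C%:E * bourgain_morrey_norm p t s%:E f.
Proof.
have [K K0 HK] := bnorm_maximal t p1.
have [L L0 HL] := maximal_majorant_esum p n0 t0 ts.
exists (K * L `^ s^-1)%R; first by rewrite mulr_ge0 ?powR_ge0// ltW.
move=> f mf f0 foo.
have finF j k := bourgain_morrey_norm_fin_lty j k foo.
rewrite !bourgain_morrey_norm_fin// EFinM -muleA.
have U0 (x : index) : 0 <= ereal_sup (range (maximal_majorant p t f x.1 x.2)).
  by apply: le_trans (maximal_majorant_ge0 p t f x.1 x.2 0) _; apply: ereal_sup_ubound; exists 0%N.
apply: (@le_trans _ _ (((K `^ s)%:E * (L%:E * \esum_(x in [set: index]) (bnormi f x `^ s))) `^ s^-1)).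
  apply: le_poweR; rewrite ?invr_ge0 ?(ltW s0)// ?esum_bnorm_ge0//.
  apply: le_trans (_ : \esum_(x in [set: index])
     ((K `^ s)%:E * (ereal_sup (range (maximal_majorant p t f x.1 x.2)) `^ s)) <= _).
    apply: le_esum => x _; rewrite -poweR_EFin -poweRM ?lee_fin ?(ltW K0)//.
    by apply: le_poweR; rewrite ?bnorm_ge0 ?(ltW s0)//; exact: HK.
  apply: le_trans (esumZ_le _ _) _; [by rewrite lee_fin powR_ge0|by move=> x; exact: poweR_ge0|].
  by rewrite lee_wpmul2l ?lee_fin ?powR_ge0//; exact: HL.
rewrite poweRM ?lee_fin ?powR_ge0 ?mule_ge0 ?lee_fin ?(ltW L0)//.
by rewrite -poweR_EFin poweRK ?gt_eqF// ?lee_fin ?(ltW K0)// poweRM// ?lee_fin ltW.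
Qed.

End sum_norm.

Lemma le_bourgain_morrey_norm_sup f g : (forall x, `|f x| <= `|g x|) ->
  bourgain_morrey_norm p t +oo f <= bourgain_morrey_norm p t +oo g.
Proof.
move=> fg; rewrite !bourgain_morrey_norm_sup; apply: ge_ereal_sup => _ [x _ <-].
apply: le_trans (le_bnorm x.1 x.2 fg) _.
by apply: ereal_sup_ubound; exists x.
Qed.

(** Without a sum over cubes, [decay l <= 1] is enough: each majorant is at most 3^n times the
    supremum. *)
Lemma bourgain_morrey_maximal_sup : exists2 C : R, (0 <= C)%R & forall f,
  measurable_fun setT f -> (forall x, 0 <= f x) ->
  bourgain_morrey_norm p t +oo f < +oo ->
  bourgain_morrey_norm p t +oo (hl_maximal f) <=
    C%:E * bourgain_morrey_norm p t +oo f.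
Proof.
have [K K0 HK] := bnorm_maximal t p1.
exists (K * #|{: n.-tuple 'I_3}|%:R)%R; first by rewrite mulr_ge0 ?ler0n// ltW.
move=> f mf f0; rewrite !bourgain_morrey_norm_sup; set B := ereal_sup _ => Boo.
have fB j k : bnorm p t f j k <= B by apply: ereal_sup_ubound; exists (j, k).
apply: ge_ereal_sup => _ [[j k] _ <-] /=.
apply: le_trans (HK f mf f0 _ j k) _.
  by move=> j' k'; apply: bnorm_lty; exact: le_lt_trans (fB j' k') Boo.
rewrite EFinM -muleA lee_wpmul2l ?lee_fin ?(ltW K0)//.
apply: ge_ereal_sup => _ [l _ <-].
rewrite /maximal_majorant -[leRHS]mul1e -sume_const; last first.
  exact: le_trans (bnorm_ge0 p t f j k) (fB j k).
apply: lee_pmul; rewrite ?lee_fin ?powR_ge0 ?decay_le1//.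
  by apply: sume_ge0 => nu _; exact: bnorm_ge0.
by apply: lee_sum => nu _; exact: fB.
Qed.

End bourgain_morrey_norm_theory.

Theorem theorem6p3 (R : realType) (n : nat) (p : n.-tuple R) (t : R)
    (r : \bar R) (hn : (0 < n)%N) (hp : forall i : 'I_n, (1 < tnth p i)%R)
    (htr : [/\ (1 < n%:R / sum_inv p)%R, (n%:R / sum_inv p < t)%R,
               t%:E < r & r < +oo] \/
           [/\ (1 < n%:R / sum_inv p)%R, (n%:R / sum_inv p <= t)%R
             & r = +oo]) :
  exists C : R, (0 <= C)%R /\
    forall f : Rn R n -> \bar R, bourgain_morrey p t r f ->
      bourgain_morrey p t r (hl_maximal f) /\
      bourgain_morrey_norm p t r (hl_maximal f) <=
        C%:E * bourgain_morrey_norm p t r f.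
Proof.
have t0 : (0 < t)%R by case: htr => -[? ? *]; lra.
(* For both ranges of r, a bound on nonnegative Borel functions suffices: monotonicity carries it
   from the Borel minorant of |f|, which has the same maximal function, to f. *)
suff [[C C0 HC] mono] : (exists2 C : R, (0 <= C)%R & forall f,
    measurable_fun setT f -> (forall x, 0 <= f x) ->
    bourgain_morrey_norm p t r f < +oo ->
    bourgain_morrey_norm p t r (hl_maximal f) <=
      C%:E * bourgain_morrey_norm p t r f) /\
    (forall f g, (forall x, `|f x| <= `|g x|) ->
      bourgain_morrey_norm p t r f <= bourgain_morrey_norm p t r g).
  exists C; split=> // f [mf foo].
  have [g [mg g0 gf ->]] := hl_maximal_borel mf.
  have gfn : bourgain_morrey_norm p t r g <= bourgain_morrey_norm p t r f.
    by apply: mono => x; rewrite (gee0_abs (g0 x)).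
  have le : bourgain_morrey_norm p t r (hl_maximal g) <=
      C%:E * bourgain_morrey_norm p t r f.
    apply: le_trans (HC g mg g0 (le_lt_trans gfn foo)) _.
    by rewrite lee_wpmul2l ?lee_fin.
  split=> //; split.
    by apply: measurable_completed; exact: measurable_hl_maximal.
  by apply: le_lt_trans le _; rewrite lte_mul_pinfty ?lee_fin.
case: htr => [[_ _]|[_ _ ->]]; last first.
  split; first exact: bourgain_morrey_maximal_sup.
  by move=> f g; exact: le_bourgain_morrey_norm_sup.
case: r => [s| |]//; rewrite lte_fin => ts _; split.
  exact: bourgain_morrey_maximal_fin.
by move=> f g; exact: le_bourgain_morrey_norm_fin.
Qed.
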